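(* Suppose $f:\mathbb{R}^d\to\mathbb{R}$ is continuously differentiable with $L$-Lipschitz continuous gradient, and let $f^*=\min_{x\in\mathbb{R}^d}f(x)$. Let $\epsilon>0$, $\delta_S^{(2)}>0$, $\epsilon_S\in(0,1)$, $\delta_1>0$ and $l\in\mathbb{N}^+$ be such that $$\delta_S<\frac{c}{(c+1)^2},\qquad\left[(1-\delta_S)(1-\delta_1)-1+\frac{c}{(c+1)^2}\right]^{-1}>0,$$ where $\delta_S=e^{-l\epsilon_S^2/4}+\delta_S^{(2)}$. Put $S_{max}=1+\sqrt{\frac dl}+\sqrt{\frac{2\log(1/\delta_S^{(2)})}{l}}$. Run the random subspace trust region algorithm of the context, with $\mathcal{S}$ the distribution of scaled Gaussian matrices in $\mathbb{R}^{l\times d}$, for $N$ iterations with $$N\ge\left[(1-\delta_S)(1-\delta_1)-1+\frac{c}{(c+1)^2}\right]^{-1}\left[\frac{f(x_0)-f^*}{h_\epsilon}+\frac{\tau_\alpha}{1+c}\right],$$ where $$h_\epsilon=\theta C_7(1-\epsilon_S)\epsilon^2\gamma_1^{c+1}\min\left\{\min\left(\frac{C_7(1-\theta)}{(L+\frac12B_{max})S_{max}^2},\frac1{B_{max}}\right),\ \frac{\alpha_0}{(1-\epsilon_S)^{1/2}\epsilon\gamma_2}\right\},$$ $$\tau_\alpha=\left\lceil\log_{\gamma_1}\left(\min\left\{\frac{\alpha_{low}}{\alpha_0},\frac1{\gamma_2}\right\}\right)\right\rceil,\qquad\alpha_{low}=(1-\epsilon_S)^{1/2}\epsilon\min\left(\frac{C_7(1-\theta)}{(L+\frac12B_{max})S_{max}^2},\frac1{B_{max}}\right).$$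 Then $$\mathbb{P}(N\ge N_\epsilon)\ge1-e^{-\frac{\delta_1^2}{2}(1-\delta_S)N},\qquad\text{where }N_\epsilon=\min\{k:\|\nabla f(x_k)\|_2\le\epsilon\}.$$
   Context: Scaled Gaussian matrix: $S\in\mathbb{R}^{l\times d}$ with independent $N(0,1/l)$ entries. Random subspace trust region algorithm. Parameters: a distribution $\mathcal{S}$ of matrices in $\mathbb{R}^{l\times d}$ ($l\le d$), $\gamma_1\in(0,1)$, $\gamma_2=\gamma_1^{-c}$ for some $c\in\mathbb{N}^+$, $\theta\in(0,1)$, $\alpha_{\max},B_{max}>0$, an iteration-independent constant $C_7>0$, deterministic $x_0\in\mathbb{R}^d$, $\alpha_0=\alpha_{\max}\gamma_1^p$ for some $p\in\mathbb{N}^+$. At each iteration $k=0,1,\dots$: 1. Draw $S_k$ from $\mathcal{S}$, independently of all previous iterations. Let $\hat m_k(\hat s)=f(x_k)+\langle S_k\nabla f(x_k),\hat s\rangle+\frac12\langle\hat s,S_kB_kS_k^T\hat s\rangle$ for $\hat s\in\mathbb{R}^l$, where $B_k\in\mathbb{R}^{d\times d}$ is a user-provided (symmetric) matrix with $\|B_k\|_2\le B_{max}$. Compute $\hat s_k$ such that $\|\hat s_k\|_2\le\alpha_k$ and $\hat m_k(0)-\hat m_k(\hat s_k)\ge C_7\|S_k\nabla f(x_k)\|_2\min\{\alpha_k,\|S_k\nabla f(x_k)\|_2/\|B_k\|_2\}$, and set $s_k=S_k^T\hat s_k$. 2. Sufficient decrease test: $f(x_k)-f(x_k+s_k)\ge\theta[\hat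 m_k(0)-\hat m_k(\hat s_k)]$. 3. If the test holds, set $x_{k+1}=x_k+s_k$, $\alpha_{k+1}=\min\{\alpha_{\max},\gamma_2\alpha_k\}$; otherwise $x_{k+1}=x_k$, $\alpha_{k+1}=\gamma_1\alpha_k$. *)

(* Defs.v *)
From HB Require Import structures.
From mathcomp Require Import all_boot all_order all_algebra.
From mathcomp Require Import all_classical all_reals all_analysis.

Set Implicit Arguments.
Unset Strict Implicit.
Unset Printing Implicit Defensive.

Import Order.TTheory GRing.Theory Num.Theory.
Import numFieldNormedType.Exports.

Local Open Scope classical_set_scope.
Local Open Scope ring_scope.

Section Euclidean.
Context {R : realType}.

Definition dot {n : nat} (u v : 'cV[R]_n) : R := \sum_i u i 0 * v i 0.

(* The norm that the library puts on matrices is the sup norm, hence this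
   separate Euclidean norm. *)
Definition enorm {n : nat} (u : 'cV[R]_n) : R := Num.sqrt (dot u u).

Definition opnorm {m n : nat} (A : 'M[R]_(m, n)) : R :=
  sup [set enorm (A *m u) | u in [set u : 'cV[R]_n | enorm u <= 1]].

Definition gradient {n : nat} (f : 'cV[R]_n -> R) (x : 'cV[R]_n) : 'cV[R]_n :=
  \col_i 'D_(delta_mx i 0) f x.

Definition continuously_differentiable {n : nat} (f : 'cV[R]_n -> R) : Prop :=
  (forall x, differentiable f x) /\ continuous (gradient f).

Definition lipschitz_gradient {n : nat} (L : R) (f : 'cV[R]_n -> R) : Prop :=
  forall x y, enorm (gradient f x - gradient f y) <= L * enorm (x - y).

Definition logb (b y : R) : R := ln y / ln b.

End Euclidean.

Section RandomMatrices.
Context {disp : measure_display} {T : measurableType disp} {R : realType}.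
Implicit Type P : probability T R.

Definition entry {m n : nat} (X : T -> 'M[R]_(m, n)) (ij : 'I_m * 'I_n) : T -> R :=
  fun w => X w ij.1 ij.2.

Definition random_matrix {m n : nat} (X : T -> 'M[R]_(m, n)) : Prop :=
  forall ij, measurable_fun setT (entry X ij).

Definition entry_events {m n : nat} (X : T -> 'M[R]_(m, n)) : set (set T) :=
  \bigcup_ij preimage_set_system setT (entry X ij) measurable.

Definition mutually_independent P {I : finType} (X : I -> T -> R) : Prop :=
  forall (J : {set I}) (U : I -> set R), (forall i, measurable (U i)) ->
    P (\bigcap_(i in [set` J]) (X i @^-1` U i)) =
    (\prod_(i in J) P (X i @^-1` U i))%E.

Definition independent_systems P (F G : set (set T)) : Prop :=
  forall A B, F A -> G B -> P (A `&` B) = (P A * P B)%E.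

(* The second parameter of normal_prob is the standard deviation. *)
Definition scaled_gaussian P {l d : nat} (S : T -> 'M[R]_(l, d)) : Prop :=
  [/\ random_matrix S,
      forall ij (U : set R), measurable U ->
        P (entry S ij @^-1` U) = normal_prob 0 (Num.sqrt (l%:R^-1)) U
    & mutually_independent P (entry S)].

End RandomMatrices.

Section TrustRegion.
Context {R : realType} {l d : nat}.
Variables (f : 'cV[R]_d -> R) (alpha_max gamma1 gamma2 theta Bmax C7 : R).

Definition tr_model (S : 'M[R]_(l, d)) (B : 'M[R]_d) (x : 'cV[R]_d)
    (s : 'cV[R]_l) : R :=
  f x + dot (S *m gradient f x) s + 2^-1 * dot s (S *m B *m S^T *m s).

(* min {alpha, g / b}, where g / b is read as +oo when b = 0 (the library's
   division would give 0). *)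
Definition min_ratio (alpha g b : R) : R :=
  if b == 0 then alpha else Num.min alpha (g / b).

(* One iteration, on one realization, from (x, alpha) to (x', alpha'). *)
Definition tr_iteration (S : 'M[R]_(l, d)) (B : 'M[R]_d) (shat : 'cV[R]_l)
    (x : 'cV[R]_d) (alpha : R) (x' : 'cV[R]_d) (alpha' : R) : Prop :=
  let g := enorm (S *m gradient f x) in
  let decrease := tr_model S B x 0 - tr_model S B x shat in
  let s := S^T *m shat in
  [/\ B^T = B /\ opnorm B <= Bmax,
      enorm shat <= alpha,
      decrease >= C7 * g * min_ratio alpha g (opnorm B)
    & if f x - f (x + s) >= theta * decrease
      then x' = x + s /\ alpha' = Num.min alpha_max (gamma2 * alpha)
      else x' = x /\ alpha' = gamma1 * alpha].

End TrustRegion.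

Section RandomTrustRegion.
Context {disp : measure_display} {T : measurableType disp} {R : realType}.
Context {l d : nat}.
Variable P : probability T R.

(* Sigma-algebra of the iterations j < k. The iterates x_j and radii alpha_j,
   j <= k, are functions of these data, since x_0 and alpha_0 are
   deterministic. *)
Definition history (S : nat -> T -> 'M[R]_(l, d)) (B : nat -> T -> 'M[R]_d)
    (shat : nat -> T -> 'cV[R]_l) (k : nat) : set (set T) :=
  <<s \bigcup_(j in `I_k)
        (entry_events (S j) `|` entry_events (B j) `|` entry_events (shat j)) >>.

(* A run of N iterations with Gaussian sketches. B_k and shat_k may depend
   arbitrarily, but measurably, on the sample point. *)
Record tr_run (f : 'cV[R]_d -> R) (alpha_max gamma1 gamma2 theta Bmax C7 : R)
    (x0 : 'cV[R]_d) (alpha0 : R) (N : nat)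
    (S : nat -> T -> 'M[R]_(l, d)) (B : nat -> T -> 'M[R]_d)
    (shat : nat -> T -> 'cV[R]_l)
    (x : nat -> T -> 'cV[R]_d) (alpha : nat -> T -> R) : Prop := {
  tr_run_gaussian : forall k, (k < N)%N -> scaled_gaussian P (S k) ;
  tr_run_B : forall k, (k < N)%N -> random_matrix (B k) ;
  tr_run_shat : forall k, (k < N)%N -> random_matrix (shat k) ;
  tr_run_indep : forall k, (k < N)%N ->
    independent_systems P <<s entry_events (S k) >> (history S B shat k) ;
  tr_run_init : forall w, x 0%N w = x0 /\ alpha 0%N w = alpha0 ;
  tr_run_step : forall k w, (k < N)%N ->
    tr_iteration f alpha_max gamma1 gamma2 theta Bmax C7
      (S k w) (B k w) (shat k w) (x k w) (alpha k w) (x k.+1 w) (alpha k.+1 w)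
}.

(* Equal to +oo when no iterate qualifies. *)
Definition N_eps (f : 'cV[R]_d -> R) (eps : R) (x : nat -> 'cV[R]_d) : \bar R :=
  ereal_inf [set (k%:R)%:E | k in [set k | enorm (gradient f (x k)) <= eps]].

End RandomTrustRegion.

(* Main.v *)
Require Import Defs.
From HB Require Import structures.
From mathcomp Require Import all_boot all_order all_algebra.
From mathcomp Require Import all_classical all_reals all_analysis.
From mathcomp Require Import measurable_realfun zify ring lra.

Set Implicit Arguments.
Unset Strict Implicit.
Unset Printing Implicit Defensive.

Import Order.TTheory GRing.Theory Num.Theory.
Import numFieldNormedType.Exports.

Local Open Scope classical_set_scope.
Local Open Scope ring_scope.

(* Call iteration k good if its sketch satisfies |S g|^2 >= (1 - eps_S) |g|^2
   for g = grad f(x_k), and |S^T s| <= S_max |s| for every s.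

   Given the past, an iteration is not good with probability at most delta_S.
   The lower tail of |S v| is the usual exponential moment bound; it passes from
   fixed directions to the random direction g by rounding g to a countable set.
   The operator norm is the supremum of the Gaussian process v^T S u. By a
   Lindeberg exchange of Gaussian variables (a smooth form of Slepian's
   inequality), the mean softmax of v^T S u plus an independent Gaussian is at
   most that of <h, u> + <h', v>; this gives the Davidson-Szarek tail on finite
   nets, hence on a dense set of directions. A Chernoff bound for the number of
   good iterations follows.

   While the gradient is larger than eps, a good iteration with radius at most
   alpha_low succeeds, and a good success whose radius is not too small lowers f
   by h_eps. With alpha_k = alpha_max gamma_1^(a_k), the potentials
   min(a_k, p + tau) and max(a_k, p + tau) then bound the number of good
   iterations, below what the Chernoff bound allows. *)

(** * Gaussian integrals *)

Section NormalIntegrals.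
Context {R : realType}.
Notation mu := (@lebesgue_measure R).
Implicit Types (m s t z : R).

(** The softmax [(\sum_k exp(beta x_k))^(lam / beta)] of [m] values costs only a factor
    [m^(lam / beta)], which tends to 1 as [beta] grows with [lam] fixed; the size of the net thus
    disappears before the net is refined. The Gaussian vectors of the comparison are never
    constructed: each is a list of directions, and its expectation is a composition of
    one-dimensional Gaussian integral operators acting on functions. The exchange becomes algebra
    with commuting monotone operators, and no enlargement of the probability space is needed for the
    auxiliary Gaussians. Softmax being unbounded, all errors are relative, that is multiples of
    softmax itself, and so survive iteration. The iterates depend on all earlier sketches, and [B_k]
    and [shat_k] may depend on the current one too; the conditional probability of a failure is
    therefore expressed through its intersections with events of the past. *)

Lemma ge0_integral_normal_prob m s (f : _ -> \bar R) :
  measurable_fun [set: R] f -> (forall z, (0 <= f z)%E) ->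
  (\int[normal_prob m s]_z f z = \int[mu]_z (f z * (normal_pdf m s z)%:E))%E.
Proof.
move=> mf f0.
have dom := normal_prob_dominates m s.
rewrite -(Radon_Nikodym_SigmaFinite.change_of_variables dom)//.
have mpdf : measurable_fun [set: R] (fun z => (normal_pdf m s z)%:E).
  by apply/measurable_EFinP; exact: measurable_normal_pdf.
apply: ge0_ae_eq_integral => //.
- apply: emeasurable_funM => //.
  exact: measurable_int (Radon_Nikodym_SigmaFinite.f_integrable _).
- by apply: emeasurable_funM.
- by move=> z _; rewrite mule_ge0// Radon_Nikodym_SigmaFinite.f_ge0.
- by move=> z _; rewrite mule_ge0// lee_fin normal_pdf_ge0.
apply: ae_eqe_mul2l; apply: integral_ae_eq => //.
- exact: Radon_Nikodym_SigmaFinite.f_integrable.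
- by move=> E _ mE; rewrite -Radon_Nikodym_SigmaFinite.f_integral.
Qed.

(** Uniqueness of Lebesgue measure: agreement on half-open intervals suffices. *)
Lemma lebesgue_measure_translation (a : R) (A : set R) : measurable A ->
  pushforward mu ((fun z => z + a) : _ -> measurableTypeR R) A = mu A.
Proof.
move=> mA; apply/esym.
apply: (@lebesgue_measure_unique R
  (pushforward mu ((fun z => z + a) : _ -> measurableTypeR R))) => //=.
  exact: measurable_funD.
move=> _ _ [[x y]] _ <-; rewrite /pushforward /=.
rewrite (_ : _ @^-1` _ = [set` `]x - a, y - a]]); last first.
  by apply/seteqP; split => z /=; rewrite !in_itv/= ltrBlDr lerBrDr.
rewrite !lebesgue_measure_itv/= !lte_fin ltrD2r; case: ifP => // _.
by rewrite -!EFinD; congr (_%:E); ring.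
Qed.

Lemma ge0_integral_translation (a : R) (f : _ -> \bar R) :
  measurable_fun [set: R] f -> (forall z, (0 <= f z)%E) ->
  (\int[mu]_z f (z + a)%R = \int[mu]_z f z)%E.
Proof.
move=> mf f0.
transitivity (\int[pushforward mu ((fun z => z + a)%R : R -> measurableTypeR R)]_z f z)%E.
  by rewrite ge0_integral_pushforward//=; exact: measurable_funD.
apply: eq_measure_integral => /=; first exact: measurable_funD.
by move=> ? A mA _; exact: lebesgue_measure_translation.
Qed.

(** Completing the square in [w]. The last factor is the conditional density of the second summand
    when the sum is [y], so that integrating it out leaves the density of the sum. *)
Lemma normal_pdf_convE s t y w : 0 < s -> 0 < t ->
  let c := Num.sqrt (s ^+ 2 + t ^+ 2) in
  normal_pdf 0 s (y - w) * normal_pdf 0 t w =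
  normal_pdf 0 c y * normal_pdf (y * t ^+ 2 / c ^+ 2) (s * t / c) w.
Proof.
move=> s0 t0 c.
have c20 : 0 < s ^+ 2 + t ^+ 2 by rewrite addr_gt0// exprn_gt0.
have c0 : 0 < c by rewrite sqrtr_gt0.
have c2 : c ^+ 2 = s ^+ 2 + t ^+ 2 by rewrite sqr_sqrtr// ltW.
rewrite !normal_pdfE ?gt_eqF ?mulr_gt0 ?invr_gt0//.
rewrite /normal_peak /normal_fun mulrACA -expRD [RHS]mulrACA -expRD.
rewrite -!invfM -!sqrtrM; last 2 first.
- by rewrite mulrn_wge0// mulr_ge0 ?pi_ge0 ?sqr_ge0.
- by rewrite mulrn_wge0// mulr_ge0 ?pi_ge0 ?sqr_ge0.
rewrite !subr0 expr_div_n exprMn c2; congr (_ * expR _).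
  congr (Num.sqrt _)^-1; move: (pi) (s ^+ 2) (t ^+ 2) c20 => q a b /lt0r_neq0 ?.
  by field.
have /lt0r_neq0 a0 : 0 < s ^+ 2 by rewrite exprn_gt0.
have /lt0r_neq0 b0 : 0 < t ^+ 2 by rewrite exprn_gt0.
move: (s ^+ 2) (t ^+ 2) a0 b0 (lt0r_neq0 c20) => a b a0 b0 c0'.
by field; rewrite a0 b0 c0'.
Qed.

Lemma integral_normal_pdf_conv s t y : 0 < s -> 0 < t ->
  (\int[mu]_w (normal_pdf 0 s (y - w) * normal_pdf 0 t w)%:E =
   (normal_pdf 0 (Num.sqrt (s ^+ 2 + t ^+ 2)) y)%:E)%E.
Proof.
move=> s0 t0; under eq_integral do rewrite normal_pdf_convE//= EFinM.
rewrite ge0_integralZl//=.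
- by rewrite integral_normal_pdf mule1.
- by apply/measurable_EFinP; exact: measurable_normal_pdf.
- by move=> w _; rewrite lee_fin normal_pdf_ge0.
- by rewrite lee_fin normal_pdf_ge0.
Qed.

Lemma ge0_integral_normal_prob_conv s t (f : _ -> \bar R) : 0 < s -> 0 < t ->
  measurable_fun [set: R] f -> (forall z, (0 <= f z)%E) ->
  (\int[normal_prob 0 s]_z \int[normal_prob 0 t]_w f (z + w)%R =
   \int[normal_prob 0 (Num.sqrt (s ^+ 2 + t ^+ 2))]_z f z)%E.
Proof.
move=> s0 t0 mf f0.
have mpdf a : measurable_fun [set: R] (fun z => (normal_pdf 0 a z)%:E).
  by apply/measurable_EFinP; exact: measurable_normal_pdf.
have mfD : measurable_fun [set: R * R] (fun zw => f (zw.1 + zw.2)).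
  by apply: measurableT_comp => //; exact: measurable_funD.
(* With [w] outside, the inner variable can be translated to [y = z + w]; a second exchange then
   puts the convolution of the densities inside. *)
have -> := @fubini_tonelli _ _ _ _ _ (normal_prob 0 s) (normal_prob 0 t) _ mfD (fun=> f0 _).
rewrite /=.
rewrite ge0_integral_normal_prob; last 2 first.
- exact: (@measurable_fun_fubini_tonelli_G _ _ _ _ _ (normal_prob 0 s) _ mfD (fun=> f0 _)).
- by move=> w; apply: integral_ge0.
transitivity (\int[mu]_w \int[mu]_y
    (f y * (normal_pdf 0 s (y - w) * normal_pdf 0 t w)%:E))%E.
  apply: eq_integral => w _.
  rewrite ge0_integral_normal_prob//; last first.
    by apply: measurableT_comp => //; exact: measurable_funD.
  rewrite -(ge0_integral_translation (- w)); last 2 first.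
  - apply: emeasurable_funM; last exact: mpdf.
    by apply: measurableT_comp => //; exact: measurable_funD.
  - by move=> y; rewrite mule_ge0// lee_fin normal_pdf_ge0.
  rewrite -ge0_integralZr//=; first last.
  - by rewrite lee_fin normal_pdf_ge0.
  - by move=> z _; rewrite mule_ge0// lee_fin normal_pdf_ge0.
  - apply: emeasurable_funM => /=.
      by apply: measurableT_comp => //; apply: measurable_funD => //; exact: measurable_funD.
    by apply: (measurableT_comp (mpdf s)); exact: measurable_funD.
  by apply: eq_integral => z _; rewrite subrK EFinM muleA.
pose g (wy : R * R) := (f wy.2 * (normal_pdf 0 s (wy.2 - wy.1) * normal_pdf 0 t wy.1)%:E)%E.
have mg : measurable_fun [set: R * R] g.
  apply: emeasurable_funM; first exact: measurableT_comp.
  apply/measurable_EFinP; apply: measurable_funM.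
    by apply: (measurableT_comp (measurable_normal_pdf _ _)); exact: measurable_funB.
  by apply: (measurableT_comp (measurable_normal_pdf _ _)).
have g0 wy : (0 <= g wy)%E.
  by rewrite mule_ge0// lee_fin mulr_ge0// normal_pdf_ge0.
have -> := @fubini_tonelli _ _ _ _ _ mu mu _ mg g0.
rewrite ge0_integral_normal_prob//; apply: eq_integral => y _.
rewrite -integral_normal_pdf_conv//= -ge0_integralZl//=.
- apply/measurable_EFinP; apply: measurable_funM; last exact: measurable_normal_pdf.
  by apply: (measurableT_comp (measurable_normal_pdf _ _)); exact: measurable_funB.
- by move=> w _; rewrite lee_fin mulr_ge0// normal_pdf_ge0.
Qed.

End NormalIntegrals.

Section NormalMoments.
Context {R : realType}.
Notation mu := (@lebesgue_measure R).
Implicit Types (s t z : R).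

Lemma integral_scaled_normal_pdf m s (C : R) : 0 <= C ->
  (\int[mu]_z (C%:E * (normal_pdf m s z)%:E) = C%:E)%E.
Proof.
move=> C0; rewrite ge0_integralZl//=.
- by rewrite integral_normal_pdf mule1.
- by apply/measurable_EFinP; exact: measurable_normal_pdf.
- by move=> w _; rewrite lee_fin normal_pdf_ge0.
Qed.

Lemma integral_normal_expR s t : 0 < s ->
  (\int[normal_prob 0 s]_z (expR (t * z))%:E = (expR (s ^+ 2 * t ^+ 2 / 2))%:E)%E.
Proof.
move=> s0; rewrite ge0_integral_normal_prob//=; last first.
  by apply/measurable_EFinP; apply: measurableT_comp => //; exact: mulrl_measurable.
transitivity (\int[mu]_z
    ((expR (s ^+ 2 * t ^+ 2 / 2))%:E * (normal_pdf (s ^+ 2 * t) s z)%:E))%E.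
  apply: eq_integral => z _; rewrite -!EFinM !normal_pdfE ?gt_eqF//.
  congr EFin; rewrite mulrCA [RHS]mulrCA /normal_fun -!expRD; congr (_ * expR _).
  have : s ^+ 2 != 0 by rewrite sqrf_eq0 gt_eqF.
  by move: (s ^+ 2) => q q0; field.
by apply: integral_scaled_normal_pdf; exact: expR_ge0.
Qed.

(** Up to a constant factor, the integrand times the density is again a normal density, with
    standard deviation [s / sqrt u] and mean [m]. The sign of [a] is free as long as [u] stays
    positive, so one computation covers decaying and growing exponentials of squares. *)
Lemma integral_normal_expR_quad s c y (a : R) : 0 < s -> 0 < 1 + 2 * a * (c ^+ 2 * s ^+ 2) ->
  (\int[normal_prob 0 s]_z (expR (- a * (y + z * c) ^+ 2))%:E =
   ((Num.sqrt (1 + 2 * a * (c ^+ 2 * s ^+ 2)))^-1 *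
    expR (- (a / (1 + 2 * a * (c ^+ 2 * s ^+ 2))) * y ^+ 2))%:E)%E.
Proof.
move=> s0 u0; rewrite ge0_integral_normal_prob//=; last first.
  apply/measurable_EFinP; apply: measurableT_comp => //.
  apply: measurable_funM => //; apply: measurable_funX.
  by apply: measurable_funD => //; apply: measurable_funM.
set u := 1 + _ in u0 *.
pose s' := s / Num.sqrt u.
have s'0 : 0 < s' by rewrite divr_gt0// sqrtr_gt0.
have Es' : s' ^+ 2 = s ^+ 2 / u by rewrite expr_div_n sqr_sqrtr// ltW.
pose m := - (2 * a) * c * y * s' ^+ 2.
transitivity (\int[mu]_z
    (((Num.sqrt u)^-1 * expR (- (a / u) * y ^+ 2))%:E * (normal_pdf m s' z)%:E))%E.
  apply: eq_integral => z _; rewrite -!EFinM !normal_pdfE ?gt_eqF//.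
  congr EFin; rewrite mulrCA [RHS]mulrACA /normal_fun -!expRD.
  have q2 : s ^+ 2 != 0 by rewrite sqrf_eq0 gt_eqF.
  rewrite /normal_peak /m Es'; congr (_ * expR _).
    rewrite -invfM -sqrtrM ?ltW//; congr (Num.sqrt _)^-1.
    by move: (s ^+ 2) u u0 {Es' m s' s'0} => t u /lt0r_neq0 uN0; field.
  move: u0 => /lt0r_neq0; rewrite /u.
  by move: (s ^+ 2) q2 => t tN0 uN0; field; rewrite tN0 uN0.
by apply: integral_scaled_normal_pdf; rewrite mulr_ge0// ?expR_ge0// invr_ge0 sqrtr_ge0.
Qed.

Lemma integral_normal_expR_sqr s t : 0 < s -> 2 * t * s ^+ 2 < 1 ->
  (\int[normal_prob 0 s]_z (expR (t * z ^+ 2))%:E =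
   ((Num.sqrt (1 - 2 * t * s ^+ 2))^-1)%:E)%E.
Proof.
move=> s0 ts; have E : 1 + 2 * - t * (1 ^+ 2 * s ^+ 2) = 1 - 2 * t * s ^+ 2 by ring.
have := @integral_normal_expR_quad s 1 0 (- t) s0; rewrite E subr_gt0 => /(_ ts).
rewrite expr0n mulr0 expR0 mulr1 => <-; apply: eq_integral => z _.
by rewrite opprK add0r mulr1.
Qed.

(** With [w = |z| / s]: 6 is [3!], from [w^k <= k! exp w]; the exponential comes from
    [(D + 1) w <= (D + 1)^2 + w^2 / 4]; and [sqrt 2] is the mean of [exp(w^2 / 4)]. *)
Definition moment_cst (D : R) : R := 6 * Num.sqrt 2 * expR ((D + 1) ^+ 2).

Lemma measurable_moment_fun k (D : R) :
  measurable_fun [set: R] (fun z => `|z| ^+ k * expR (D * `|z|)).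
Proof.
apply: measurable_funM; first by apply: measurable_funX; exact: normr_measurable.
by apply: measurableT_comp => //; apply: measurable_funM => //; exact: normr_measurable.
Qed.

Lemma le_integral_normal_moment k (D : R) s : (k <= 3)%N -> 0 <= D -> 0 < s <= 1 ->
  (\int[normal_prob 0 s]_z (`|z| ^+ k * expR (D * `|z|))%:E <=
   (moment_cst D * s ^+ k)%:E)%E.
Proof.
move=> k3 D0 /andP[s0 s1].
have sN0 : s != 0 by rewrite gt_eqF.
pose a := 4^-1 * (s ^+ 2)^-1.
pose K := 6 * expR ((D + 1) ^+ 2) * s ^+ k.
have K0 : 0 <= K by rewrite !mulr_ge0 ?expR_ge0 ?exprn_ge0// ltW.
have mg : measurable_fun [set: R] (fun z => expR (a * z ^+ 2)).
  by apply: measurableT_comp => //; apply: measurable_funM.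
apply: (@le_trans _ _ (\int[normal_prob 0 s]_z (K%:E * (expR (a * z ^+ 2))%:E))%E).
  apply: ge0_le_integral => //=.
  - by apply/measurable_EFinP; exact: measurable_moment_fun.
  - by apply: emeasurable_funM => //; apply/measurable_EFinP.
  move=> z _; rewrite -EFinM lee_fin.
  pose w := `|z| / s.
  have w0 : 0 <= w by rewrite divr_ge0// ltW.
  have zE : `|z| = s * w by rewrite mulrC divfK.
  have -> : a * z ^+ 2 = w ^+ 2 / 4.
    by rewrite -[z ^+ 2]real_normK ?num_real// zE /a; field.
  have wk : w ^+ k <= 6 * expR w.
    case: k k3 {K K0} => [|k] k3.
      by rewrite expr0; have := expR_ge1Dx w; lra.
    have := expR_ge1Dxn k w0; move=> H.
    have {H} : w ^+ k.+1 / (k.+1)`!%:R <= expR w by lra.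
    rewrite ler_pdivrMr ?ltr0n ?fact_gt0// => /le_trans; apply.
    rewrite mulrC ler_wpM2r ?expR_ge0//.
    by case: k k3 => [|[|[|]]]//= _; rewrite ler_nat.
  rewrite zE exprMn /K (_ : s ^+ k * w ^+ k * _ = s ^+ k * (w ^+ k * expR (D * (s * w)))); last by ring.
  rewrite (_ : 6 * _ * _ * _ = s ^+ k * (6 * (expR ((D + 1) ^+ 2) * expR (w ^+ 2 / 4)))); last by ring.
  rewrite ler_wpM2l ?exprn_ge0 ?(ltW s0)// -expRD.
  apply: (@le_trans _ _ (6 * (expR w * expR (D * w)))).
    rewrite (mulrA 6); apply: ler_pM; rewrite ?exprn_ge0 ?expR_ge0//.
    by rewrite ler_expR ler_wpM2l// ler_piMl.
  rewrite -!expRD ler_pM2l// ler_expR.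
  have := sqr_ge0 ((D + 1) - w / 2); lra.
rewrite ge0_integralZl//=; last by apply/measurable_EFinP.
rewrite integral_normal_expR_sqr//; last first.
  have -> : 2 * a * s ^+ 2 = 2^-1 by rewrite /a; field.
  by lra.
have -> : 1 - 2 * a * s ^+ 2 = 2^-1 by rewrite /a; field.
rewrite sqrtrV// invrK -EFinM lee_fin /K /moment_cst.
by rewrite le_eqVlt; apply/orP; left; apply/eqP; ring.
Qed.
End NormalMoments.

(** * Taylor bounds *)

Section Taylor.
Context {R : realType}.
Implicit Types (x y t : R).

(** The Taylor bounds below apply this to a remainder, whose derivative is, up to a factor, the
    remainder one order lower. Factorials are not tracked; only the power of [|x|] matters. *)
Lemma MVT_at0 (f df : R -> R) (x M : R) : f 0 = 0 ->
  (forall y, `|y| <= `|x| -> is_derive y 1 f (df y)) ->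
  (forall y, `|y| <= `|x| -> `|df y| <= M) -> `|f x| <= M * `|x|.
Proof.
move=> f0 fdf dfM.
have [x0|x0|->] := ltgtP x 0; last by rewrite f0 normr0 mulr0.
- have [||y] := @MVT_segment R f df x 0 (ltW x0).
  + move=> y; rewrite in_itv/= => /andP[xy y0]; apply: fdf.
    by rewrite !ltr0_norm// lerN2 ltW.
  + apply: derivable_within_continuous => y; rewrite in_itv/= => /andP[xy y0].
    by apply: ex_derive; apply: fdf; rewrite !ler0_norm ?(ltW x0)// lerN2.
  rewrite in_itv/= f0 !sub0r => /andP[xy y0] fx.
  rewrite -normrN fx normrM normrN ler_wpM2r// dfM//.
  by rewrite !ler0_norm// ?lerN2// ltW.
- have [||y] := @MVT_segment R f df 0 x (ltW x0).
  + move=> y; rewrite in_itv/= => /andP[xy y0]; apply: fdf.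
    by rewrite !gtr0_norm// ltW.
  + apply: derivable_within_continuous => y; rewrite in_itv/= => /andP[xy y0].
    by apply: ex_derive; apply: fdf; rewrite !ger0_norm ?(ltW x0).
  rewrite in_itv/= f0 !subr0 => /andP[xy y0] ->.
  by rewrite normrM ler_wpM2r// dfM// !ger0_norm// (ltW x0).
Qed.

Let le_expR_norm x y k : `|y| <= `|x| ->
  `|y| ^+ k * expR `|y| <= `|x| ^+ k * expR `|x|.
Proof. by move=> yx; rewrite ler_pM ?exprn_ge0 ?expR_ge0 ?ler_expR// lerXn2r. Qed.

Lemma expR_taylor1 x : `|expR x - 1| <= `|x| * expR `|x|.
Proof.
rewrite mulrC; apply: (@MVT_at0 (fun x => expR x - 1) expR).
- by rewrite expR0 subrr.
- by move=> y _; rewrite -[expR y]subr0; apply: is_deriveB.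
- move=> y yx; rewrite ger0_norm ?expR_ge0// ler_expR.
  by rewrite (le_trans _ yx)// ler_norm.
Qed.

Lemma expR_taylor2 x : `|expR x - 1 - x| <= `|x| ^+ 2 * expR `|x|.
Proof.
rewrite expr2 -mulrA mulrC.
apply: (@MVT_at0 (fun x => expR x - 1 - x) (fun x => expR x - 1)).
- by rewrite expR0 subrr subr0.
- move=> y _; apply: is_deriveB; rewrite -[expR y]subr0; exact: is_deriveB.
- move=> y yx; apply: (le_trans (expR_taylor1 _)).
  by have := le_expR_norm 1 yx; rewrite !expr1.
Qed.

Lemma expR_taylor3 x :
  `|expR x - 1 - x - x ^+ 2 / 2| <= `|x| ^+ 3 * expR `|x|.
Proof.
rewrite (exprSr `|x|) [X in _ <= X]mulrAC.
apply: (@MVT_at0 (fun x => expR x - 1 - x - x ^+ 2 / 2) (fun x => expR x - 1 - x)).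
- by rewrite expR0 subrr subr0 expr0n/= mul0r subrr.
- move=> y _; apply: is_derive_eq.
  by rewrite /GRing.scale/=; field.
- move=> y yx; apply: (le_trans (expR_taylor2 _)).
  exact: le_expR_norm.
Qed.

(** The value 8 is [(1/2)^(-3)], the worst case [1 + y = 1/2], [a = -3]. *)
Let powR_le8 (a y : R) : -3 <= a <= 0 -> `|y| <= 2^-1 -> (1 + y) `^ a <= 8.
Proof.
move=> /andP[a3 a0]; rewrite ler_norml => /andP[y1 y2].
have y0 : 0 < 1 + y by lra.
rewrite -[a]opprK powRN -[8]invrK lef_pV2 ?posrE ?powR_gt0//.
apply: (@le_trans _ _ (2^-1 `^ (- a))); last first.
  by apply: ge0_ler_powR; rewrite ?nnegrE ?(ltW y0)//; lra.
rewrite (_ : 8^-1 = 2^-1 `^ 3%:R); last by rewrite powR_mulrn//; lra.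
by apply: ger_powR; lra.
Qed.

Let is_derive_powR1D (a y : R) : `|y| <= 2^-1 ->
  is_derive y 1 (fun x => (1 + x) `^ a) (a * (1 + y) `^ (a - 1)).
Proof.
rewrite ler_norml => /andP[y1 y2].
have y0 : 0 < 1 + y by lra.
have H := is_derive1_powR a y0.
have H1 : is_derive y 1 (fun x : R => 1 + x) 1.
  by apply: is_derive_eq; ring.
have := @is_derive1_comp R (fun x : R => x `^ a) (fun x : R => 1 + x) y _ _ H H1.
by rewrite mulr1.
Qed.

(** The range of [a] narrows from each order to the next because differentiation lowers the
    exponent. At the bottom [a - 1] stays in [[-3, 0]] and [|a| <= 2], whence [16 = 2 * 8]. *)
Lemma powR_taylor1 (a x : R) : -2 <= a <= 1 -> `|x| <= 2^-1 ->
  `|(1 + x) `^ a - 1| <= 16 * `|x|.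
Proof.
move=> /andP[a2 a1] x2.
apply: (@MVT_at0 (fun x => (1 + x) `^ a - 1) (fun y => a * (1 + y) `^ (a - 1))).
- by rewrite addr0 powR1 subrr.
- move=> y yx; rewrite -[_ * _]subr0; apply: is_deriveB.
  exact/is_derive_powR1D/(le_trans yx).
- move=> y yx; rewrite normrM (_ : 16 = 2 * 8); last by lra.
  apply: ler_pM => //; first by rewrite ler_norml; lra.
  rewrite ger0_norm ?powR_ge0//; apply: powR_le8; last exact: le_trans x2.
  lra.
Qed.

Lemma powR_taylor2 (a x : R) : -1 <= a <= 1 -> `|x| <= 2^-1 ->
  `|(1 + x) `^ a - 1 - a * x| <= 16 * `|x| ^+ 2.
Proof.
move=> /andP[a2 a1] x2; rewrite expr2 mulrA.
apply: (@MVT_at0 (fun x => (1 + x) `^ a - 1 - a * x)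
  (fun y => a * ((1 + y) `^ (a - 1) - 1))).
- by rewrite addr0 powR1 subrr mulr0 subr0.
- move=> y yx; pose g := is_derive_powR1D a (le_trans yx x2).
  have d1 : is_derive y 1 (fun x : R => a * x) a.
    by apply: is_derive_eq; rewrite /GRing.scale/=; ring.
  have d2 : is_derive y 1 (cst (1 : R)) 0 by exact: is_derive_cst.
  have -> : a * ((1 + y) `^ (a - 1) - 1) = a * (1 + y) `^ (a - 1) - 0 - a by ring.
  exact: is_deriveB (is_deriveB g d2) d1.
- move=> y yx; rewrite normrM -[X in _ <= X]mul1r.
  apply: ler_pM => //; first by rewrite ler_norml; lra.
  apply: (le_trans (powR_taylor1 _ (le_trans yx x2))); first lra.
  by rewrite ler_pM2l.
Qed.

Lemma powR_taylor3 (a x : R) : 0 <= a <= 1 -> `|x| <= 2^-1 ->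
  `|(1 + x) `^ a - 1 - a * x + a * (1 - a) / 2 * x ^+ 2| <= 16 * `|x| ^+ 3.
Proof.
move=> /andP[a2 a1] x2; rewrite (exprSr `|x|) mulrA.
apply: (@MVT_at0 (fun x => (1 + x) `^ a - 1 - a * x + a * (1 - a) / 2 * x ^+ 2)
  (fun y => a * ((1 + y) `^ (a - 1) - 1 - (a - 1) * y))).
- by rewrite addr0 powR1 subrr mulr0 subr0 expr0n/= mulr0 addr0.
- move=> y yx; pose g := is_derive_powR1D a (le_trans yx x2).
  have d1 : is_derive y 1 (fun x : R => a * x) a.
    by apply: is_derive_eq; rewrite /GRing.scale/=; ring.
  have d2 : is_derive y 1 (cst (1 : R)) 0 by exact: is_derive_cst.
  have d3 : is_derive y 1 (fun x : R => a * (1 - a) / 2 * x ^+ 2) (a * (1 - a) * y).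
    by apply: is_derive_eq; rewrite /GRing.scale/=; field.
  have -> : a * ((1 + y) `^ (a - 1) - 1 - (a - 1) * y) =
      a * (1 + y) `^ (a - 1) - 0 - a + a * (1 - a) * y by ring.
  exact: is_deriveD (is_deriveB (is_deriveB g d2) d1) d3.
- move=> y yx; rewrite normrM -[X in _ <= X]mul1r.
  apply: ler_pM => //; first by rewrite ler_norml; lra.
  apply: (le_trans (powR_taylor2 _ (le_trans yx x2))); first lra.
  by rewrite ler_pM2l// lerXn2r.
Qed.

Lemma powR_taylor3_global (a x : R) : 0 <= a <= 1 -> 0 < 1 + x ->
  `|(1 + x) `^ a - 1 - a * x + a * (1 - a) / 2 * x ^+ 2| <= 32 * `|x| ^+ 3.
Proof.
move=> a01 x1; have [x2|x2] := leP `|x| 2^-1.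
  apply: (le_trans (powR_taylor3 a01 x2)).
  by rewrite ler_wpM2r ?exprn_ge0// ler_nat.
move: a01 => /andP[a0 a1].
have P0 : 0 <= (1 + x) `^ a by rewrite powR_ge0.
have P1 : (1 + x) `^ a <= 1 + `|x|.
  apply: (@le_trans _ _ ((1 + `|x|) `^ a)).
    by apply: ge0_ler_powR; rewrite ?nnegrE ?(ltW x1)// ?addr_ge0// lerD2l ler_norm.
  by apply: ler1_powR => //; rewrite lerDl.
have xx : x ^+ 2 = `|x| ^+ 2 by rewrite real_normK ?num_real.
have xle := ler_norm x; have := ler_norm (- x); rewrite normrN => xge.
rewrite xx; move: `|x| x2 P1 xle xge => w w2 P1 xw wx {xx}.
have w0' : 0 <= 2 * w - 1 by lra.
have w3 : w ^+ 2 <= 2 * w ^+ 3 by have := mulr_ge0 (sqr_ge0 w) w0'; lra.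
have w1 : w <= 4 * w ^+ 3.
  have : 0 <= w * (2 * w - 1) by rewrite mulr_ge0//; lra.
  lra.
have w0 : 1 <= 8 * w ^+ 3 by lra.
have A1 : `|a * x| <= w by rewrite ler_norml; apply/andP; split; nra.
have A2 : 0 <= a * (1 - a) / 2 * w ^+ 2 <= w ^+ 2.
  apply/andP; split; first by rewrite !mulr_ge0 ?sqr_ge0//; lra.
  by rewrite ler_piMl ?sqr_ge0//; nra.
move: A1; rewrite !ler_norml => /andP[A11 A12]; move: A2 => /andP[A21 A22].
by apply/andP; split; lra.
Qed.

End Taylor.

(** * Powers of a weighted mean of exponentials *)

Section LogSumExp.
Context {R : realType} {m : nat}.
Variables (p t : 'I_m -> R) (w : R).
Hypotheses (p0 : forall k, 0 <= p k) (p1 : \sum_k p k = 1).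
Hypothesis (tw : forall k, `|t k| <= w).

Let y := \sum_k p k * expR (t k).

Lemma ler_norm_wsum (g : 'I_m -> R) (M : R) : (forall k, `|g k| <= M) ->
  `|\sum_k p k * g k| <= M.
Proof.
move=> gM; apply: (le_trans (ler_norm_sum _ _ _)).
rewrite -[M]mul1r -p1 mulr_suml; apply: ler_sum => k _.
by rewrite normrM (ger0_norm (p0 k)) ler_wpM2l.
Qed.

Lemma wsum_cst (M : R) : \sum_k p k * M = M.
Proof. by rewrite -mulr_suml p1 mul1r. Qed.

Lemma wsum_expR_bounds : expR (- w) <= y <= expR w.
Proof.
have twk k : - w <= t k <= w by rewrite -ler_norml.
apply/andP; split.
  rewrite -(wsum_cst (expR (- w))); apply: ler_sum => k _.
  by rewrite ler_wpM2l// ler_expR; case/andP: (twk k).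
rewrite -(wsum_cst (expR w)); apply: ler_sum => k _.
by rewrite ler_wpM2l// ler_expR; case/andP: (twk k).
Qed.

Lemma wsum_expR_gt0 : 0 < y.
Proof. by have /andP[+ _] := wsum_expR_bounds; apply: lt_le_trans; exact: expR_gt0. Qed.

Lemma wsum_expR_powR (a : R) : 0 <= w -> -2 <= a <= 0 ->
  expR (- (2 * w)) <= y `^ a <= expR (2 * w).
Proof.
move=> w0 /andP[a2 a0]; have y0 := wsum_expR_gt0.
have /andP[yl yu] := wsum_expR_bounds.
have lnyl : - w <= ln y by rewrite -[- w]expRK ler_ln ?posrE ?expR_gt0.
have lnyu : ln y <= w by rewrite -[w]expRK ler_ln ?posrE ?expR_gt0.
rewrite /powR gt_eqF// !ler_expR.
by apply/andP; split; nra.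
Qed.

(** Both factors are exponentials of numbers at most [2 w] in absolute value: [y^a] too, since [y]
    lies between [exp(-w)] and [exp w] and [|a| <= 2]. *)
Lemma gibbs_weight_bound (a u : R) : 0 <= w -> -2 <= a <= 0 -> `|u| <= 2 * w ->
  `|expR u * y `^ a - 1| <= 4 * w * expR (4 * w).
Proof.
move=> w0 a20 uw; have y0 := wsum_expR_gt0.
have /andP[yl yu] := wsum_expR_powR w0 a20.
move: uw; rewrite ler_norml => /andP[ul uu].
have ya0 : 0 < y `^ a by rewrite powR_gt0.
pose v := ln (y `^ a).
have vE : expR v = y `^ a by rewrite lnK ?posrE.
have vl : - (2 * w) <= v by rewrite -ler_expR vE.
have vu : v <= 2 * w by rewrite -ler_expR vE.
rewrite -vE -expRD; apply: (le_trans (expR_taylor1 _)).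
have H : `|u + v| <= 4 * w by rewrite ler_norml; lra.
by rewrite ler_pM ?expR_ge0 ?ler_expR.
Qed.

Let m1 := \sum_k p k * t k.
Let m2 := \sum_k p k * t k ^+ 2.

(** Third-order expansion of [(1 + h)^a] at [h = y - 1], with [h] replaced by [m1 + m2 / 2] in the
    linear term and by [m1] in the quadratic one. The three errors are at most 32, 1 and 2 times
    [w^3 exp(3 w)]. *)
Lemma lse_powR_taylor (a : R) : 0 <= w -> 0 <= a <= 1 ->
  `|y `^ a - (1 + a * m1 + a * (m2 - (1 - a) * m1 ^+ 2) / 2)| <=
  40 * w ^+ 3 * expR (3 * w).
Proof.
move=> w0 a01; have y0 := wsum_expR_gt0.
set E := expR w.
have E1 : 1 <= E by rewrite -expR0 ler_expR.
have Ele k : expR `|t k| <= E by rewrite ler_expR.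
pose h := y - 1.
have hE : h = \sum_k p k * (expR (t k) - 1).
  by rewrite /h /y -[X in _ - X]p1 -sumrB; apply: eq_bigr => k _; rewrite mulrBr mulr1.
have h1 : `|h| <= w * E.
  rewrite hE; apply: ler_norm_wsum => k; apply: (le_trans (expR_taylor1 _)).
  by rewrite ler_pM ?expR_ge0.
have h2 : `|h - m1| <= w ^+ 2 * E.
  rewrite hE -sumrB; under eq_bigr do rewrite -mulrBr.
  apply: ler_norm_wsum => k; apply: (le_trans (expR_taylor2 _)).
  by rewrite ler_pM ?exprn_ge0 ?expR_ge0// lerXn2r ?nnegrE.
have h3 : `|h - m1 - m2 / 2| <= w ^+ 3 * E.
  rewrite hE mulr_suml -!sumrB; under eq_bigr do rewrite -mulrA -!mulrBr.
  apply: ler_norm_wsum => k; apply: (le_trans (expR_taylor3 _)).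
  by rewrite ler_pM ?exprn_ge0 ?expR_ge0// lerXn2r ?nnegrE.
have m1w : `|m1| <= w by exact: ler_norm_wsum.
have EE : expR (3 * w) = E ^+ 3 by rewrite -expRM_natl.
have h4 : `|h ^+ 2 - m1 ^+ 2| <= 2 * w ^+ 3 * E ^+ 3.
  rewrite subr_sqr normrM.
  apply: (@le_trans _ _ (w ^+ 2 * E * (2 * w * E))).
    apply: ler_pM => //; apply: (le_trans (ler_normD _ _)).
    have : w <= w * E by rewrite ler_peMr.
    lra.
  rewrite (_ : _ * (2 * w * E) = 2 * w ^+ 3 * E ^+ 2); last by ring.
  by rewrite ler_wpM2l ?mulr_ge0 ?exprn_ge0// ler_weXn2l.
have := powR_taylor3_global a01 (_ : 0 < 1 + h).
rewrite (_ : 1 + h = y); last by rewrite /h; ring.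
move=> /(_ y0) h5.
have h6 : 32 * `|h| ^+ 3 <= 32 * w ^+ 3 * E ^+ 3.
  by rewrite -mulrA ler_pM2l// -exprMn lerXn2r ?nnegrE ?mulr_ge0// (le_trans _ E1).
have EE3 : w ^+ 3 * E <= w ^+ 3 * E ^+ 3.
  rewrite ler_wpM2l ?exprn_ge0// -[X in X <= _]expr1.
  by rewrite ler_weXn2l.
have -> : y `^ a - (1 + a * m1 + a * (m2 - (1 - a) * m1 ^+ 2) / 2) =
  (y `^ a - 1 - a * h + a * (1 - a) / 2 * h ^+ 2) + a * (h - m1 - m2 / 2)
    - a * (1 - a) / 2 * (h ^+ 2 - m1 ^+ 2) by field.
rewrite EE; move: a01 => /andP[a0 a1].
apply: (le_trans (ler_normB _ _)).
apply: (le_trans (lerD (ler_normD _ _) (lexx _))).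
have g1 : `|a * (h - m1 - m2 / 2)| <= w ^+ 3 * E ^+ 3.
  rewrite normrM ger0_norm// -[X in _ <= X]mul1r ler_pM// (le_trans h3)//.
have g2 : `|a * (1 - a) / 2 * (h ^+ 2 - m1 ^+ 2)| <= 2 * w ^+ 3 * E ^+ 3.
  rewrite normrM -[X in _ <= X]mul1r ler_pM// ger0_norm; first nra.
  by rewrite divr_ge0// mulr_ge0// subr_ge0.
have := mulr_ge0 (exprn_ge0 3 w0) (exprn_ge0 3 (le_trans ler01 E1)).
lra.
Qed.

End LogSumExp.

(** * Expansion of Gaussian means to second order *)

Section NormalExpansion.
Context {R : realType}.
Implicit Types (g : R -> R).

Let measurable_exp_comb (a0 a1 a2 : R) : measurable_fun [set: R]
  (fun z => a0 + a1 * expR z + a2 * expR (- z)).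
Proof.
apply: measurable_funD; last first.
  by apply: measurable_funM => //; apply: measurableT_comp.
by apply: measurable_funD => //; apply: measurable_funM.
Qed.

Lemma integral_normal_exp_comb (s a0 a1 a2 : R) : 0 < s ->
  (normal_prob 0 s).-integrable setT
    (fun z => (a0 + a1 * expR z + a2 * expR (- z))%:E) /\
  (\int[normal_prob 0 s]_z (a0 + a1 * expR z + a2 * expR (- z))%:E =
   (a0 + (a1 + a2) * expR (s ^+ 2 / 2))%:E)%E.
Proof.
move=> s0.
have E1 : (\int[normal_prob 0 s]_z (expR z)%:E = (expR (s ^+ 2 / 2))%:E)%E.
  have := integral_normal_expR 1 s0; rewrite expr1n mulr1 => <-.
  by apply: eq_integral => z _; rewrite mul1r.
have E2 : (\int[normal_prob 0 s]_z (expR (- z))%:E = (expR (s ^+ 2 / 2))%:E)%E.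
  have := integral_normal_expR (-1) s0; rewrite sqrrN expr1n mulr1 => <-.
  by apply: eq_integral => z _; rewrite mulN1r.
have I1 : (normal_prob 0 s).-integrable setT (fun z => (expR z)%:E).
  apply/integrableP; split.
    by apply/measurable_EFinP; exact: measurable_expR.
  under eq_integral => z _ do rewrite gee0_abs ?lee_fin ?expR_ge0//.
  by rewrite E1 ltry.
have I2 : (normal_prob 0 s).-integrable setT (fun z => (expR (- z))%:E).
  apply/integrableP; split.
    by apply/measurable_EFinP; apply: measurableT_comp.
  under eq_integral => z _ do rewrite gee0_abs ?lee_fin ?expR_ge0//.
  by rewrite E2 ltry.
have I0 : (normal_prob 0 s).-integrable setT (fun=> a0%:E).
  exact: finite_measure_integrable_cst.
have J1 := integrableZl measurableT a1 I1.
have J2 := integrableZl measurableT a2 I2.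
have J01 := integrableD measurableT I0 J1.
have J := integrableD measurableT J01 J2.
have E : (fun z : R => (a0 + a1 * expR z + a2 * expR (- z))%:E) =
   ((fun=> a0%:E) \+ (fun z => a1%:E * (expR z)%:E) \+ (fun z => a2%:E * (expR (- z))%:E))%E.
  by apply/funext => z; rewrite /= !EFinD !EFinM.
rewrite E; split => //.
rewrite integralD//= integralD//= !integralZl//= E1 E2 integral_cst//=.
rewrite probability_setT mule1 -!EFinM -!EFinD; congr EFin; ring.
Qed.

(** One-sided, like its counterpart below, so that [g] need only be measurable and nonnegative; its
    integral is not known to be finite beforehand. *)
Lemma le_normal_expansion g (s a0 a1 a2 M D : R) k :
  measurable_fun [set: R] g -> (forall z, 0 <= g z) ->
  (k <= 3)%N -> 0 <= D -> 0 <= M -> 0 < s <= 1 ->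
  (forall z, g z <= a0 + a1 * expR z + a2 * expR (- z)
                    + M * (`|z| ^+ k * expR (D * `|z|))) ->
  (\int[normal_prob 0 s]_z (g z)%:E <=
   (a0 + (a1 + a2) * expR (s ^+ 2 / 2) + M * (moment_cst D * s ^+ k))%:E)%E.
Proof.
move=> mg g0 k3 D0 M0 s01 gle; have /andP[s0 s1] := s01.
have [Ip Ep] := integral_normal_exp_comb a0 a1 a2 s0.
have Hm := le_integral_normal_moment k3 D0 s01.
have mm := @measurable_moment_fun R k D.
pose h (z : R) := `|z| ^+ k * expR (D * `|z|).
have h0 z : 0 <= h z by rewrite mulr_ge0 ?exprn_ge0 ?expR_ge0.
have Ih : (normal_prob 0 s).-integrable setT (fun z => (h z)%:E).
  apply/integrableP; split; first by apply/measurable_EFinP.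
  under eq_integral => z _ do rewrite gee0_abs ?lee_fin ?h0//.
  by apply: le_lt_trans Hm _; rewrite ltry.
have IM := integrableZl measurableT M Ih.
apply: (@le_trans _ _ (\int[normal_prob 0 s]_z
    ((a0 + a1 * expR z + a2 * expR (- z))%:E + M%:E * (h z)%:E))%E).
  apply: ge0_le_integral => //=.
  - by move=> z _; rewrite lee_fin.
  - by apply/measurable_EFinP.
  - apply: emeasurable_funD.
      by apply/measurable_EFinP; exact: measurable_exp_comb.
    by apply: emeasurable_funM => //; apply/measurable_EFinP.
  - by move=> z _; rewrite -EFinM -EFinD lee_fin.
rewrite integralD//= Ep integralZl//= [leRHS]EFinD leeD2l// [leRHS]EFinM.
exact: lee_wpmul2l.
Qed.

Lemma ge_normal_expansion g (s a0 a1 a2 M D : R) k :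
  measurable_fun [set: R] g -> (forall z, 0 <= g z) ->
  (k <= 3)%N -> 0 <= D -> 0 <= M -> 0 < s <= 1 ->
  (forall z, a0 + a1 * expR z + a2 * expR (- z) <=
             g z + M * (`|z| ^+ k * expR (D * `|z|))) ->
  ((a0 + (a1 + a2) * expR (s ^+ 2 / 2))%:E <=
   \int[normal_prob 0 s]_z (g z)%:E + (M * (moment_cst D * s ^+ k))%:E)%E.
Proof.
move=> mg g0 k3 D0 M0 s01 gle; have /andP[s0 s1] := s01.
have [Ip Ep] := integral_normal_exp_comb a0 a1 a2 s0.
have Hm := le_integral_normal_moment k3 D0 s01.
have mm := @measurable_moment_fun R k D.
pose h (z : R) := `|z| ^+ k * expR (D * `|z|).
have h0 z : 0 <= h z by rewrite mulr_ge0 ?exprn_ge0 ?expR_ge0.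
apply: (@le_trans _ _ (\int[normal_prob 0 s]_z ((g z)%:E + M%:E * (h z)%:E))%E).
  (* The comparison function may be negative; its integral is at most that of its positive part,
     which is below the nonnegative integrand on the right. *)
  rewrite -Ep [leLHS]integralE.
  apply: (@le_trans _ _ (\int[normal_prob 0 s]_z
    ((fun z : R => (a0 + a1 * expR z + a2 * expR (- z))%:E)^\+ z))%E).
    by rewrite geeDl// oppe_le0 integral_ge0.
  apply: ge0_le_integral => //=.
  - by apply: measurable_funepos; apply/measurable_EFinP; exact: measurable_exp_comb.
  - apply: emeasurable_funD; first by apply/measurable_EFinP.
    by apply: emeasurable_funM => //; apply/measurable_EFinP.
  - move=> z _; rewrite funeposE ge_max -EFinM -EFinD !lee_fin gle.
    by rewrite addr_ge0// mulr_ge0.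
rewrite ge0_integralD//=.
- rewrite leeD2l// ge0_integralZl//=; last 2 first.
  + by apply/measurable_EFinP.
  + by move=> z _; rewrite lee_fin.
  by rewrite [leRHS]EFinM lee_wpmul2l.
- by move=> z _; rewrite lee_fin.
- by apply/measurable_EFinP.
- by move=> z _; rewrite -EFinM lee_fin mulr_ge0.
- by apply: emeasurable_funM => //; apply/measurable_EFinP.
Qed.

Lemma sinh_taylor (z : R) :
  `|(expR z - expR (- z)) / 2 - z| <= `|z| ^+ 3 * expR `|z|.
Proof.
have h1 := expR_taylor3 z; have h2 := expR_taylor3 (- z).
rewrite normrN sqrrN in h2.
have -> : (expR z - expR (- z)) / 2 - z = (expR z - 1 - z - z ^+ 2 / 2) / 2
   - (expR (- z) - 1 - - z - z ^+ 2 / 2) / 2 by field.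
apply: (le_trans (ler_normB _ _)).
by rewrite !normrM !(ger0_norm (_ : 0 <= 2^-1 :> R)) ?invr_ge0//; lra.
Qed.

Lemma cosh_taylor (z : R) :
  `|(expR z + expR (- z)) / 2 - 1 - z ^+ 2 / 2| <= `|z| ^+ 3 * expR `|z|.
Proof.
have h1 := expR_taylor3 z; have h2 := expR_taylor3 (- z).
rewrite normrN sqrrN in h2.
have -> : (expR z + expR (- z)) / 2 - 1 - z ^+ 2 / 2 = (expR z - 1 - z - z ^+ 2 / 2) / 2
   + (expR (- z) - 1 - - z - z ^+ 2 / 2) / 2 by field.
apply: (le_trans (ler_normD _ _)).
by rewrite !normrM !(ger0_norm (_ : 0 <= 2^-1 :> R)) ?invr_ge0//; lra.
Qed.

Definition half_var (s : R) : R := expR (s ^+ 2 / 2) - 1.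

Lemma half_var_bounds (s : R) : 0 < s <= 1 -> 0 <= half_var s <= s ^+ 2.
Proof.
move=> /andP[s0 s1]; rewrite /half_var subr_ge0 -expR0 ler_expR.
rewrite divr_ge0 ?sqr_ge0//=.
have x1 : s ^+ 2 <= 1 by rewrite exprn_ile1// ltW.
have := expR_ge1Dx (- (s ^+ 2 / 2)); rewrite expRN => h.
have e0 := expR_gt0 (s ^+ 2 / 2).
have : expR (s ^+ 2 / 2) * (1 - s ^+ 2 / 2) <= 1.
  by rewrite mulrC -ler_pdivlMr// mul1r; lra.
have := sqr_ge0 s; rewrite expR0; move: (s ^+ 2) (expR (s ^+ 2 / 2)) x1 e0 => q e q1 e0 q0 H.
rewrite lerBlDl.
have q2 : 0 < 1 - q / 2 by lra.
rewrite -(ler_pM2r q2); apply: (le_trans H).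
have : 0 <= q * (1 - q) by rewrite mulr_ge0//; lra.
lra.
Qed.

(* half_var s plays the role of s^2 / 2: it is what the comparison
   function cosh - 1, whose Gaussian integral is explicit, gives in place of z^2 / 2. *)
Lemma le_normal_taylor g (s c0 c1 c2 M D : R) :
  measurable_fun [set: R] g -> (forall z, 0 <= g z) ->
  1 <= D -> 0 <= M -> 0 < s <= 1 ->
  (forall z, g z <= c0 + c1 * z + c2 * z ^+ 2 / 2
                    + M * (`|z| ^+ 3 * expR (D * `|z|))) ->
  (\int[normal_prob 0 s]_z (g z)%:E <=
   (c0 + c2 * half_var s + (M + `|c1| + `|c2|) * (moment_cst D * s ^+ 3))%:E)%E.
Proof.
move=> mg g0 D1 M0 s01 gle.
(* The coefficients of [c0 + c1 sinh z + c2 (cosh z - 1)] in 1, [exp z] and [exp(-z)]; sinh has mean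
   zero. *)
have -> : c0 + c2 * half_var s = (c0 - c2) + ((c2 + c1) / 2 + (c2 - c1) / 2) * expR (s ^+ 2 / 2).
  by rewrite /half_var; field.
apply: le_normal_expansion => //; first by rewrite (le_trans _ D1).
  by rewrite !addr_ge0.
move=> z; apply: (le_trans (gle z)).
have H : `|z| ^+ 3 * expR `|z| <= `|z| ^+ 3 * expR (D * `|z|).
  by rewrite ler_wpM2l ?exprn_ge0// ler_expR ler_peMl.
have h1 := le_trans (sinh_taylor z) H; have h2 := le_trans (cosh_taylor z) H.
move: (`|z| ^+ 3 * _) h1 h2 => T h1 h2 {H}.
have l1 : c1 * (z - (expR z - expR (- z)) / 2) <= `|c1| * T.
  apply: (le_trans (ler_norm _)); by rewrite normrM ler_wpM2l// distrC.
have l2 : c2 * (z ^+ 2 / 2 - ((expR z + expR (- z)) / 2 - 1)) <= `|c2| * T.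
  apply: (le_trans (ler_norm _)); by rewrite normrM ler_wpM2l// distrC.
lra.
Qed.

Lemma ge_normal_taylor g (s c0 c1 c2 M D : R) :
  measurable_fun [set: R] g -> (forall z, 0 <= g z) ->
  1 <= D -> 0 <= M -> 0 < s <= 1 ->
  (forall z, c0 + c1 * z + c2 * z ^+ 2 / 2 <=
             g z + M * (`|z| ^+ 3 * expR (D * `|z|))) ->
  ((c0 + c2 * half_var s)%:E <= \int[normal_prob 0 s]_z (g z)%:E +
   ((M + `|c1| + `|c2|) * (moment_cst D * s ^+ 3))%:E)%E.
Proof.
move=> mg g0 D1 M0 s01 gle.
have -> : c0 + c2 * half_var s = (c0 - c2) + ((c2 + c1) / 2 + (c2 - c1) / 2) * expR (s ^+ 2 / 2).
  by rewrite /half_var; field.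
apply: ge_normal_expansion => //; first by rewrite (le_trans _ D1).
  by rewrite !addr_ge0.
move=> z; have := gle z.
have H : `|z| ^+ 3 * expR `|z| <= `|z| ^+ 3 * expR (D * `|z|).
  by rewrite ler_wpM2l ?exprn_ge0// ler_expR ler_peMl.
have h1 := le_trans (sinh_taylor z) H; have h2 := le_trans (cosh_taylor z) H.
move: (`|z| ^+ 3 * _) h1 h2 => T h1 h2 {H}.
have l1 : c1 * ((expR z - expR (- z)) / 2 - z) <= `|c1| * T.
  by apply: (le_trans (ler_norm _)); rewrite normrM ler_wpM2l.
have l2 : c2 * (((expR z + expR (- z)) / 2 - 1) - z ^+ 2 / 2) <= `|c2| * T.
  by apply: (le_trans (ler_norm _)); rewrite normrM ler_wpM2l.
lra.
Qed.

End NormalExpansion.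

(** * Gaussian smoothing operators *)

Section GaussianOperators.
Context {R : realType} {m : nat}.
Notation V := (m.-tuple R).
Local Open Scope ereal_scope.

Definition tshift (x e : V) (z : R) : V :=
  [tuple (tnth x k + z * tnth e k)%R | k < m].

Definition gauss_op (s : R) (e : V) (Phi : V -> \bar R) (x : V) : \bar R :=
  \int[normal_prob 0 s]_z Phi (tshift x e z).

(** The mean of a nonnegative [Phi] at [x + \sum_j Z_j e_j] for independent [Z_j] of law
    [N(0, s^2)]: the list [es] stands for the Gaussian vector. Values in the extended reals make
    every such integral meaningful without integrability. *)
Definition gauss_ops (s : R) (es : seq V) (Phi : V -> \bar R) : V -> \bar R :=
  foldr (gauss_op s) Phi es.

Definition nonneg_measurable (Phi : V -> \bar R) :=
  measurable_fun [set: V] Phi /\ forall x, 0 <= Phi x.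

Lemma measurable_shift2 (e : V) :
  measurable_fun [set: V * R] (fun xz => tshift xz.1 e xz.2).
Proof.
apply/measurable_fun_tnthP => k.
rewrite (_ : _ \o _ = fun xz : V * R => (tnth xz.1 k + xz.2 * tnth e k)%R); last first.
  by apply/funext => xz /=; rewrite tnth_mktuple.
apply: measurable_funD.
  by apply: (measurableT_comp (measurable_tnth k)).
by apply: measurable_funM.
Qed.

Lemma measurable_shift (x e : V) : measurable_fun [set: R] (tshift x e).
Proof.
apply/measurable_fun_tnthP => k.
rewrite (_ : _ \o _ = fun z : R => (tnth x k + z * tnth e k)%R); last first.
  by apply/funext => z /=; rewrite tnth_mktuple.
by apply: measurable_funD => //; exact: measurable_funM.
Qed.

Lemma nonneg_measurable_shift Phi (x e : V) : nonneg_measurable Phi ->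
  measurable_fun [set: R] (fun z => Phi (tshift x e z)).
Proof.
move=> [mPhi _]; apply: (measurableT_comp mPhi); exact: measurable_shift.
Qed.

Lemma nonneg_measurable_gauss_op s e Phi : nonneg_measurable Phi ->
  nonneg_measurable (gauss_op s e Phi).
Proof.
move=> [mPhi Phi0]; split; last by move=> x; exact: integral_ge0.
pose f (xz : V * R) := Phi (tshift xz.1 e xz.2).
have mf : measurable_fun [set: V * R] f.
  by apply: (measurableT_comp mPhi); exact: measurable_shift2.
exact: (@measurable_fun_fubini_tonelli_F _ _ _ _ _ (normal_prob 0 s) _ mf (fun=> Phi0 _)).
Qed.

Lemma nonneg_measurable_gauss_ops s es Phi : nonneg_measurable Phi ->
  nonneg_measurable (gauss_ops s es Phi).
Proof. by move=> ?; elim: es => //= e es; exact: nonneg_measurable_gauss_op. Qed.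

Lemma le_gauss_op s e Phi Psi : nonneg_measurable Phi -> nonneg_measurable Psi ->
  (forall x, Phi x <= Psi x) -> forall x, gauss_op s e Phi x <= gauss_op s e Psi x.
Proof.
move=> mPhi mPsi PhiPsi x; apply: ge0_le_integral => //=.
- by move=> z _; case: mPhi.
- exact: nonneg_measurable_shift.
- exact: nonneg_measurable_shift.
Qed.

Lemma gauss_opD s e Phi Psi : nonneg_measurable Phi -> nonneg_measurable Psi ->
  gauss_op s e (fun x => Phi x + Psi x) =
  (fun x => gauss_op s e Phi x + gauss_op s e Psi x).
Proof.
move=> mPhi mPsi; apply/funext => x; rewrite /gauss_op ge0_integralD//=.
- by move=> z _; case: mPhi.
- exact: nonneg_measurable_shift.
- by move=> z _; case: mPsi.
- exact: nonneg_measurable_shift.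
Qed.

Lemma gauss_opZ s e Phi (a : R) : (0 <= a)%R -> nonneg_measurable Phi ->
  gauss_op s e (fun x => a%:E * Phi x) = (fun x => a%:E * gauss_op s e Phi x).
Proof.
move=> a0 mPhi; apply/funext => x; rewrite /gauss_op ge0_integralZl//=.
- exact: nonneg_measurable_shift.
- by move=> z _; case: mPhi.
Qed.

Lemma nonneg_measurableD Phi Psi : nonneg_measurable Phi -> nonneg_measurable Psi ->
  nonneg_measurable (fun x => Phi x + Psi x).
Proof.
move=> [mPhi Phi0] [mPsi Psi0]; split; first exact: emeasurable_funD.
by move=> x; rewrite adde_ge0.
Qed.

Lemma nonneg_measurableZ Phi (a : R) : (0 <= a)%R -> nonneg_measurable Phi ->
  nonneg_measurable (fun x => a%:E * Phi x).
Proof.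
move=> a0 [mPhi Phi0]; split; last by move=> x; rewrite mule_ge0.
by apply: emeasurable_funM.
Qed.

Lemma shiftAC (x e f : V) (z w : R) :
  tshift (tshift x e z) f w = tshift (tshift x f w) e z.
Proof. by apply: eq_from_tnth => k; rewrite !tnth_mktuple addrAC. Qed.

Lemma shiftD (x e : V) (z w : R) : tshift (tshift x e z) e w = tshift x e (z + w).
Proof. by apply: eq_from_tnth => k; rewrite !tnth_mktuple mulrDl addrA. Qed.

(** Tonelli, as shifts along two directions commute. *)
Lemma gauss_opC s t e f Phi : nonneg_measurable Phi ->
  gauss_op s e (gauss_op t f Phi) = gauss_op t f (gauss_op s e Phi).
Proof.
move=> [mPhi Phi0]; apply/funext => x; rewrite /gauss_op.
pose h (zw : R * R) := Phi (tshift (tshift x e zw.1) f zw.2).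
have mh : measurable_fun [set: R * R] h.
  have mg : measurable_fun [set: R * R] (fun zw => (tshift x e zw.1, zw.2)).
    by apply: measurable_fun_pair => //; apply: (measurableT_comp (measurable_shift x e)).
  exact: (measurableT_comp mPhi (measurableT_comp (measurable_shift2 f) mg)).
have := @fubini_tonelli _ _ _ _ _ (normal_prob 0 s) (normal_prob 0 t) _ mh (fun=> Phi0 _).
move=> ->; apply: eq_integral => w _; apply: eq_integral => z _.
by rewrite shiftAC.
Qed.

Lemma gauss_op_comp s t e Phi : (0 < s)%R -> (0 < t)%R -> nonneg_measurable Phi ->
  gauss_op s e (gauss_op t e Phi) = gauss_op (Num.sqrt (s ^+ 2 + t ^+ 2)) e Phi.
Proof.
move=> s0 t0 [mPhi Phi0]; apply/funext => x; rewrite /gauss_op.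
under eq_integral => z _ do under eq_integral => w _ do rewrite shiftD.
rewrite (@ge0_integral_normal_prob_conv _ _ _ (fun z => Phi (tshift x e z)))//.
exact: (measurableT_comp mPhi (measurable_shift x e)).
Qed.

Lemma gauss_ops_cat s es fs Phi :
  gauss_ops s (es ++ fs) Phi = gauss_ops s es (gauss_ops s fs Phi).
Proof. by rewrite /gauss_ops foldr_cat. Qed.

Lemma gauss_op_opsC s t e fs Phi : nonneg_measurable Phi ->
  gauss_op s e (gauss_ops t fs Phi) = gauss_ops t fs (gauss_op s e Phi).
Proof.
move=> mPhi; elim: fs => [//|f fs IH]; rewrite [LHS]/= [RHS]/= -IH.
by apply: gauss_opC; apply: nonneg_measurable_gauss_ops.
Qed.

Lemma gauss_opsC s t es fs Phi : nonneg_measurable Phi ->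
  gauss_ops s es (gauss_ops t fs Phi) = gauss_ops t fs (gauss_ops s es Phi).
Proof.
move=> mPhi; elim: es => [//|e es IH]; rewrite [LHS]/= IH.
by rewrite gauss_op_opsC; last exact: nonneg_measurable_gauss_ops.
Qed.

Lemma le_gauss_ops s es Phi Psi : nonneg_measurable Phi -> nonneg_measurable Psi ->
  (forall x, Phi x <= Psi x) -> forall x, gauss_ops s es Phi x <= gauss_ops s es Psi x.
Proof.
move=> mPhi mPsi le; elim: es => [//|e es IH] x; apply: le_gauss_op.
- exact: nonneg_measurable_gauss_ops.
- exact: nonneg_measurable_gauss_ops.
- exact: IH.
Qed.

Lemma gauss_opsD s es Phi Psi : nonneg_measurable Phi -> nonneg_measurable Psi ->
  gauss_ops s es (fun x => Phi x + Psi x) =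
  (fun x => gauss_ops s es Phi x + gauss_ops s es Psi x).
Proof.
move=> mPhi mPsi; elim: es => [//|e es IH]; rewrite [LHS]/= IH gauss_opD.
- by [].
- exact: nonneg_measurable_gauss_ops.
- exact: nonneg_measurable_gauss_ops.
Qed.

Lemma gauss_opsZ s es Phi (a : R) : (0 <= a)%R -> nonneg_measurable Phi ->
  gauss_ops s es (fun x => a%:E * Phi x) = (fun x => a%:E * gauss_ops s es Phi x).
Proof.
move=> a0 mPhi; elim: es => [//|e es IH]; rewrite [LHS]/= IH gauss_opZ.
- by [].
- by [].
- exact: nonneg_measurable_gauss_ops.
Qed.

(* Infinite divisibility: n independent copies of every direction, each with
   variance s^2 / n. *)
Lemma gauss_ops_split s es n Phi : (0 < s)%R -> (0 < n)%N -> nonneg_measurable Phi ->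
  gauss_ops s es Phi = iter n (gauss_ops (s / Num.sqrt n%:R) es) Phi.
Proof.
move=> s0 n0 mPhi.
have n0' : (0 < Num.sqrt n%:R :> R)%R by rewrite sqrtr_gt0 ltr0n.
have : (0 < s / Num.sqrt n%:R)%R by rewrite divr_gt0.
move tE : (s / Num.sqrt n%:R)%R => t t0.
have miter k : nonneg_measurable (iter k (gauss_ops t es) Phi).
  by elim: k => //= k; exact: nonneg_measurable_gauss_ops.
have H1 e k Psi : nonneg_measurable Psi ->
    iter k.+1 (gauss_op t e) Psi = gauss_op (t * Num.sqrt k.+1%:R)%R e Psi.
  move=> mPsi; elim: k => [|k IH]; first by rewrite /= sqrtr1 mulr1.
  have k0 : (0 < Num.sqrt k.+1%:R :> R)%R by rewrite sqrtr_gt0 ltr0n.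
  rewrite iterS IH (gauss_op_comp e t0 (mulr_gt0 t0 k0) mPsi).
  apply: (congr1 (fun a => gauss_op a e Psi)).
  rewrite exprMn (sqr_sqrtr (ler0n _ _)) -[X in (X + _)%R]mulr1 -mulrDr.
  by rewrite addrC natr1 (sqrtrM _ (sqr_ge0 t)) sqrtr_sqr (gtr0_norm t0).
(* Commutation regroups the copies direction by direction. *)
have H2 e es' k Psi : nonneg_measurable Psi ->
    iter k (gauss_ops t (e :: es')) Psi =
    iter k (gauss_op t e) (iter k (gauss_ops t es') Psi).
  move=> mPsi; have mI j : nonneg_measurable (iter j (gauss_ops t es') Psi).
    by elim: j => [//|j]; exact: nonneg_measurable_gauss_ops.
  elim: k => [//|k IH]; rewrite [LHS]iterS IH [LHS]/=.
  rewrite [RHS]iterS; congr (gauss_op _ _ _); rewrite iterS.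
  move: (iter k _ Psi) (mI k) => Xi mXi; elim: {IH}k => [//|k IH].
  rewrite !iterS -IH -gauss_op_opsC//.
  by elim: k {IH} => [//|k]; exact: nonneg_measurable_gauss_op.
elim: es {miter} => [|e es IH].
  by elim: (n) => // k IH; rewrite iterS -IH.
rewrite (H2 _ _ _ _ mPhi) -IH.
have := H1 e n.-1 _ (nonneg_measurable_gauss_ops s es mPhi).
rewrite (prednK n0) => ->.
apply: (congr1 (fun a => gauss_op a e (gauss_ops s es Phi))).
by rewrite -tE divfK// gt_eqF.
Qed.

End GaussianOperators.

(** * Softmax and Gaussian comparison *)

Section SoftMax.
Context {R : realType} {m : nat}.
Hypothesis m0 : (0 < m)%N.
Variables lam beta : R.
Hypotheses (lam0 : 0 < lam) (lamb : lam <= beta).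
Notation V := (m.-tuple R).

Let beta0 : 0 < beta. Proof. exact: lt_le_trans lamb. Qed.

Definition sumexp (x : V) : R := \sum_k expR (beta * tnth x k).

(** A smooth stand-in for [exp(lam max_k x_k)], exceeding it by a factor of at most
    [m^(lam / beta)]. The condition [lam <= beta] makes the exponent at most 1 and the off-diagonal
    entries of the Hessian nonpositive, the sign that Gaussian comparison needs. *)
Definition softmax (x : V) : R := sumexp x `^ (lam / beta).

Definition gibbs (x : V) (k : 'I_m) : R := expR (beta * tnth x k) / sumexp x.

Definition gibbs_mean (x : V) (g : 'I_m -> R) : R := \sum_k gibbs x k * g k.

(* softmax x * softmax_hess e x is the second derivative of softmax at x in
   direction e. *)
Definition softmax_hess (e x : V) : R :=
  lam * (beta * gibbs_mean x (fun k => tnth e k ^+ 2)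
         - (beta - lam) * gibbs_mean x (tnth e) ^+ 2).

Lemma sumexp_gt0 x : 0 < sumexp x.
Proof.
rewrite /sumexp (bigD1 (Ordinal m0))//= ltr_pwDl ?expR_gt0//.
by apply: sumr_ge0 => k _; exact: expR_ge0.
Qed.

Lemma softmax_gt0 x : 0 < softmax x.
Proof. by rewrite powR_gt0// sumexp_gt0. Qed.

Lemma gibbs_ge0 x k : 0 <= gibbs x k.
Proof. by rewrite divr_ge0 ?expR_ge0// ltW// sumexp_gt0. Qed.

Lemma sum_gibbs x : \sum_k gibbs x k = 1.
Proof. by rewrite -mulr_suml divff// gt_eqF// sumexp_gt0. Qed.

Lemma nonneg_measurable_softmax : nonneg_measurable (fun x => (softmax x)%:E).
Proof.
split; last by move=> x; rewrite lee_fin ltW// softmax_gt0.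
apply/measurable_EFinP; apply: (measurableT_comp (measurable_powR _)).
apply: measurable_sum => k; apply: measurableT_comp => //.
by apply: measurable_funM => //; exact: measurable_tnth.
Qed.

Lemma measurable_gibbs k : measurable_fun [set: V] (gibbs ^~ k).
Proof.
rewrite (_ : gibbs ^~ k = fun x => expR (beta * tnth x k) * sumexp x `^ (-1)); last first.
  by apply/funext => x; rewrite powR_inv1// ltW// sumexp_gt0.
have me j : measurable_fun [set: V] (fun x => expR (beta * tnth x j)).
  apply: measurableT_comp => //.
  by apply: measurable_funM => //; exact: measurable_tnth.
apply: measurable_funM; first exact: me.
apply: (measurableT_comp (measurable_powR _)).
by apply: measurable_sum => j; exact: me.
Qed.

Lemma measurable_softmax_hess e : measurable_fun [set: V] (softmax_hess e).
Proof.
have mg (g : 'I_m -> R) : measurable_fun [set: V] (gibbs_mean ^~ g).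
  apply: measurable_sum => k; apply: measurable_funM => //.
  exact: measurable_gibbs.
apply: measurable_funM => //; apply: measurable_funB; first exact: measurable_funM.
by apply: measurable_funM => //; apply: measurable_funX.
Qed.

Lemma sumexp_shift x e z : sumexp (tshift x e z) =
  sumexp x * \sum_k gibbs x k * expR (beta * (z * tnth e k)).
Proof.
rewrite mulr_sumr; apply: eq_bigr => k _; rewrite tnth_mktuple mulrDr expRD.
by rewrite /gibbs (mulrA (sumexp x)) [sumexp x * _]mulrC divfK// gt_eqF// sumexp_gt0.
Qed.

Section Direction.
Variables (e : V).
Hypothesis e1 : forall k, `|tnth e k| <= 1.

Let w_bound z k : `|beta * (z * tnth e k)| <= beta * `|z|.
Proof.
rewrite !normrM (gtr0_norm beta0) ler_wpM2l ?(ltW beta0)//.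
by rewrite ler_piMr.
Qed.

Let w_ge0 (z : R) : 0 <= beta * `|z|.
Proof. by rewrite mulr_ge0// ltW. Qed.

Let kappa01 : 0 <= lam / beta <= 1.
Proof. by rewrite divr_ge0 ?(ltW lam0) ?(ltW beta0)//= ler_pdivrMr// mul1r. Qed.

Let ka1 : -2 <= lam / beta - 1 <= 0.
Proof. by move: (lam / beta) kappa01 => a /andP[? ?]; apply/andP; split; lra. Qed.

Let ka2 : -2 <= lam / beta - 2 <= 0.
Proof. by move: (lam / beta) kappa01 => a /andP[? ?]; apply/andP; split; lra. Qed.

(** The difference is the variance of [e] under the Gibbs weights. *)
Lemma gibbs_mean_sqr_le x : gibbs_mean x (tnth e) ^+ 2 <=
  gibbs_mean x (fun k => tnth e k ^+ 2).
Proof.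
set a := gibbs_mean x (tnth e).
have : 0 <= \sum_k gibbs x k * (tnth e k - a) ^+ 2.
  by apply: sumr_ge0 => k _; rewrite mulr_ge0 ?gibbs_ge0 ?sqr_ge0.
have -> : \sum_k gibbs x k * (tnth e k - a) ^+ 2 =
    \sum_k (gibbs x k * tnth e k ^+ 2 - 2 * a * (gibbs x k * tnth e k)
            + a ^+ 2 * gibbs x k).
  by apply: eq_bigr => k _; ring.
rewrite big_split/= sumrB -!mulr_sumr sum_gibbs.
rewrite -/(gibbs_mean x (tnth e)) -/a -/(gibbs_mean x (fun k => tnth e k ^+ 2)).
lra.
Qed.

Lemma softmax_hess_bounds x : 0 <= softmax_hess e x <= lam * beta.
Proof.
have h := gibbs_mean_sqr_le x; have h0 := sqr_ge0 (gibbs_mean x (tnth e)).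
have h1 : gibbs_mean x (fun k => tnth e k ^+ 2) <= 1.
  apply: (le_trans (ler_norm _)); apply: ler_norm_wsum => [k||k].
  - exact: gibbs_ge0.
  - exact: sum_gibbs.
  - by rewrite normrX exprn_ile1.
rewrite /softmax_hess; apply/andP; split.
  rewrite mulr_ge0 ?(ltW lam0)// subr_ge0.
  by apply: ler_pM => //; rewrite ?subr_ge0// gerBl ltW.
rewrite ler_pM2l// lerBlDr -[X in X <= _]addr0 lerD//.
  by rewrite ler_piMr// ltW.
by rewrite mulr_ge0// subr_ge0.
Qed.

(** Dividing by [softmax x] leaves a power of a Gibbs-weighted mean of exponentials, so the error is
    relative. [softmax_hess] collects the term [m2 - (1 - lam / beta) m1^2] of its expansion. *)
Lemma softmax_shift_taylor x z :
  `|softmax (tshift x e z) - softmax x * (1 + lam * gibbs_mean x (tnth e) * z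
      + softmax_hess e x * z ^+ 2 / 2)| <=
  softmax x * (40 * beta ^+ 3) * (`|z| ^+ 3 * expR ((1 + 4 * beta) * `|z|)).
Proof.
have := lse_powR_taylor (gibbs_ge0 x) (sum_gibbs x) (w_bound z) (w_ge0 z) kappa01.
set y := \sum_k _ * expR _; set m1 := \sum_k _ * _; set m2 := \sum_k _ * _ ^+ 2.
have m1E : m1 = beta * z * gibbs_mean x (tnth e).
  by rewrite /m1 mulr_sumr; apply: eq_bigr => k _; ring.
have m2E : m2 = (beta * z) ^+ 2 * gibbs_mean x (fun k => tnth e k ^+ 2).
  by rewrite /m2 mulr_sumr; apply: eq_bigr => k _; ring.
move=> H.
have y0 : 0 <= y by apply: sumr_ge0 => k _; rewrite mulr_ge0 ?gibbs_ge0 ?expR_ge0.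
rewrite /softmax sumexp_shift powRM// ?(ltW (sumexp_gt0 x))// -/(softmax x).
rewrite -mulrBr normrM (gtr0_norm (softmax_gt0 x)) -[X in _ <= X]mulrA.
rewrite ler_pM2l ?softmax_gt0//.
have -> : 1 + lam * gibbs_mean x (tnth e) * z + softmax_hess e x * z ^+ 2 / 2 =
  1 + lam / beta * m1 + lam / beta * (m2 - (1 - lam / beta) * m1 ^+ 2) / 2.
  rewrite m1E m2E /softmax_hess.
  move: (gibbs_mean _ _) (gibbs_mean _ _) => a b; field.
  by rewrite gt_eqF.
apply: (le_trans H); rewrite exprMn [40 * _]mulrA -[X in X <= _](mulrA (40 * _)).
rewrite ler_wpM2l ?mulr_ge0 ?exprn_ge0 ?(ltW beta0)// ler_wpM2l ?exprn_ge0//.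
rewrite ler_expR.
have := normr_ge0 z; move: (`|z|) => u u0; have := mulr_ge0 (ltW beta0) u0; lra.
Qed.

(** At the shifted point a Gibbs weight times [y^(lam / beta)] is the old weight times [exp u * y^a]
    with [u = t_k], [a = lam / beta - 1]; in the squared mean two weights meet, hence
    [u = t_k + t_j] and [a = lam / beta - 2]. Both cases fall under [gibbs_weight_bound]. *)
Lemma softmax_hess_shift x z (f : V) : (forall k, `|tnth f k| <= 1) ->
  `|softmax (tshift x e z) * softmax_hess f (tshift x e z) -
    softmax x * softmax_hess f x| <=
  softmax x * (8 * lam * beta ^+ 2) * (`|z| ^+ 1 * expR ((1 + 4 * beta) * `|z|)).
Proof.
move=> f1; set x' := tshift x e z.
pose t k := beta * (z * tnth e k); set w := beta * `|z|.
pose y := \sum_k gibbs x k * expR (t k).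
have y0 : 0 < y by exact: (wsum_expR_gt0 (gibbs_ge0 x) (sum_gibbs x) (w_bound z)).
have gE k : gibbs x' k = gibbs x k * expR (t k) / y.
  rewrite /gibbs sumexp_shift tnth_mktuple mulrDr expRD -/y -/(t k).
  by field; rewrite !gt_eqF ?sumexp_gt0.
have sE : softmax x' = softmax x * y `^ (lam / beta).
  by rewrite /softmax sumexp_shift powRM ?(ltW y0)// ltW// sumexp_gt0.
have W (a u : R) : -2 <= a <= 0 -> `|u| <= 2 * w ->
    `|expR u * y `^ a - 1| <= 4 * w * expR (4 * w).
  exact: (gibbs_weight_bound (gibbs_ge0 x) (sum_gibbs x) (w_bound z) (w_ge0 z)).
have tw k : `|t k| <= w by exact: w_bound.
have w0 : 0 <= w by exact: w_ge0.
have tw2 k : `|t k| <= 2 * w by apply: (le_trans (tw k)); rewrite ler_peMl// ler1n.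
have tw4 k j : `|t k + t j| <= 2 * w.
  by rewrite (_ : 2 * w = w + w); [exact: (le_trans (ler_normD _ _) (lerD _ _))|ring].
set C := 4 * w * expR (4 * w) in W *.
have yD (a b : R) : y `^ a * y `^ b = y `^ (a + b).
  by rewrite powRD// (gt_eqF y0) implybT.
have yinv : y^-1 = y `^ (-1) by rewrite powR_inv1// ltW.
have B1 : `|y `^ (lam / beta) * gibbs_mean x' (fun k => tnth f k ^+ 2) -
    gibbs_mean x (fun k => tnth f k ^+ 2)| <= C.
  rewrite /gibbs_mean mulr_sumr -sumrB.
  under eq_bigr => k _.
    rewrite gE (_ : _ - _ = gibbs x k * ((expR (t k) * y `^ (lam / beta - 1) - 1)
       * tnth f k ^+ 2)); last by rewrite -yD -yinv; ring.
    over.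
  apply: (ler_norm_wsum (gibbs_ge0 x) (sum_gibbs x)) => k.
  rewrite normrM -[C]mulr1; apply: ler_pM; rewrite ?normr_ge0//.
    exact: (W _ _ ka1 (tw2 k)).
  by rewrite normrX exprn_ile1.
have B2 : `|y `^ (lam / beta) * gibbs_mean x' (tnth f) ^+ 2 -
    gibbs_mean x (tnth f) ^+ 2| <= C.
  have -> : y `^ (lam / beta) * gibbs_mean x' (tnth f) ^+ 2 -
      gibbs_mean x (tnth f) ^+ 2 = \sum_k gibbs x k * (tnth f k *
      \sum_j gibbs x j * (tnth f j * (expR (t k + t j) * y `^ (lam / beta - 2) - 1))).
    have -> : gibbs_mean x' (tnth f) = (\sum_k gibbs x k * expR (t k) * tnth f k) / y.
      by rewrite /gibbs_mean mulr_suml; apply: eq_bigr => k _; rewrite gE; ring.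
    rewrite expr_div_n mulrCA -(_ : y `^ (lam / beta - 2) = y `^ (lam / beta) / y ^+ 2); last first.
      by rewrite -yD powR_invn// ltW.
    rewrite !expr2 !mulr_suml -sumrB; apply: eq_bigr => k _.
    rewrite [X in X * _ - _]mulr_sumr mulr_suml /gibbs_mean mulr_sumr -sumrB !mulr_sumr.
    by apply: eq_bigr => j _; rewrite expRD; ring.
  apply: (ler_norm_wsum (gibbs_ge0 x) (sum_gibbs x)) => k.
  rewrite normrM -[C]mul1r; apply: ler_pM; rewrite ?normr_ge0//.
  apply: (ler_norm_wsum (gibbs_ge0 x) (sum_gibbs x)) => j.
  rewrite normrM -[C]mul1r; apply: ler_pM; rewrite ?normr_ge0//.
  exact: (W _ _ ka2 (tw4 k j)).
rewrite sE /softmax_hess -mulrA -mulrBr normrM (gtr0_norm (softmax_gt0 x)) -[X in _ <= X]mulrA.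
rewrite ler_pM2l ?softmax_gt0//.
have -> : forall Y a b a' b' : R, Y * (lam * (beta * a' - (beta - lam) * b')) -
   lam * (beta * a - (beta - lam) * b) =
   lam * (beta * (Y * a' - a) - (beta - lam) * (Y * b' - b)) by move=> *; ring.
rewrite normrM (gtr0_norm lam0).
apply: (@le_trans _ _ (lam * (2 * beta * C))).
  rewrite ler_pM2l//; apply: (le_trans (ler_normB _ _)).
  rewrite !normrM (gtr0_norm beta0) (ger0_norm (_ : 0 <= beta - lam)) ?subr_ge0//.
  have C0 : 0 <= C by exact: le_trans B1.
  have b1 := ler_wpM2l (ltW beta0) B1.
  have b2 : (beta - lam) * `|y `^ (lam / beta) * gibbs_mean x' (tnth f) ^+ 2 -
    gibbs_mean x (tnth f) ^+ 2| <= beta * C.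
    by rewrite ler_pM ?subr_ge0// gerBl ltW.
  lra.
rewrite /C /w expr1 (_ : lam * _ = 8 * lam * beta ^+ 2 * (`|z| * expR (4 * (beta * `|z|)))); last by ring.
apply: ler_wpM2l; first by rewrite mulr_ge0 ?sqr_ge0// mulr_ge0// ltW.
apply: ler_wpM2l; first exact: normr_ge0.
by rewrite ler_expR; move: (`|z|) (normr_ge0 z) => u u0; lra.
Qed.

End Direction.

End SoftMax.

Lemma ler_norm_sumB (R : realType) (T : eqType) (es : seq T) (f g : T -> R) (a b C : R) :
  (forall e, e \in es -> `|a * f e - b * g e| <= C) ->
  `|a * \sum_(e <- es) f e - b * \sum_(e <- es) g e| <= (size es)%:R * C.
Proof.
elim: es => [|e es IH] h.
  by rewrite !big_nil !mulr0 subrr normr0 mul0r.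
rewrite !big_cons !mulrDr opprD addrACA /= -natr1 mulrDl mul1r addrC.
apply: (le_trans (ler_normD _ _) (lerD _ _)); last by apply: h; exact: mem_head.
by apply: IH => f' fes; apply: h; rewrite inE fes orbT.
Qed.

Lemma sum_bounds (R : realType) (T : eqType) (es : seq T) (f : T -> R) (B : R) :
  (forall e, e \in es -> 0 <= f e <= B) ->
  0 <= \sum_(e <- es) f e <= (size es)%:R * B.
Proof.
elim: es => [|e es IH] h; first by rewrite big_nil mul0r lexx.
have /andP[h1 h2] := h e (mem_head _ _).
have /andP[h3 h4] : 0 <= \sum_(e <- es) f e <= (size es)%:R * B.
  by apply: IH => e' e'es; apply: h; rewrite inE e'es orbT.
by rewrite big_cons addr_ge0//= -natr1 mulrDl mul1r addrC lerD.
Qed.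

Section SoftMaxStep.
Context {R : realType} {m : nat}.
Hypothesis m0 : (0 < m)%N.
Variables lam beta : R.
Hypotheses (lam0 : 0 < lam) (lamb : lam <= beta).
Notation V := (m.-tuple R).
Notation F := (@softmax R m lam beta).
Notation FE := (fun x : V => (softmax lam beta x)%:E).
Notation H := (@softmax_hess R m lam beta).

Let beta0 : 0 < beta. Proof. exact: lt_le_trans lamb. Qed.

Definition unit_box (e : V) : Prop := forall k, `|tnth e k| <= 1.

(** Relative to [softmax x], the coefficient of [s^2 / 2] in the expansion of [gauss_ops s es] at
    [x]. *)
Definition hess_sum (es : seq V) (x : V) : R := \sum_(e <- es) H e x.

Let D := 1 + 4 * beta.
Let A0 := (40 * beta ^+ 3 + lam + lam * beta) * moment_cst D.
Let A1 := 8 * lam * beta ^+ 2 * moment_cst D.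

Let D1 : 1 <= D. Proof. by rewrite lerDl mulr_ge0// ltW. Qed.
Let D0 : 0 <= D. Proof. exact: le_trans D1. Qed.
Let MC0 : 0 <= moment_cst D.
Proof. by rewrite /moment_cst !mulr_ge0 ?expR_ge0 ?sqrtr_ge0. Qed.
Let A00 : 0 <= A0.
Proof. by rewrite mulr_ge0// !addr_ge0 ?mulr_ge0 ?exprn_ge0 ?(ltW beta0) ?(ltW lam0). Qed.
Let A10 : 0 <= A1.
Proof. by rewrite mulr_ge0// mulr_ge0 ?sqr_ge0// mulr_ge0// ltW. Qed.
Let F0 (x : V) : 0 < F x. Proof. exact: softmax_gt0. Qed.
Let F00 (x : V) : 0 <= F x. Proof. exact: ltW (F0 x). Qed.

Let mF : nonneg_measurable FE. Proof. exact: nonneg_measurable_softmax. Qed.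

Lemma hess_sum_bounds es x : (forall e, e \in es -> unit_box e) ->
  0 <= hess_sum es x <= (size es)%:R * (lam * beta).
Proof.
by move=> es1; apply: sum_bounds => e /es1 e1; exact: softmax_hess_bounds.
Qed.

Lemma nonneg_measurable_hess_sum es : (forall e, e \in es -> unit_box e) ->
  nonneg_measurable (fun x => (F x * hess_sum es x)%:E).
Proof.
move=> es1; split; last first.
  by move=> x; rewrite lee_fin mulr_ge0//; case/andP: (hess_sum_bounds x es1).
apply/measurable_EFinP; apply: measurable_funM.
  by apply/measurable_EFinP; case: mF.
by apply: measurable_sum => e; exact: measurable_softmax_hess.
Qed.

Section OneDirection.
Variables (e : V) (e1 : unit_box e).

Let c1_bound x : `|F x * (lam * gibbs_mean beta x (tnth e))| <= F x * lam.
Proof.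
rewrite normrM (ger0_norm (F00 x)); apply: ler_wpM2l => //.
rewrite normrM (gtr0_norm lam0) -[X in _ <= X]mulr1; apply: ler_wpM2l; first exact: ltW.
by apply: ler_norm_wsum; [exact: gibbs_ge0|exact: sum_gibbs|exact: e1].
Qed.

Let c2_bound x : `|F x * H e x| <= F x * (lam * beta).
Proof.
have /andP[h1 h2] := softmax_hess_bounds m0 lam0 lamb e1 x.
by rewrite (ger0_norm (mulr_ge0 (F00 x) h1)); exact: (ler_wpM2l (F00 x) h2).
Qed.

Let mFs x : measurable_fun [set: R] (fun z => F (tshift x e z)).
Proof.
by apply/measurable_EFinP; exact: (nonneg_measurable_shift x e mF).
Qed.

Let error_bound x (s : R) : 0 < s <= 1 ->
  (F x * (40 * beta ^+ 3) + `|F x * (lam * gibbs_mean beta x (tnth e))|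
     + `|F x * H e x|) * (moment_cst D * s ^+ 3) <= F x * (A0 * s ^+ 3).
Proof.
move=> /andP[s0 s1].
have -> : F x * (A0 * s ^+ 3) =
    F x * (40 * beta ^+ 3 + lam + lam * beta) * (moment_cst D * s ^+ 3).
  by rewrite /A0; ring.
apply: ler_wpM2r; first by apply: mulr_ge0 => //; apply: exprn_ge0; exact: ltW.
rewrite !mulrDr; apply: lerD; last exact: c2_bound.
by apply: lerD; last exact: c1_bound.
Qed.

(** The first-order term integrates to zero; its coefficient only enters the error, which is why
    [A0] contains [lam]. *)
Lemma gauss_op_softmax_le (s : R) x : 0 < s <= 1 ->
  (gauss_op s e FE x <= (F x * (1 + half_var s * H e x + A0 * s ^+ 3))%:E)%E.
Proof.
move=> s01; rewrite /gauss_op.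
have M0 : 0 <= F x * (40 * beta ^+ 3).
  by apply: mulr_ge0 => //; apply: mulr_ge0 => //; apply: exprn_ge0; exact: ltW.
have h z : F (tshift x e z) <= F x + F x * (lam * gibbs_mean beta x (tnth e)) * z +
    F x * H e x * z ^+ 2 / 2 +
    F x * (40 * beta ^+ 3) * (`|z| ^+ 3 * expR (D * `|z|)).
  have := softmax_shift_taylor m0 lam0 lamb e1 x z.
  by rewrite !mulrDr mulr1 !mulrA => /ler_distlDr.
have T := le_normal_taylor (mFs x) (fun z => F00 (tshift x e z)) D1 M0 s01 h.
apply: (le_trans T); rewrite lee_fin.
have -> : F x * (1 + half_var s * H e x + A0 * s ^+ 3) =
    F x + F x * H e x * half_var s + F x * (A0 * s ^+ 3) by ring.
by rewrite lerD2l; exact: error_bound.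
Qed.

Lemma gauss_op_softmax_ge (s : R) x : 0 < s <= 1 ->
  ((F x * (1 + half_var s * H e x))%:E <=
   gauss_op s e FE x + (F x * (A0 * s ^+ 3))%:E)%E.
Proof.
move=> s01; rewrite /gauss_op.
have M0 : 0 <= F x * (40 * beta ^+ 3).
  by apply: mulr_ge0 => //; apply: mulr_ge0 => //; apply: exprn_ge0; exact: ltW.
have h z : F x + F x * (lam * gibbs_mean beta x (tnth e)) * z +
    F x * H e x * z ^+ 2 / 2 <= F (tshift x e z) +
    F x * (40 * beta ^+ 3) * (`|z| ^+ 3 * expR (D * `|z|)).
  have := softmax_shift_taylor m0 lam0 lamb e1 x z.
  by rewrite !mulrDr mulr1 !mulrA => /ler_distlCDr.
have T := ge_normal_taylor (mFs x) (fun z => F00 (tshift x e z)) D1 M0 s01 h.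
have -> : F x * (1 + half_var s * H e x) = F x + F x * H e x * half_var s by ring.
by apply: (le_trans T); rewrite leeD2l// lee_fin error_bound.
Qed.

Variables (es : seq V) (es1 : forall f, f \in es -> unit_box f).

Let hess_sum_shift x z :
  `|F (tshift x e z) * hess_sum es (tshift x e z) - F x * hess_sum es x| <=
  (size es)%:R * (F x * (8 * lam * beta ^+ 2)) * (`|z| ^+ 1 * expR (D * `|z|)).
Proof.
rewrite -mulrA /hess_sum; apply: ler_norm_sumB => f fes.
exact: (softmax_hess_shift m0 lam0 lamb e1 x z (es1 fes)).
Qed.

Let mFHs x : measurable_fun [set: R]
  (fun z => F (tshift x e z) * hess_sum es (tshift x e z)).
Proof.
apply/measurable_EFinP.
exact: (nonneg_measurable_shift x e (nonneg_measurable_hess_sum es1)).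
Qed.

Let FHs0 x (z : R) : 0 <= F (tshift x e z) * hess_sum es (tshift x e z).
Proof. by rewrite mulr_ge0//; case/andP: (hess_sum_bounds (tshift x e z) es1). Qed.

Let M10 x : 0 <= (size es)%:R * (F x * (8 * lam * beta ^+ 2)).
Proof.
apply: mulr_ge0 => //; apply: mulr_ge0 => //.
by apply: mulr_ge0; [apply: mulr_ge0 => //; exact: ltW|exact: sqr_ge0].
Qed.

(** An error of order [s] suffices: this term will be multiplied by [half_var s <= s^2]. *)
Lemma gauss_op_hess_sum_le (s : R) x : 0 < s <= 1 ->
  (gauss_op s e (fun y => (F y * hess_sum es y)%:E) x <=
   (F x * (hess_sum es x + (size es)%:R * A1 * s))%:E)%E.
Proof.
move=> s01; rewrite /gauss_op.
have h z : F (tshift x e z) * hess_sum es (tshift x e z) <=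
    F x * hess_sum es x + 0 * expR z + 0 * expR (- z) +
    (size es)%:R * (F x * (8 * lam * beta ^+ 2)) * (`|z| ^+ 1 * expR (D * `|z|)).
  by rewrite !mul0r !addr0; apply: ler_distlDr; exact: hess_sum_shift.
have T := le_normal_expansion (mFHs x) (FHs0 x) (isT : (1 <= 3)%N) D0 (M10 x) s01 h.
apply: (le_trans T).
by rewrite lee_fin le_eqVlt; apply/orP; left; apply/eqP; rewrite /A1; ring.
Qed.

Lemma gauss_op_hess_sum_ge (s : R) x : 0 < s <= 1 ->
  ((F x * hess_sum es x)%:E <=
   gauss_op s e (fun y => (F y * hess_sum es y)%:E) x +
   (F x * ((size es)%:R * A1 * s))%:E)%E.
Proof.
move=> s01; rewrite /gauss_op.
have h z : F x * hess_sum es x + 0 * expR z + 0 * expR (- z) <=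
    F (tshift x e z) * hess_sum es (tshift x e z) +
    (size es)%:R * (F x * (8 * lam * beta ^+ 2)) * (`|z| ^+ 1 * expR (D * `|z|)).
  by rewrite !mul0r !addr0; apply: ler_distlCDr; exact: hess_sum_shift.
have T := ge_normal_expansion (mFHs x) (FHs0 x) (isT : (1 <= 3)%N) D0 (M10 x) s01 h.
have -> : F x * hess_sum es x = F x * hess_sum es x + (0 + 0) * expR (s ^+ 2 / 2).
  by rewrite addr0 mul0r addr0.
apply: (le_trans T); rewrite leeD2l// lee_fin le_eqVlt; apply/orP; left; apply/eqP.
by rewrite /A1; ring.
Qed.

End OneDirection.
End SoftMaxStep.

Lemma ge0_bounded_EFin (R : realType) (y : \bar R) (c : R) :
  (0 <= y)%E -> (y <= c%:E)%E -> exists r, y = r%:E.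
Proof. by case: y => [r||]// _ _; exists r. Qed.

(** * Exchange of Gaussian directions for an abstract function *)

Section Lindeberg.
Context {R : realType} {m : nat}.
Notation V := (m.-tuple R).
Variables (F : V -> R) (H : V -> V -> R) (U : V -> Prop) (B A0 A1 : R).
Local Notation FE := (fun x : V => (F x)%:E).
Hypotheses (B0 : 0 <= B) (A00 : 0 <= A0) (A10 : 0 <= A1).
Hypothesis F0 : forall x, 0 < F x.
Hypothesis mF : nonneg_measurable (fun x => (F x)%:E).
Hypothesis HB : forall e x, U e -> 0 <= H e x <= B.

Let HS (es : seq V) (x : V) : R := \sum_(e <- es) H e x.
Let UA (es : seq V) := forall e, e \in es -> U e.

Hypothesis mFH : forall es, UA es ->
  nonneg_measurable (fun x => (F x * \sum_(e <- es) H e x)%:E).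
Hypothesis F_le : forall e s x, U e -> 0 < s <= 1 ->
  (gauss_op s e FE x <=
   (F x * (1 + half_var s * H e x + A0 * s ^+ 3))%:E)%E.
Hypothesis F_ge : forall e s x, U e -> 0 < s <= 1 ->
  ((F x * (1 + half_var s * H e x))%:E <=
   gauss_op s e FE x + (F x * (A0 * s ^+ 3))%:E)%E.
Hypothesis FH_le : forall e es s x, U e -> UA es -> 0 < s <= 1 ->
  (gauss_op s e (fun y => (F y * \sum_(e <- es) H e y)%:E) x <=
   (F x * (\sum_(e <- es) H e x + (size es)%:R * A1 * s))%:E)%E.
Hypothesis FH_ge : forall e es s x, U e -> UA es -> 0 < s <= 1 ->
  ((F x * \sum_(e <- es) H e x)%:E <=
   gauss_op s e (fun y => (F y * \sum_(e <- es) H e y)%:E) x +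
   (F x * ((size es)%:R * A1 * s))%:E)%E.

Let UA_cons e es : UA (e :: es) -> U e /\ UA es.
Proof.
move=> h; split; first by apply: h; exact: mem_head.
by move=> f fes; apply: h; rewrite inE fes orbT.
Qed.

Let HS_bounds es x : UA es -> 0 <= HS es x <= (size es)%:R * B.
Proof. by move=> Ues; apply: sum_bounds => e /Ues; exact: HB. Qed.

Let hv_bounds (s : R) : 0 < s <= 1 -> [/\ 0 <= half_var s, half_var s <= s ^+ 2 &
  half_var s <= 1].
Proof.
move=> s01; have /andP[h1 h2] := half_var_bounds s01.
split => //; apply: (le_trans h2); move: s01 => /andP[s0 s1].
by rewrite exprn_ile1// ltW.
Qed.

Lemma gauss_ops_le es : UA es -> exists2 A, 0 <= A & forall s x, 0 < s <= 1 ->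
  (gauss_ops s es FE x <=
   (F x * (1 + half_var s * HS es x + A * s ^+ 3))%:E)%E.
Proof.
elim: es => [_|e es IH /UA_cons[Ue Ues]].
  exists 0 => // s x _.
  by rewrite /HS big_nil mulr0 addr0 mul0r addr0 mulr1.
have [A A_0 hA] := IH Ues.
exists (A + A * B + A0 + A * A0 + (size es)%:R * A1).
  by rewrite !addr_ge0 ?mulr_ge0.
move=> s x s01; have /andP[s0 s1] := s01.
have [hv0 hv2 hv1] := hv_bounds s01.
have s3 : 0 <= s ^+ 3 by rewrite exprn_ge0// ltW.
have s31 : s ^+ 3 <= 1 by rewrite exprn_ile1// ltW.
have E : (fun y => (F y * (1 + half_var s * HS es y + A * s ^+ 3))%:E) =
    (fun y => (1 + A * s ^+ 3)%:E * (F y)%:E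
      + (half_var s)%:E * (F y * HS es y)%:E)%E.
  by apply/funext => y; rewrite -!EFinM -EFinD; congr EFin; ring.
have mFs := nonneg_measurableZ (_ : 0 <= 1 + A * s ^+ 3) mF.
have {}mFs := mFs (addr_ge0 ler01 (mulr_ge0 A_0 s3)).
have mHs := nonneg_measurableZ hv0 (mFH Ues).
have H1 : (gauss_op s e (gauss_ops s es FE) x <=
    gauss_op s e (fun y => (F y * (1 + half_var s * HS es y + A * s ^+ 3))%:E) x)%E.
  apply: le_gauss_op; first exact: nonneg_measurable_gauss_ops.
    by rewrite E; exact: nonneg_measurableD.
  by move=> y; exact: hA.
have p0 : 0 <= 1 + A * s ^+ 3 by rewrite addr_ge0// mulr_ge0.
apply: (le_trans H1); rewrite E (gauss_opD _ _ mFs mHs) (gauss_opZ _ _ p0 mF).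
rewrite (gauss_opZ _ _ hv0 (mFH Ues)).
have P0 : (0%:E <= (1 + A * s ^+ 3)%:E :> \bar R)%E.
  by rewrite lee_fin.
apply: (le_trans (leeD (lee_wpmul2l P0 (F_le x Ue s01))
  (lee_wpmul2l (_ : 0%:E <= (half_var s)%:E)%E (FH_le x Ue Ues s01)))) => //.
rewrite -!EFinM -EFinD lee_fin /HS big_cons -/(HS es x).
have -> : (1 + A * s ^+ 3) * (F x * (1 + half_var s * H e x + A0 * s ^+ 3)) +
  half_var s * (F x * (HS es x + (size es)%:R * A1 * s)) =
  F x * ((1 + A * s ^+ 3) * (1 + half_var s * H e x + A0 * s ^+ 3) +
  half_var s * (HS es x + (size es)%:R * A1 * s)) by ring.
rewrite ler_pM2l//.
have /andP[He0 HeB] := HB x Ue.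
have k1 : A * s ^+ 3 * (half_var s * H e x) <= A * s ^+ 3 * B.
  apply: ler_wpM2l; first exact: mulr_ge0.
  by rewrite -[B]mul1r; apply: ler_pM.
have k2 : A * s ^+ 3 * (A0 * s ^+ 3) <= A * s ^+ 3 * A0.
  apply: ler_wpM2l; first exact: mulr_ge0.
  by rewrite ler_piMr.
have k3 : half_var s * ((size es)%:R * A1 * s) <= (size es)%:R * A1 * s ^+ 3.
  rewrite mulrCA exprSr; apply: ler_wpM2l; first exact: mulr_ge0.
  by apply: ler_wpM2r => //; exact: ltW.
move: (half_var s) (H e x) (HS es x) k1 k2 k3 => v he hs k1 k2 k3.
move: ((size es)%:R * A1) k3 => c k3; lra.
Qed.

Lemma gauss_ops_ge es : UA es -> exists2 A, 0 <= A & forall s x, 0 < s <= 1 ->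
  ((F x * (1 + half_var s * HS es x))%:E <=
   gauss_ops s es FE x + (F x * (A * s ^+ 3))%:E)%E.
Proof.
elim: es => [_|e es IH /UA_cons[Ue Ues]].
  exists 0 => // s x _.
  by rewrite /HS big_nil mulr0 addr0 mul0r mulr0 mulr1 adde0.
have [A A_0 hA] := IH Ues.
exists (A * (1 + B + A0) + A0 + (size es)%:R * A1).
  by rewrite !addr_ge0 ?mulr_ge0 ?addr_ge0.
move=> s x s01; have /andP[s0 s1] := s01.
have [hv0 hv2 hv1] := hv_bounds s01.
have s3 : 0 <= s ^+ 3 by rewrite exprn_ge0// ltW.
have s31 : s ^+ 3 <= 1 by rewrite exprn_ile1// ltW.
have As3 : 0 <= A * s ^+ 3 by rewrite mulr_ge0.
have mHs := nonneg_measurableZ hv0 (mFH Ues).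
have mAF := nonneg_measurableZ As3 mF.
have mK := nonneg_measurable_gauss_ops s es mF.
(* The error is added on the right instead of being subtracted on the left, which keeps both
   functions nonnegative. *)
have H1 : (gauss_op s e (fun y => (F y)%:E + (half_var s)%:E * (F y * HS es y)%:E) x <=
    gauss_op s e (fun y => gauss_ops s es FE y
      + (A * s ^+ 3)%:E * (F y)%:E) x)%E.
  apply: le_gauss_op; [exact: nonneg_measurableD|exact: nonneg_measurableD|].
  move=> y; apply: le_trans (le_trans (hA s y s01) _).
    by rewrite -EFinM -EFinD lee_fin le_eqVlt; apply/orP; left; apply/eqP; ring.
  by rewrite leeD2l// -EFinM lee_fin le_eqVlt; apply/orP; left; apply/eqP; ring.
rewrite (gauss_opD _ _ mF mHs) (gauss_opZ _ _ hv0 (mFH Ues)) in H1.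
rewrite (gauss_opD _ _ mK mAF) (gauss_opZ _ _ As3 mF) in H1.
rewrite /HS big_cons -/(HS es x).
have G1 := F_ge x Ue s01.
have hvE : (0%:E <= (half_var s)%:E :> \bar R)%E by rewrite lee_fin.
have G2 := lee_wpmul2l hvE (FH_ge x Ue Ues s01).
rewrite -/(HS es x) in G2.
have As3E : (0%:E <= (A * s ^+ 3)%:E :> \bar R)%E by rewrite lee_fin.
have G3 := lee_wpmul2l As3E (F_le x Ue s01).
have /andP[He0 HeB] := HB x Ue.
have [K0 K00] : nonneg_measurable (gauss_op s e FE).
  exact: nonneg_measurable_gauss_op.
have [L0 L00] : nonneg_measurable
    (gauss_op s e (fun y => (F y * \sum_(e <- es) H e y)%:E)).
  exact: nonneg_measurable_gauss_op (mFH Ues).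
(* These two integrals are finite by the upper bounds, which allows real arithmetic; the third may
   be infinite, and then the claim is trivial. *)
have [k kE] := ge0_bounded_EFin (K00 x) (F_le x Ue s01).
have [l lE] := ge0_bounded_EFin (L00 x) (FH_le x Ue Ues s01).
move: G1 G2 G3 H1; rewrite [gauss_ops s (e :: es) _ x]/= kE lE.
move: (gauss_op s e (gauss_ops s es FE) x) => KK G1 G2 G3.
rewrite -?EFinM -?EFinD !lee_fin in G1 G2 G3; rewrite -?EFinM -?EFinD.
case: KK => [kk||] //; last first.
  by move=> _; rewrite addye// leey.
rewrite -EFinD !lee_fin => H1.
have s30 := ler_wpM2l (ltW (F0 x)) s31.
have k1 : A * s ^+ 3 * k <= F x * (A * (1 + B + A0) * s ^+ 3).
  apply: (le_trans G3).
  rewrite (_ : F x * (A * _ * _) = A * s ^+ 3 * (F x * (1 + B + A0))); last by ring.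
  rewrite ler_wpM2l// ler_pM2l// lerD//; last by rewrite ler_piMr.
  by rewrite lerD2l -[B]mul1r; apply: ler_pM.
have k3 : half_var s * (F x * ((size es)%:R * A1 * s)) <= F x * ((size es)%:R * A1 * s ^+ 3).
  rewrite mulrCA ler_pM2l// mulrCA exprSr; apply: ler_wpM2l; first exact: mulr_ge0.
  by apply: ler_wpM2r => //; exact: ltW.
move: (half_var s) (H e x) (HS es x) H1 G1 G2 k3 => v he hs H1 G1 G2 k3.
move: (F x) (A * (1 + B + A0)) ((size es)%:R * A1) k1 G1 G2 k3 => f a1 a2 k1 G1 G2 k3.
lra.
Qed.

Lemma gauss_ops_growth es : UA es -> exists2 C, 0 <= C & forall s x, 0 < s <= 1 ->
  (gauss_ops s es FE x <= (F x * (1 + C * s ^+ 2))%:E)%E.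
Proof.
move=> Ues; have [A A_0 hA] := gauss_ops_le Ues.
exists ((size es)%:R * B + A); first by rewrite addr_ge0// mulr_ge0.
move=> s x s01; apply: (le_trans (hA s x s01)); rewrite lee_fin ler_pM2l//.
have [hv0 hv2 hv1] := hv_bounds s01; have /andP[h1 h2] := HS_bounds x Ues.
move: s01 => /andP[s0 s1].
have k1 : half_var s * HS es x <= s ^+ 2 * ((size es)%:R * B) by apply: ler_pM.
have k2 : A * s ^+ 3 <= A * s ^+ 2.
  by apply: ler_wpM2l => //; rewrite exprSr; apply: ler_piMr => //; exact: sqr_ge0.
rewrite -addrA lerD2l (_ : (_ + A) * s ^+ 2 = s ^+ 2 * ((size es)%:R * B) + A * s ^+ 2).
  exact: lerD k1 k2.
by ring.
Qed.

(** The terms of order [s^2] compare by hypothesis; only errors of order [s^3] remain. *)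
Lemma gauss_ops_compare es fs : UA es -> UA fs ->
  (forall x, HS es x <= HS fs x) ->
  exists2 C, 0 <= C & forall s x, 0 < s <= 1 ->
    (gauss_ops s es FE x <=
     gauss_ops s fs FE x + (C * s ^+ 3)%:E * (F x)%:E)%E.
Proof.
move=> Ues Ufs HSle; have [A A_0 hA] := gauss_ops_le Ues.
have [A' A'0 hA'] := gauss_ops_ge Ufs.
exists (A + A'); first by rewrite addr_ge0.
move=> s x s01; apply: (le_trans (hA s x s01)).
have [hv0 _ _] := hv_bounds s01.
apply: (@le_trans _ _ ((F x * (1 + half_var s * HS fs x))%:E + (F x * (A * s ^+ 3))%:E)%E).
  by rewrite -EFinD lee_fin -mulrDr ler_pM2l// lerD2r lerD2l ler_wpM2l.
apply: (le_trans (leeD (hA' s x s01) (lexx _))).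
rewrite -addeA leeD2l// -EFinD -EFinM lee_fin le_eqVlt; apply/orP; left.
by apply/eqP; ring.
Qed.

Let miter s es k : nonneg_measurable (iter k (gauss_ops s es) FE).
Proof. by elim: k => [//|k]; exact: nonneg_measurable_gauss_ops. Qed.

Lemma iter_gauss_ops_growth es s c k x : 0 <= c ->
  (forall x, gauss_ops s es FE x <= (1 + c)%:E * (F x)%:E)%E ->
  (iter k (gauss_ops s es) FE x <= ((1 + c) ^+ k)%:E * (F x)%:E)%E.
Proof.
move=> c0 h; have c10 : 0 <= 1 + c by rewrite addr_ge0.
elim: k x => [|k IH] x; first by rewrite expr0 mul1e.
have ck0 : 0 <= (1 + c) ^+ k by rewrite exprn_ge0.
have H1 : (gauss_ops s es (iter k (gauss_ops s es) FE) x <=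
    gauss_ops s es (fun x => ((1 + c) ^+ k)%:E * (F x)%:E) x)%E.
  by apply: le_gauss_ops; [exact: miter|exact: nonneg_measurableZ|].
rewrite iterS; apply: (le_trans H1).
rewrite (gauss_opsZ _ _ ck0 mF) exprSr EFinM -muleA.
by apply: lee_wpmul2l => //; rewrite lee_fin.
Qed.

(** Telescoping over the blocks: since the operators commute, a new block [es] passes through the
    [k] blocks [fs] already exchanged and is exchanged next to [F], where the one-step comparison
    holds. Each error is amplified by at most [1 + c] per further block. *)
Lemma iter_gauss_ops_compare es fs s c C k x : 0 <= c -> 0 <= C ->
  (forall x, gauss_ops s es FE x <= (1 + c)%:E * (F x)%:E)%E ->
  (forall x, gauss_ops s fs FE x <= (1 + c)%:E * (F x)%:E)%E ->
  (forall x, gauss_ops s es FE x <=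
     gauss_ops s fs FE x + C%:E * (F x)%:E)%E ->
  (iter k (gauss_ops s es) FE x <=
   iter k (gauss_ops s fs) FE x +
   (k%:R * C * (1 + c) ^+ k)%:E * (F x)%:E)%E.
Proof.
move=> c0 C0 hes hfs hC; have c10 : 0 <= 1 + c by rewrite addr_ge0.
elim: k x => [|k IH] x; first by rewrite !mul0r mul0e adde0.
have d0 : 0 <= k%:R * C * (1 + c) ^+ k by rewrite !mulr_ge0// exprn_ge0.
have mB := miter s fs k.
have H1 : (gauss_ops s es (iter k (gauss_ops s es) FE) x <=
    gauss_ops s es (fun x => iter k (gauss_ops s fs) FE x +
      (k%:R * C * (1 + c) ^+ k)%:E * FE x) x)%E.
  apply: le_gauss_ops; [exact: miter| |exact: IH].
  by apply: nonneg_measurableD => //; exact: nonneg_measurableZ.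
rewrite iterS; apply: (le_trans H1).
rewrite (gauss_opsD _ _ mB (nonneg_measurableZ d0 mF)) (gauss_opsZ _ _ d0 mF).
have comm j Phi : nonneg_measurable Phi ->
    gauss_ops s es (iter j (gauss_ops s fs) Phi) =
    iter j (gauss_ops s fs) (gauss_ops s es Phi).
  move=> mPhi; elim: j => [//|j IHj]; rewrite !iterS -IHj gauss_opsC//.
  by elim: j {IHj} => [//|j]; exact: nonneg_measurable_gauss_ops.
have mono j Phi Psi : nonneg_measurable Phi -> nonneg_measurable Psi ->
    (forall y, Phi y <= Psi y)%E -> forall y,
    (iter j (gauss_ops s fs) Phi y <= iter j (gauss_ops s fs) Psi y)%E.
  move=> mPhi mPsi le; elim: j => [//|j IHj] y; rewrite !iterS.
  apply: le_gauss_ops => //.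
  - by elim: j {IHj} => [//|j]; exact: nonneg_measurable_gauss_ops.
  - by elim: j {IHj} => [//|j]; exact: nonneg_measurable_gauss_ops.
have split j : iter j (gauss_ops s fs) (fun y => gauss_ops s fs FE y + C%:E * FE y)%E =
   (fun y => iter j.+1 (gauss_ops s fs) FE y + C%:E * iter j (gauss_ops s fs) FE y)%E.
  elim: j => [//|j IHj]; rewrite iterS IHj gauss_opsD.
  - by rewrite (gauss_opsZ _ _ C0)//; exact: miter.
  - exact: miter.
  - by apply: nonneg_measurableZ => //; exact: miter.
have G1 : (gauss_ops s es (iter k (gauss_ops s fs) FE) x <=
    iter k.+1 (gauss_ops s fs) FE x + C%:E * (((1 + c) ^+ k)%:E * FE x))%E.
  rewrite comm//.
  have mes : nonneg_measurable (gauss_ops s es FE) by exact: nonneg_measurable_gauss_ops.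
  have mfs : nonneg_measurable (fun y => gauss_ops s fs FE y + C%:E * FE y)%E.
    apply: nonneg_measurableD; first exact: nonneg_measurable_gauss_ops.
    exact: nonneg_measurableZ.
  apply: (le_trans (mono k _ _ mes mfs hC x)); rewrite split.
  apply: leeD2l; apply: lee_wpmul2l; first by rewrite lee_fin.
  exact: iter_gauss_ops_growth.
have d0E : (0%:E <= (k%:R * C * (1 + c) ^+ k)%:E :> \bar R)%E by rewrite lee_fin.
apply: (le_trans (leeD G1 (lee_wpmul2l d0E (hes x)))).
rewrite -addeA; apply: leeD2l; rewrite -!EFinM -EFinD lee_fin.
rewrite !mulrA -mulrDl; apply: ler_wpM2r; first exact: ltW.
rewrite -natr1 exprSr.
have ck : 1 <= 1 + c by rewrite lerDl.
have cc : C * (1 + c) ^+ k <= C * ((1 + c) ^+ k * (1 + c)).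
  apply: ler_wpM2l => //; apply: ler_peMr => //; exact: exprn_ge0.
move: ((1 + c) ^+ k) (k%:R) cc => e kk cc; lra.
Qed.

(* Lindeberg replacement: split every Gaussian into n independent pieces
   and exchange the pieces one after the other; the error of order
   n * n^(-3/2) vanishes. *)
Theorem gauss_ops_comparison es fs s x : 0 < s -> UA es -> UA fs ->
  (forall y, HS es y <= HS fs y) ->
  (gauss_ops s es FE x <= gauss_ops s fs FE x)%E.
Proof.
move=> s0 Ues Ufs HSle.
have [C C0 hC] := gauss_ops_compare Ues Ufs HSle.
have [c1 c10 hc1] := gauss_ops_growth Ues.
have [c2 c20 hc2] := gauss_ops_growth Ufs.
pose c := c1 + c2.
(* With pieces of deviation [t = s / sqrt n], the accumulated error [n C t^3 (1 + c t^2)^n F(x)] is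
   at most [K / sqrt n]. *)
pose K := C * s ^+ 3 * expR (c * s ^+ 2) * F x.
have K0 : 0 <= K.
  by rewrite /K mulr_ge0 ?(ltW (F0 x))// mulr_ge0 ?expR_ge0// mulr_ge0// exprn_ge0// ltW.
apply/lee_addgt0Pr => eps eps0.
have [n n0 [sn Kn]] : exists2 n, (0 < n)%N &
    s <= Num.sqrt n%:R /\ K / Num.sqrt n%:R <= eps.
  (* [sqrt n >= M] gives both [t <= 1], required by the expansions, and an error of at most
     [eps]. *)
  pose M := s + K / eps.
  have M0 : 0 < M by rewrite ltr_pwDl// divr_ge0// ltW.
  exists (Num.truncn (M ^+ 2)).+1 => //.
  have MN : M <= Num.sqrt (Num.truncn (M ^+ 2)).+1%:R.
    have ME : Num.sqrt (M ^+ 2) = M by rewrite sqrtr_sqr gtr0_norm.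
    rewrite -[X in X <= _]ME; apply: ler_wsqrtr; apply: ltW; exact: truncnS_gt.
  split; first by rewrite (le_trans _ MN)// lerDl divr_ge0// ltW.
  rewrite ler_pdivrMr; last exact: lt_le_trans MN.
  rewrite mulrC -ler_pdivrMr// (le_trans _ MN)// lerDr ltW//.
have n0' : 0 < Num.sqrt n%:R :> R by rewrite sqrtr_gt0 ltr0n.
rewrite (gauss_ops_split es s0 n0 mF) (gauss_ops_split fs s0 n0 mF).
have t01 : 0 < s / Num.sqrt n%:R <= 1.
  by rewrite divr_gt0//= ler_pdivrMr// mul1r.
have t2 : (s / Num.sqrt n%:R) ^+ 2 = s ^+ 2 / n%:R.
  by rewrite expr_div_n sqr_sqrtr// ler0n.
move tE : (s / Num.sqrt n%:R) t01 t2 => t t01 t2.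
have t20 := sqr_ge0 t.
have t3 : t ^+ 3 = s ^+ 3 / n%:R / Num.sqrt n%:R.
  by rewrite exprSr t2 -tE exprSr; ring.
have t30 : 0 <= t ^+ 3 by rewrite exprn_ge0//; case/andP: t01 => /ltW.
have grow (gs : seq V) (ci : R) : 0 <= ci -> ci <= c ->
    (forall s x, 0 < s <= 1 -> (gauss_ops s gs FE x <=
      (F x * (1 + ci * s ^+ 2))%:E)%E) ->
    forall y, (gauss_ops t gs FE y <= (1 + c * t ^+ 2)%:E * (F y)%:E)%E.
  move=> ci0 cic h y; apply: (le_trans (h t y t01)).
  by rewrite -EFinM lee_fin mulrC ler_pM2r// lerD2l ler_wpM2r.
have ct0 : 0 <= c * t ^+ 2 by rewrite mulr_ge0// addr_ge0.
have Ct0 : 0 <= C * t ^+ 3 by rewrite mulr_ge0.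
have g1 := grow es c1 c10 (_ : c1 <= c) hc1; rewrite lerDl in g1.
have g2 := grow fs c2 c20 (_ : c2 <= c) hc2; rewrite lerDr in g2.
apply: (le_trans (iter_gauss_ops_compare n x ct0 Ct0 (g1 c20) (g2 c10)
  (fun y => hC t y t01))).
apply: leeD2l; rewrite -EFinM lee_fin; apply: le_trans Kn.
have nN0 : n%:R != 0 :> R by rewrite pnatr_eq0 -lt0n.
have -> : n%:R * (C * t ^+ 3) = C * s ^+ 3 / Num.sqrt n%:R.
  rewrite t3; move: (n%:R) nN0 (Num.sqrt _)^-1 => q q0 r; field.
  by [].
have -> : K / Num.sqrt n%:R = C * s ^+ 3 / Num.sqrt n%:R * expR (c * s ^+ 2) * F x.
  by rewrite /K; ring.
apply: ler_wpM2r; first exact: ltW.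
apply: ler_wpM2l.
  by rewrite mulr_ge0 ?invr_ge0 ?(ltW n0')// mulr_ge0// exprn_ge0// ltW.
have -> : expR (c * s ^+ 2) = expR (c * t ^+ 2) ^+ n.
  rewrite -expRM_natl t2; congr expR.
  by move: (n%:R) nN0 => q q0; field.
by rewrite lerXn2r ?nnegrE ?expR_ge0 ?addr_ge0// expR_ge1Dx.
Qed.

End Lindeberg.

Section SoftMaxComparison.
Context {R : realType} {m : nat}.
Hypothesis m0 : (0 < m)%N.
Variables lam beta : R.
Hypotheses (lam0 : 0 < lam) (lamb : lam <= beta).
Notation V := (m.-tuple R).
Notation FE := (fun x : V => (softmax lam beta x)%:E).

(** The covariance matrix of the Gaussian vector that [es] stands for, up to the factor [s^2]. *)
Definition gram (es : seq V) (j k : 'I_m) : R := \sum_(e <- es) tnth e j * tnth e k.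

Lemma hess_sum_gram es (x : V) : hess_sum lam beta es x =
  lam * (beta * (\sum_k gibbs beta x k * gram es k k) -
    (beta - lam) * \sum_j \sum_k gibbs beta x j * gibbs beta x k * gram es j k).
Proof.
rewrite /hess_sum /softmax_hess -mulr_sumr sumrB -!mulr_sumr; congr (_ * (_ * _ - _ * _)).
  rewrite /gibbs_mean exchange_big/=; apply: eq_bigr => k _.
  by rewrite -mulr_sumr; congr (_ * _); apply: eq_bigr => e _; rewrite expr2.
rewrite /gibbs_mean.
under eq_bigr => e _ do rewrite expr2 mulr_suml.
rewrite exchange_big/=; apply: eq_bigr => j _.
under eq_bigr => e _ do rewrite mulr_sumr.
rewrite exchange_big/=; apply: eq_bigr => k _.
by rewrite /gram mulr_sumr; apply: eq_bigr => e _; ring.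
Qed.

(** Slepian's condition: equal variances, and smaller covariances for the vector with the larger
    mean. It works since covariances enter with the coefficient [-(beta - lam) <= 0] times products
    of Gibbs weights. *)
Lemma le_hess_sum_gram es fs (x : V) : (forall k, gram es k k = gram fs k k) ->
  (forall j k, gram fs j k <= gram es j k) ->
  hess_sum lam beta es x <= hess_sum lam beta fs x.
Proof.
move=> diag off; rewrite !hess_sum_gram; apply: ler_wpM2l; first exact: ltW.
under eq_bigr => k _ do rewrite diag.
rewrite lerD2l lerN2; apply: ler_wpM2l; first by rewrite subr_ge0.
apply: ler_sum => j _; apply: ler_sum => k _; apply: ler_wpM2l => //.
by apply: mulr_ge0; exact: gibbs_ge0.
Qed.

Theorem softmax_gaussian_comparison es fs (s : R) x : 0 < s ->
  (forall e, e \in es -> unit_box e) -> (forall e, e \in fs -> unit_box e) ->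
  (forall k, gram es k k = gram fs k k) ->
  (forall j k, gram fs j k <= gram es j k) ->
  (gauss_ops s es FE x <= gauss_ops s fs FE x)%E.
Proof.
move=> s0 Ues Ufs diag off.
have b0 : 0 < beta by exact: lt_le_trans lamb.
have D0 : 0 <= moment_cst (1 + 4 * beta).
  rewrite /moment_cst; apply: mulr_ge0; last exact: expR_ge0.
  by apply: mulr_ge0 => //; exact: sqrtr_ge0.
apply: (@gauss_ops_comparison R m (softmax lam beta) (softmax_hess lam beta) unit_box
  (lam * beta) ((40 * beta ^+ 3 + lam + lam * beta) * moment_cst (1 + 4 * beta))
  (8 * lam * beta ^+ 2 * moment_cst (1 + 4 * beta))) => //.
- by apply: mulr_ge0; exact: ltW.
- apply: mulr_ge0 => //; apply: addr_ge0; last by apply: mulr_ge0; exact: ltW.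
  apply: addr_ge0; last exact: ltW.
  by apply: mulr_ge0 => //; apply: exprn_ge0; exact: ltW.
- apply: mulr_ge0 => //; apply: mulr_ge0; last exact: sqr_ge0.
  by apply: mulr_ge0 => //; exact: ltW.
- by move=> y; exact: softmax_gt0.
- exact: nonneg_measurable_softmax.
- by move=> e y Ue; exact: (softmax_hess_bounds m0 lam0 lamb Ue y).
- by move=> gs Ugs; exact: (nonneg_measurable_hess_sum m0 lam0 lamb Ugs).
- by move=> e t y Ue; exact: (gauss_op_softmax_le m0 lam0 lamb Ue y).
- by move=> e t y Ue; exact: (gauss_op_softmax_ge m0 lam0 lamb Ue y).
- by move=> e gs t y Ue Ugs; exact: (gauss_op_hess_sum_le m0 lam0 lamb Ue Ugs y).
- by move=> e gs t y Ue Ugs; exact: (gauss_op_hess_sum_ge m0 lam0 lamb Ue Ugs y).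
- by move=> y; exact: le_hess_sum_gram.
Qed.

Definition ones : V := [tuple 1 | k < m].

(** Adding [z] to all coordinates multiplies softmax by [exp(lam z)], so a variable common to all
    coordinates splits off as its moment generating function. *)
Lemma gauss_op_ones (s : R) x : 0 < s ->
  (gauss_op s ones FE x = (expR (s ^+ 2 * lam ^+ 2 / 2))%:E * FE x)%E.
Proof.
move=> s0; rewrite -integral_normal_expR// muleC /gauss_op.
have b0 : beta != 0 by rewrite gt_eqF//; exact: lt_le_trans lamb.
rewrite -ge0_integralZl//=; last 2 first.
- by apply/measurable_EFinP; apply: measurableT_comp => //; exact: mulrl_measurable.
- by rewrite lee_fin ltW// softmax_gt0.
apply: eq_integral => z _; rewrite -EFinM /softmax; congr EFin.
have -> : sumexp beta (tshift x ones z) = sumexp beta x * expR (beta * z).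
  rewrite /sumexp mulr_suml; apply: eq_bigr => k _.
  by rewrite !tnth_mktuple mulr1 mulrDr expRD.
rewrite powRM ?expR_ge0 ?(ltW (sumexp_gt0 m0 _ _))//; congr (_ * _).
by rewrite -expRM; congr expR; field.
Qed.

Lemma le_softmax (x : V) M : (forall k, tnth x k <= M) ->
  softmax lam beta x <= m%:R `^ (lam / beta) * expR (lam * M).
Proof.
move=> xM; have b0 : 0 < beta by exact: lt_le_trans lamb.
apply: (@le_trans _ _ ((m%:R * expR (beta * M)) `^ (lam / beta))).
  apply: ge0_ler_powR.
  - by rewrite divr_ge0 ?(ltW lam0) ?(ltW b0).
  - by rewrite nnegrE; exact: ltW (sumexp_gt0 m0 _ _).
  - by rewrite nnegrE mulr_ge0 ?expR_ge0.
  rewrite /sumexp mulr_natl -[X in _ *+ X]card_ord -sumr_const; apply: ler_sum => k _.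
  by rewrite ler_expR ler_pM2l.
rewrite powRM ?expR_ge0 ?ler0n// -expRM.
by rewrite (_ : beta * M * (lam / beta) = lam * M)//; field; rewrite gt_eqF.
Qed.

Lemma ge_softmax (x : V) k : expR (lam * tnth x k) <= softmax lam beta x.
Proof.
have b0 : 0 < beta by exact: lt_le_trans lamb.
apply: (@le_trans _ _ (expR (beta * tnth x k) `^ (lam / beta))).
  by rewrite -expRM (_ : beta * _ * (lam / beta) = lam * tnth x k)//; field; rewrite gt_eqF.
apply: ge0_ler_powR.
- by rewrite divr_ge0 ?(ltW lam0) ?(ltW b0).
- by rewrite nnegrE expR_ge0.
- by rewrite nnegrE; exact: ltW (sumexp_gt0 m0 _ _).
rewrite /sumexp (bigD1 k)//= lerDl; apply: sumr_ge0 => j _; exact: expR_ge0.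
Qed.

End SoftMaxComparison.

Section QuadraticBound.
Context {R : realType} {m : nat}.
Notation V := (m.-tuple R).

Fixpoint shifts (x : V) (es : seq V) (zs : seq R) : V :=
  match es, zs with
  | e :: es', z :: zs' => shifts (tshift x e z) es' zs'
  | _, _ => x
  end.

Lemma tnth_shifts x es zs k : size zs = size es ->
  tnth (shifts x es zs) k = tnth x k + \sum_(ez <- zip es zs) ez.2 * tnth ez.1 k.
Proof.
elim: es zs x => [|e es IH] [|z zs] x //=; first by rewrite big_nil addr0.
by move=> [szs]; rewrite IH// tnth_mktuple big_cons/= addrA.
Qed.

(** The variables are integrated out one at a time, the outer ones being absorbed in [C]; each turns
    its factor [exp(theta z^2)] into one inverse square root. *)
Lemma gauss_ops_quadratic_bound (s theta C : R) es Phi x :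
  0 < s -> 2 * theta * s ^+ 2 < 1 -> 0 <= C -> nonneg_measurable Phi ->
  (forall zs, size zs = size es ->
    (Phi (shifts x es zs) <= (C * expR (theta * \sum_(z <- zs) z ^+ 2))%:E)%E) ->
  (gauss_ops s es Phi x <=
   (C * (Num.sqrt (1 - 2 * theta * s ^+ 2))^-1 ^+ size es)%:E)%E.
Proof.
move=> s0 ts C0 mPhi; elim: es x C C0 => [|e es IH] x C C0 h.
  have := h [::] erefl; rewrite big_nil mulr0 expR0 => /le_trans; apply.
  by rewrite expr0.
set c := (Num.sqrt _)^-1.
have c0 : 0 <= c by rewrite invr_ge0 sqrtr_ge0.
have H z : (gauss_ops s es Phi (tshift x e z) <=
    (C * c ^+ size es * expR (theta * z ^+ 2))%:E)%E.
  rewrite mulrAC; apply: IH; first by rewrite mulr_ge0 ?expR_ge0.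
  move=> zs szs; have := h (z :: zs); rewrite /= szs => /(_ erefl).
  by rewrite big_cons mulrDr expRD mulrA.
apply: (@le_trans _ _ (\int[normal_prob 0 s]_z
    ((C * c ^+ size es)%:E * (expR (theta * z ^+ 2))%:E))%E).
  apply: ge0_le_integral => //.
  - by move=> z _; exact: (nonneg_measurable_gauss_ops s es mPhi).2.
  - exact: (nonneg_measurable_shift x e (nonneg_measurable_gauss_ops s es mPhi)).
  - apply: emeasurable_funM => //; apply/measurable_EFinP.
    apply: measurableT_comp => //; apply: measurable_funM => //.
  - by move=> z _; rewrite -EFinM; exact: H.
rewrite ge0_integralZl//=; last 2 first.
- apply/measurable_EFinP.
  by apply: measurableT_comp => //; apply: measurable_funM.
- by rewrite lee_fin mulr_ge0// exprn_ge0.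
by rewrite integral_normal_expR_sqr// -EFinM -/c exprSr mulrA.
Qed.

End QuadraticBound.

(** * The bilinear process of a Gaussian matrix *)

Section EuclideanFacts.
Context {R : realType} {n : nat}.
Implicit Types (u v : 'cV[R]_n).

Lemma dotC u v : dot u v = dot v u.
Proof. by apply: eq_bigr => i _; rewrite mulrC. Qed.

Lemma dot_ge0 u : 0 <= dot u u.
Proof. by apply: sumr_ge0 => i _; rewrite -expr2 sqr_ge0. Qed.

Lemma dotDr u v w : dot u (v + w) = dot u v + dot u w.
Proof. by rewrite -big_split; apply: eq_bigr => i _; rewrite mxE mulrDr. Qed.

Lemma dotZr (a : R) u v : dot u (a *: v) = a * dot u v.
Proof. by rewrite mulr_sumr; apply: eq_bigr => i _; rewrite mxE mulrCA. Qed.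

Lemma dotDl u v w : dot (v + w) u = dot v u + dot w u.
Proof. by rewrite !(dotC _ u) dotDr. Qed.

Lemma dotZl (a : R) u v : dot (a *: v) u = a * dot v u.
Proof. by rewrite !(dotC _ u) dotZr. Qed.

Lemma dotNr u v : dot u (- v) = - dot u v.
Proof. by rewrite -scaleN1r dotZr mulN1r. Qed.

Lemma dotNl u v : dot (- v) u = - dot v u.
Proof. by rewrite !(dotC _ u) dotNr. Qed.

Lemma le_dot_half u v : dot u v <= (dot u u + dot v v) / 2.
Proof.
rewrite -subr_ge0 (_ : _ - _ = dot (u - v) (u - v) / 2); last first.
  by rewrite dotDr dotNr !dotDl !dotNl (dotC v u); field.
by rewrite divr_ge0// dot_ge0.
Qed.

Lemma sqr_entry_le u i : u i 0 ^+ 2 <= dot u u.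
Proof.
rewrite /dot (bigD1 i)//= -expr2 lerDl.
by apply: sumr_ge0 => j _; rewrite -expr2 sqr_ge0.
Qed.

Lemma dot_eq0 u : dot u u = 0 -> u = 0.
Proof.
move=> u0; apply/matrixP => i j; rewrite ord1 mxE.
have := sqr_entry_le u i; rewrite u0 => h.
by apply/eqP; rewrite -sqrf_eq0 eq_le h sqr_ge0.
Qed.

Lemma enorm_ge0 u : 0 <= enorm u.
Proof. exact: sqrtr_ge0. Qed.

Lemma sqr_enorm u : enorm u ^+ 2 = dot u u.
Proof. by rewrite sqr_sqrtr ?dot_ge0. Qed.

Lemma enormZ (a : R) u : enorm (a *: u) = `|a| * enorm u.
Proof. by rewrite /enorm dotZl dotZr mulrA -expr2 sqrtrM ?sqr_ge0// sqrtr_sqr. Qed.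

Lemma enorm0 : enorm (0 : 'cV[R]_n) = 0.
Proof. by rewrite -(scale0r 0) enormZ normr0 mul0r. Qed.

Lemma enorm0_eq0 u : enorm u = 0 -> u = 0.
Proof. by move=> u0; apply: dot_eq0; rewrite -sqr_enorm u0 expr0n. Qed.

Lemma enorm_gt0 u : u != 0 -> 0 < enorm u.
Proof.
move=> u0; rewrite lt_neqAle enorm_ge0 andbT eq_sym.
by apply: contra u0 => /eqP/enorm0_eq0 ->.
Qed.

End EuclideanFacts.

Lemma exists_golden (R : realType) (mu : R) : 0 < mu ->
  exists2 al, 0 < al & mu = al - al^-1.
Proof.
move=> mu0; pose r := Num.sqrt (mu ^+ 2 + 4).
have rr : r ^+ 2 = mu ^+ 2 + 4 by rewrite sqr_sqrtr// addr_ge0// sqr_ge0.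
have al0 : 0 < (mu + r) / 2 by rewrite divr_gt0// ltr_pwDl// sqrtr_ge0.
exists ((mu + r) / 2) => //.
have alE : (mu + r) / 2 * ((mu + r) / 2 - mu) = 1.
  by rewrite (_ : _ * _ = (r ^+ 2 - mu ^+ 2) / 4); [rewrite rr|]; field.
have E : ((mu + r) / 2)^-1 = (mu + r) / 2 - mu.
  by apply: (mulfI (lt0r_neq0 al0)); rewrite alE divff// gt_eqF.
by rewrite E; ring.
Qed.

(* The choice of a solves lam * s / sqrt n = al - al^-1 with a = al * s * sqrt n;
   it minimizes the left-hand side, a bound for the moment generating function at lam
   of s times a chi variable with n degrees of freedom. *)
Lemma chi_mgf_optimum (R : realType) (n : nat) (lam s : R) :
  (0 < n)%N -> 0 < lam -> 0 < s ->
  exists a, [/\ 0 < a, 2 * (lam / (2 * a)) * s ^+ 2 < 1 &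
    expR (lam * a / 2) * (Num.sqrt (1 - 2 * (lam / (2 * a)) * s ^+ 2))^-1 ^+ n <=
    expR (lam * s * Num.sqrt n%:R + lam ^+ 2 * s ^+ 2 / 2)].
Proof.
move=> n0 lam0 s0.
have : 0 < Num.sqrt n%:R :> R by rewrite sqrtr_gt0 ltr0n.
have : n%:R = Num.sqrt n%:R ^+ 2 :> R by rewrite sqr_sqrtr// ler0n.
move: (Num.sqrt n%:R) => q nq q0.
have [al al0 muE] := exists_golden (divr_gt0 (mulr_gt0 lam0 s0) q0).
have sN0 : s != 0 by rewrite gt_eqF.
have qN0 : q != 0 by rewrite gt_eqF.
have alN0 : al != 0 by rewrite gt_eqF.
have lamE : lam = (al - al^-1) * q / s.
  by rewrite -muE; field; rewrite sN0 qN0.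
have E1 : 1 - 2 * (lam / (2 * (al * s * q))) * s ^+ 2 = al^-1 ^+ 2.
  by rewrite lamE; field; rewrite alN0 sN0 qN0.
exists (al * s * q); split.
- by rewrite !mulr_gt0.
- by rewrite -subr_gt0 E1 exprn_gt0// invr_gt0.
rewrite E1 sqrtr_sqr gtr0_norm ?invr_gt0// invrK.
have -> : al ^+ n = expR (q ^+ 2 * ln al) by rewrite -nq expRM_natl lnK ?posrE.
rewrite -expRD ler_expR.
have lnal : ln al <= al - 1.
  by have := @le_ln1Dx R (al - 1); rewrite (addrC 1 (al - 1)) subrK; apply; lra.
have -> : lam * (al * s * q) / 2 = q ^+ 2 * ((al ^+ 2 - 1) / 2).
  by rewrite lamE; field; rewrite alN0 sN0.
have -> : lam * s * q + lam ^+ 2 * s ^+ 2 / 2 =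
    q ^+ 2 * (al - al^-1 + (al - al^-1) ^+ 2 / 2).
  by rewrite lamE; field; rewrite alN0 sN0.
rewrite -mulrDr; apply: ler_wpM2l; first exact: sqr_ge0.
(* By [ln al <= al - 1], the two sides differ by at least [(1 - 1 / al)^2 / 2]. *)
have -> : (al - al^-1) ^+ 2 = al ^+ 2 - 2 + al^-1 ^+ 2 by field.
have := sqr_ge0 (1 - al^-1); move: (al^-1) => b; lra.
Qed.

Section BilinearNet.
Context {R : realType} {m l d : nat}.
Hypotheses (m0 : (0 < m)%N) (l0 : (0 < l)%N) (d0 : (0 < d)%N).
Variables (cu : 'I_m -> 'cV[R]_d) (cv : 'I_m -> 'cV[R]_l).
Hypotheses (cu1 : forall k, dot (cu k) (cu k) = 1) (cv1 : forall k, dot (cv k) (cv k) = 1).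
Notation V := (m.-tuple R).

(** The direction that the matrix entry [S i j] moves: combined with the coefficients [S i j], these
    give the vector of the values [v_k^T S u_k]. Likewise [linear_dirs c] gives the vector of the
    [<h, c_k>]. *)
Definition bilinear_dir (ij : 'I_l * 'I_d) : V :=
  [tuple cv k ij.1 0 * cu k ij.2 0 | k < m].
Definition bilinear_dirs : seq V := [seq bilinear_dir ij | ij <- enum {: 'I_l * 'I_d}].
Definition linear_dirs (n : nat) (c : 'I_m -> 'cV[R]_n) : seq V :=
  [seq [tuple c k j 0 | k < m] | j <- enum 'I_n].
Definition zero_tuple : V := [tuple 0 | k < m].

Let entry_le1 n (c : 'cV[R]_n) i : dot c c = 1 -> `|c i 0| <= 1.
Proof.
move=> c1; rewrite -(@expr_le1 _ 2)// real_normK ?num_real// -c1.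
exact: sqr_entry_le.
Qed.
Lemma unit_box_bilinear e : e \in bilinear_dirs -> unit_box e.
Proof.
move=> /mapP[ij _ ->] k; rewrite tnth_mktuple normrM.
by rewrite -[X in _ <= X]mulr1; apply: ler_pM; rewrite ?normr_ge0// entry_le1.
Qed.

Lemma unit_box_linear n (c : 'I_m -> 'cV[R]_n) e : (forall k, dot (c k) (c k) = 1) ->
  e \in linear_dirs c -> unit_box e.
Proof. by move=> c1 /mapP[j _ ->] k; rewrite tnth_mktuple entry_le1. Qed.

Lemma gram_linear n (c : 'I_m -> 'cV[R]_n) j k :
  gram (linear_dirs c) j k = dot (c j) (c k).
Proof.
rewrite /gram big_map big_enum/=; apply: eq_bigr => i _.
by rewrite !tnth_mktuple.
Qed.

Lemma gram_bilinear j k :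
  gram bilinear_dirs j k = dot (cv j) (cv k) * dot (cu j) (cu k).
Proof.
rewrite /gram big_map big_enum/= /dot mulr_suml.
under [RHS]eq_bigr => i _ do rewrite mulr_sumr.
rewrite pair_bigA/=; apply: eq_bigr => -[i i'] _ /=.
by rewrite !tnth_mktuple/=; ring.
Qed.

Lemma sum_zip1 (S T : Type) (s : seq S) (t : seq T) (f : S -> R) :
  size s = size t -> \sum_(st <- zip s t) f st.1 = \sum_(x <- s) f x.
Proof.
by move=> st; rewrite -(big_map fst xpredT f) -/(unzip1 _) unzip1_zip// st.
Qed.

Lemma sum_zip2 (S T : Type) (s : seq S) (t : seq T) (f : T -> R) :
  size s = size t -> \sum_(st <- zip s t) f st.2 = \sum_(x <- t) f x.
Proof.
by move=> st; rewrite -(big_map snd xpredT f) -/(unzip2 _) unzip2_zip// st.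
Qed.

(** Young's inequality [<z, c> <= a |c|^2 / 2 + |z|^2 / (2 a)] with [|c| = 1], a bound uniform in
    [k]. It trades the norm [|z|] for a quadratic, whose exponential has an explicit integral; the
    good [a] comes from [chi_mgf_optimum]. *)
Lemma tnth_shifts_linear n (c : 'I_m -> 'cV[R]_n) (a : R) x zs k :
  dot (c k) (c k) = 1 -> 0 < a -> size zs = size (linear_dirs c) ->
  tnth (shifts x (linear_dirs c) zs) k <=
  tnth x k + (a / 2 + (\sum_(z <- zs) z ^+ 2) / (2 * a)).
Proof.
move=> c1 a0 szs; rewrite tnth_shifts// lerD2l.
have aN0 : a != 0 by rewrite gt_eqF.
apply: (@le_trans _ _ (\sum_(ez <- zip (linear_dirs c) zs)
    (a / 2 * (tnth ez.1 k * tnth ez.1 k) + ez.2 ^+ 2 / (2 * a)))).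
  apply: ler_sum => -[e z] _ /=; rewrite -subr_ge0.
  have -> : a / 2 * (tnth e k * tnth e k) + z ^+ 2 / (2 * a) - z * tnth e k =
     (a * tnth e k - z) ^+ 2 / (2 * a) by field.
  by rewrite divr_ge0 ?sqr_ge0// mulr_ge0// ltW.
rewrite big_split/= -mulr_sumr -mulr_suml.
rewrite (sum_zip1 (fun e => tnth e k * tnth e k)) ?szs//.
rewrite (sum_zip2 (fun z => z ^+ 2)) ?szs//.
by rewrite -/(gram (linear_dirs c) k k) gram_linear c1 mulr1.
Qed.

(** The covariances of the two vectors differ by [1 + (v.v')(u.u') - u.u' - v.v' = (1 - v.v')(1 -
    u.u') >= 0], which vanishes on the diagonal. The summand 1 is the independent Gaussian, that is
    the direction [ones]; without it the variances would not agree. *)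
Theorem softmax_bilinear_bound (lam beta s : R) : 0 < lam -> lam <= beta -> 0 < s ->
  (gauss_ops s bilinear_dirs (fun x : V => (softmax lam beta x)%:E) zero_tuple <=
   (m%:R `^ (lam / beta) * expR (lam * (s * (Num.sqrt d%:R + Num.sqrt l%:R))
      + lam ^+ 2 * s ^+ 2 / 2))%:E)%E.
Proof.
move=> lam0 lamb s0.
set FE := (fun x : V => (softmax lam beta x)%:E).
have mF : nonneg_measurable FE by exact: nonneg_measurable_softmax.
have [a [a0 as1 ha]] := chi_mgf_optimum d0 lam0 s0.
have [b [b0 bs1 hb]] := chi_mgf_optimum l0 lam0 s0.
set ca := (Num.sqrt _)^-1 in ha; set cb := (Num.sqrt _)^-1 in hb.
pose K := m%:R `^ (lam / beta).
have K0 : 0 <= K by exact: powR_ge0.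
have cb0 : 0 <= cb by rewrite invr_ge0 sqrtr_ge0.
have sU : size (linear_dirs cu) = d by rewrite size_map -cardE card_ord.
have sV : size (linear_dirs cv) = l by rewrite size_map -cardE card_ord.
have bound : (gauss_ops s (linear_dirs cu ++ linear_dirs cv) FE zero_tuple <=
    (K * expR (lam * a / 2 + lam * b / 2) * cb ^+ l * ca ^+ d)%:E)%E.
  rewrite gauss_ops_cat -[X in ca ^+ X]sU.
  apply: gauss_ops_quadratic_bound => //.
  - by rewrite mulr_ge0 ?exprn_ge0// mulr_ge0 ?expR_ge0.
  - exact: nonneg_measurable_gauss_ops.
  move=> zs szs; set Z := \sum_(z <- zs) _.
  rewrite mulrAC -[X in cb ^+ X]sV.
  apply: gauss_ops_quadratic_bound => //.
    by rewrite !mulr_ge0 ?expR_ge0.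
  move=> ws sws; set W := \sum_(z <- ws) _.
  rewrite lee_fin -(mulrA K) -expRD -(mulrA K) -expRD.
  have -> : lam * a / 2 + lam * b / 2 + lam / (2 * a) * Z + lam / (2 * b) * W =
      lam * (a / 2 + Z / (2 * a) + (b / 2 + W / (2 * b))).
    by field; rewrite !gt_eqF.
  apply: le_softmax => // k.
  apply: (le_trans (tnth_shifts_linear _ (cv1 k) b0 sws)); rewrite lerD2r.
  apply: (le_trans (tnth_shifts_linear _ (cu1 k) a0 szs)).
  by rewrite tnth_mktuple add0r.
have comp := @softmax_gaussian_comparison R m m0 lam beta lam0 lamb
  (ones :: bilinear_dirs) (linear_dirs cu ++ linear_dirs cv) s zero_tuple s0.
have gones j k es : @gram R m (ones :: es) j k = 1 + gram es j k.
  by rewrite /gram big_cons !tnth_mktuple mulr1.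
have gcat j k : gram (linear_dirs cu ++ linear_dirs cv) j k =
    dot (cu j) (cu k) + dot (cv j) (cv k).
  by rewrite /gram big_cat/= -/(gram (linear_dirs cu) j k)
    -/(gram (linear_dirs cv) j k) !gram_linear.
have {}comp := le_trans (comp _ _ _ _) bound.
have E : gauss_ops s (ones :: bilinear_dirs) FE zero_tuple =
    ((expR (s ^+ 2 * lam ^+ 2 / 2))%:E * gauss_ops s bilinear_dirs FE zero_tuple)%E.
  rewrite [LHS]/= gauss_op_opsC// -/gauss_ops.
  have -> : gauss_op s ones FE = (fun x => (expR (s ^+ 2 * lam ^+ 2 / 2))%:E * FE x)%E.
    by apply/funext => x; exact: gauss_op_ones.
  by rewrite gauss_opsZ// expR_ge0.
rewrite E in comp.
have e0 := expR_gt0 (s ^+ 2 * lam ^+ 2 / 2).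
have eF : (expR (s ^+ 2 * lam ^+ 2 / 2))%:E \is a fin_num by [].
(* The bounds for the two chi variables contribute [lam^2 s^2 / 2] each to the exponent; cancelling
   the factor from [ones] removes one of the two. *)
rewrite -(lee_pmul2l eF); last by rewrite lte_fin.
apply: (le_trans (comp _ _ _ _)).
- move=> e; rewrite inE => /predU1P[->|]; last exact: unit_box_bilinear.
  by move=> k; rewrite tnth_mktuple normr1.
- move=> e; rewrite mem_cat => /orP[]; exact: unit_box_linear.
- by move=> k; rewrite gones gcat gram_bilinear cu1 cv1 mulr1.
- move=> j k; rewrite gones gcat gram_bilinear -subr_ge0.
  have -> : 1 + dot (cv j) (cv k) * dot (cu j) (cu k) -
     (dot (cu j) (cu k) + dot (cv j) (cv k)) =
     (1 - dot (cv j) (cv k)) * (1 - dot (cu j) (cu k)) by ring.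
  have h1 := le_dot_half (cu j) (cu k); have h2 := le_dot_half (cv j) (cv k).
  rewrite !cu1 in h1; rewrite !cv1 in h2.
  by apply: mulr_ge0; rewrite subr_ge0; lra.
rewrite -EFinM lee_fin -/K.
have -> : K * expR (lam * a / 2 + lam * b / 2) * cb ^+ l * ca ^+ d =
    K * ((expR (lam * a / 2) * ca ^+ d) * (expR (lam * b / 2) * cb ^+ l)).
  by rewrite expRD; ring.
rewrite [X in _ <= X]mulrCA; apply: ler_wpM2l => //.
apply: (le_trans (ler_pM _ _ ha hb)).
- by rewrite mulr_ge0 ?expR_ge0// exprn_ge0// invr_ge0 sqrtr_ge0.
- by rewrite mulr_ge0 ?expR_ge0// exprn_ge0.
by rewrite -!expRD ler_expR le_eqVlt; apply/orP; left; apply/eqP; field.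
Qed.

End BilinearNet.

(** * Gaussian families, and the lower tail of a sketched norm *)

Section Independence.
Context {disp : measure_display} {T : measurableType disp} {R : realType}.
Variable P : probability T R.
Local Open Scope ereal_scope.

(** The events independent of [E] form a Dynkin system, and [G] is stable under intersection. *)
Lemma indep_generated (G : set (set T)) (E : set T) :
  setI_closed G -> G setT -> (forall A, G A -> measurable A) -> measurable E ->
  (forall A, G A -> P (A `&` E) = P A * P E) ->
  forall A, <<s G >> A -> P (A `&` E) = P A * P E.
Proof.
move=> GI GT Gm mE GE A sGA.
have sGm B : <<s G >> B -> measurable B.
  by apply: smallest_sub => //; exact: sigma_algebra_measurable.
pose H : set (set T) := [set B | measurable B /\ P (B `&` E) = P B * P E].
have fE : P E \is a fin_num by exact: fin_num_measure.
suff : <<s G >> `<=` H by move=> /(_ _ sGA)[].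
rewrite -(setI_closed_g_dynkin_g_sigma_algebra GI).
apply: smallest_sub; last by move=> B GB; split; [exact: Gm|exact: GE].
split.
- by split=> //; rewrite setTI probability_setT mul1e.
- move=> B [mB BE]; split; first exact: measurableC.
  have -> : P (~` B `&` E) = P E - P (B `&` E).
    rewrite setIC -setDE measureD//; last by rewrite -ge0_fin_numE// fin_num_measure.
    by rewrite (setIC E).
  rewrite BE probability_setC// muleBl ?mul1e//.
- move=> F tF HF; have mF i : measurable (F i) by case: (HF i).
  split; first exact: bigcupT_measurable.
  rewrite setI_bigcupl !measure_semi_bigcup//; last 4 first.
  + exact: bigcupT_measurable.
  + by move=> i; exact: measurableI.
  + exact: trivIset_setIr.
  + by apply: bigcupT_measurable => i; exact: measurableI.
  rewrite muleC -(fineK fE) -nneseriesZl//.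
  by apply: eq_eseriesr => i _; rewrite fineK// muleC; exact: (HF i).2.
Qed.

(** By uniqueness of product measures the joint law is the product of the law of [W] with [Q];
    Tonelli then integrates [Y] out. *)
Lemma integral_indep_pair d1 d2 (U : measurableType d1) (V : measurableType d2)
    (W : T -> U) (Y : T -> V) (Q : probability V R) (f : U * V -> \bar R) :
  measurable_fun setT W -> measurable_fun setT Y ->
  (forall B, measurable B -> P (Y @^-1` B) = Q B) ->
  (forall A B, measurable A -> measurable B ->
     P (W @^-1` A `&` Y @^-1` B) = P (W @^-1` A) * P (Y @^-1` B)) ->
  measurable_fun setT f -> (forall x, 0 <= f x) ->
  \int[P]_w f (W w, Y w) = \int[P]_w \int[Q]_z f (W w, z).
Proof.
move=> mW mY YQ WY mf f0.
have mWY : measurable_fun setT (fun w => (W w, Y w)) by exact: measurable_fun_pair.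
pose X : {mfun T >-> U} := HB.pack W (isMeasurableFun.Build _ _ _ _ W mW).
transitivity (\int[pushforward P (fun w => (W w, Y w))]_x f x).
  by rewrite ge0_integral_pushforward//= preimage_setT.
transitivity (\int[(distribution P X) \x Q]_x f x).
  apply: eq_measure_integral => A mA _; apply/esym.
  apply: (@product_measure_unique _ _ _ _ _ (distribution P X) Q
    (pushforward P (fun w => (W w, Y w)))) => // B C mB mC.
  by rewrite /pushforward/= -YQ//; exact: WY.
rewrite fubini_tonelli1//.
rewrite ge0_integral_distribution//.
  exact: (@measurable_fun_fubini_tonelli_F _ _ _ _ _ Q _ mf f0).
by move=> x; exact: integral_ge0.
Qed.

End Independence.

Section GaussianFamily.
Context {disp : measure_display} {T : measurableType disp} {R : realType}.
Variable P : probability T R.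
Variables (I : finType) (m : nat) (X : I -> T -> R) (s : R).
Variable a : I -> m.-tuple R.
Hypothesis mX : forall i, measurable_fun setT (X i).
Hypothesis XN : forall i (U : set R), measurable U ->
  P (X i @^-1` U) = normal_prob 0 s U.
Hypothesis XI : mutually_independent P X.
Notation V := (m.-tuple R).

Definition gauss_comb (x0 : V) (js : seq I) (w : T) : V :=
  foldr (fun j x => tshift x (a j) (X j w)) x0 js.

Lemma tnth_gauss_comb x0 js w k : tnth (gauss_comb x0 js w) k =
  tnth x0 k + \sum_(j <- js) X j w * tnth (a j) k.
Proof.
elim: js => [|j js IH] /=; first by rewrite big_nil addr0.
by rewrite tnth_mktuple IH big_cons addrAC -addrA.
Qed.

(** A system stable under intersection that generates the sigma-algebra of the [X i] with [i] in
    [J]; mutual independence speaks of exactly these sets. *)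
Let cylinders (J : {set I}) : set (set T) := [set A | exists2 U : I -> set R,
  (forall i, measurable (U i)) & A = \bigcap_(i in [set` J]) (X i @^-1` U i)].

Let cylindersI J : setI_closed (cylinders J).
Proof.
move=> _ _ [U mU ->] [U' mU' ->]; exists (fun i => U i `&` U' i).
  by move=> i; exact: measurableI.
by rewrite -bigcapI; apply: eq_bigcapr => i _; rewrite preimage_setI.
Qed.

Let cylindersT J : cylinders J setT.
Proof.
exists (fun=> setT) => //; apply/esym; rewrite -subTset => w _ i _ //.
Qed.

Let cylinders_measurable J A : cylinders J A -> measurable A.
Proof.
move=> [U mU ->]; apply: fin_bigcap_measurable; first exact: finite_finset.
by move=> i _; rewrite -[X in measurable X]setTI; exact: mX.
Qed.

Let cylinder_preimage (J : {set I}) i B : i \in J -> measurable B ->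
  cylinders J (X i @^-1` B).
Proof.
move=> iJ mB; exists (fun j => if j == i then B else setT).
  by move=> j; case: ifP.
apply/seteqP; split => w /=.
  by move=> wB j _ /=; case: ifPn => [/eqP ->|].
by move=> /(_ i iJ) /=; rewrite eqxx.
Qed.

Let measurable_gauss_comb_cyl x0 js (J : {set I}) : (forall j, j \in js -> j \in J) ->
  measurable_fun [set: g_sigma_algebraType (cylinders J)] (gauss_comb x0 js).
Proof.
move=> jsJ; apply/measurable_fun_tnthP => k.
rewrite (_ : _ \o _ = fun w => tnth x0 k + \sum_(j <- js) X j w * tnth (a j) k); last first.
  by apply/funext => w /=; rewrite tnth_gauss_comb.
apply: measurable_funD => //.
have mXJ j : j \in J -> measurable_fun [set: g_sigma_algebraType (cylinders J)] (X j).
  move=> jJ _ B mB; rewrite setTI; apply: sub_sigma_algebra.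
  exact: cylinder_preimage.
elim: js jsJ => [|j js IH] jsJ.
  under eq_fun do rewrite big_nil.
  exact: measurable_cst.
under eq_fun do rewrite big_cons.
apply: measurable_funD.
  by apply: measurable_funM => //; apply: mXJ; apply: jsJ; exact: mem_head.
by apply: IH => i ijs; apply: jsJ; rewrite inE ijs orbT.
Qed.

Lemma measurable_gauss_comb x0 js : measurable_fun setT (gauss_comb x0 js).
Proof.
apply/measurable_fun_tnthP => k.
rewrite (_ : _ \o _ = fun w => tnth x0 k + \sum_(j <- js) X j w * tnth (a j) k); last first.
  by apply/funext => w /=; rewrite tnth_gauss_comb.
by apply: measurable_funD => //; apply: measurable_sum => j; exact: measurable_funM.
Qed.

Let gauss_comb_indep x0 js j A B : j \notin js -> measurable A -> measurable B ->
  (P (gauss_comb x0 js @^-1` A `&` X j @^-1` B) =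
   P (gauss_comb x0 js @^-1` A) * P (X j @^-1` B))%E.
Proof.
move=> jjs mA mB; pose J : {set I} := [set i in js].
have mXB : measurable (X j @^-1` B).
  by rewrite -[X in measurable X]setTI; exact: mX.
apply: (indep_generated (cylindersI (J := J)) (cylindersT J)
  (@cylinders_measurable J) mXB).
  move=> _ [U mU ->].
  pose U' i := if i == j then B else U i.
  have mU' i : measurable (U' i) by rewrite /U'; case: ifP.
  have jJ : j \notin J by rewrite inE.
  have -> : \bigcap_(i in [set` J]) (X i @^-1` U i) `&` X j @^-1` B =
      \bigcap_(i in [set` (j |: J)%SET]) (X i @^-1` U' i).
    apply/seteqP; split => w /=.
      move=> [wU wB] i; rewrite /= !inE /U' /= => /predU1P[->|iJ].
        by rewrite eqxx.
      by case: ifPn => [/eqP -> //|_]; apply: wU; rewrite /= inE.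
    move=> wU; split; last first.
      by have := wU j; rewrite /= !inE eqxx /U' eqxx; exact.
    move=> i /= iJ; have := wU i; rewrite /= !inE in iJ *.
    rewrite iJ orbT /U' => /(_ isT); case: ifPn => // /eqP ij.
    by move: jjs; rewrite -ij iJ.
  rewrite !XI// big_setU1//= /U' eqxx muleC; congr (_ * _)%E.
  apply: eq_bigr => i iJ; case: ifPn => // /eqP ij.
  by move: jJ; rewrite -ij iJ.
have := @measurable_gauss_comb_cyl x0 js J.
by move=> /(_ (fun i => _)) => /(_ _) h; rewrite -[X in <<s _ >> X]setTI; apply: h => // i ijs; rewrite inE.
Qed.

(** The bridge from the probability space to the operators. The variable at the head is independent
    of the combination of the others, hence integrates to one [gauss_op]. *)
Theorem integral_gauss_comb x0 js Phi : uniq js -> nonneg_measurable Phi ->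
  (\int[P]_w Phi (gauss_comb x0 js w) =
   gauss_ops s [seq a j | j <- js] Phi x0)%E.
Proof.
elim: js Phi => [|j js IH] Phi /=.
  move=> _ [mPhi Phi0]; rewrite integral_cst//= probability_setT mule1//.
move=> /andP[jjs ujs] mPhi; have [mPhi1 mPhi2] := mPhi.
have mg : measurable_fun [set: V * R] (fun xz => Phi (tshift xz.1 (a j) xz.2)).
  by apply: (measurableT_comp mPhi1); exact: measurable_shift2.
have -> := @integral_indep_pair _ _ _ P _ _ _ _ _ _
  (normal_prob 0 s : probability _ _) _ (measurable_gauss_comb x0 js) (mX j) (XN j)
  (fun A B mA mB => gauss_comb_indep x0 jjs mA mB) mg (fun=> mPhi2 _).
rewrite gauss_op_opsC// -IH//; last exact: nonneg_measurable_gauss_op.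
Qed.

End GaussianFamily.

Section ChiSquare.
Context {R : realType} {l : nat}.
Variable th : R.
Hypothesis th0 : 0 <= th.
Notation V := (l.-tuple R).

(** The mean of [exp(-th (y + G)^2)] for a centred Gaussian [G] of variance [q]. Another Gaussian
    shift just adds to [q], so products of kernels over the coordinates are stable under shifts
    along coordinate directions. *)
Definition sqr_kernel (q y : R) : R :=
  (Num.sqrt (1 + 2 * th * q))^-1 * expR (- (th / (1 + 2 * th * q)) * y ^+ 2).

Lemma measurable_sqr_kernel q : measurable_fun setT (sqr_kernel q).
Proof.
apply: measurable_funM => //; apply: measurableT_comp => //.
by apply: measurable_funM => //; exact: exprn_measurable.
Qed.

Lemma measurable_sqr_kernel_line (q y c : R) :
  measurable_fun [set: R] (fun z => sqr_kernel q (y + z * c)).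
Proof.
apply: (measurableT_comp (measurable_sqr_kernel q)).
by apply: measurable_funD => //; apply: measurable_funM.
Qed.

Lemma integral_sqr_kernel (s c q y : R) : 0 < s -> 0 <= q ->
  (\int[normal_prob 0 s]_z (sqr_kernel q (y + z * c))%:E =
   (sqr_kernel (q + c ^+ 2 * s ^+ 2) y)%:E)%E.
Proof.
move=> s0 q0; have u0 : 0 < 1 + 2 * th * q.
  by rewrite ltr_pwDl// mulr_ge0// mulr_ge0.
pose A := th / (1 + 2 * th * q).
have A0 : 0 <= A by rewrite divr_ge0// ltW.
have w0 : 0 < 1 + 2 * A * (c ^+ 2 * s ^+ 2).
  by rewrite ltr_pwDl//; apply: mulr_ge0; apply: mulr_ge0 => //; exact: sqr_ge0.
have E : 1 + 2 * th * (q + c ^+ 2 * s ^+ 2) =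
    (1 + 2 * th * q) * (1 + 2 * A * (c ^+ 2 * s ^+ 2)).
  by rewrite /A; field; rewrite gt_eqF.
have uN0 := lt0r_neq0 u0; have wN0 := lt0r_neq0 w0.
transitivity (\int[normal_prob 0 s]_z (((Num.sqrt (1 + 2 * th * q))^-1)%:E *
    (expR (- A * (y + z * c) ^+ 2))%:E))%E; first by [].
have mE : measurable_fun [set: R] (fun z => (expR (- A * (y + z * c) ^+ 2))%:E).
  apply/measurable_EFinP; apply: measurableT_comp => //.
  apply: measurable_funM => //; apply: measurable_funX.
  by apply: measurable_funD => //; apply: measurable_funM.
have k0 : 0 <= (Num.sqrt (1 + 2 * th * q))^-1 by rewrite invr_ge0 sqrtr_ge0.
rewrite ge0_integralZl//.
rewrite integral_normal_expR_quad// -EFinM; congr EFin; rewrite [LHS]mulrA.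
have F (a b : R) : th / (a * b) = th / a / b by rewrite invfM mulrA.
by rewrite [RHS]/sqr_kernel E (sqrtrM _ (ltW u0)) [in X in _ = X * _]invfM F -/A.
Qed.

Definition sqr_kernels (q : 'I_l -> R) (x : V) : \bar R :=
  (\prod_i sqr_kernel (q i) (tnth x i))%:E.

Definition coordinate_dir (c : R) (i : 'I_l) : V :=
  [tuple if k == i then c else 0 | k < l].

Let kernel_ge0 q y : 0 <= sqr_kernel q y.
Proof. by rewrite mulr_ge0// ?expR_ge0// invr_ge0 sqrtr_ge0. Qed.

Lemma nonneg_measurable_sqr_kernels q : nonneg_measurable (sqr_kernels q).
Proof.
split; last by move=> x; rewrite lee_fin prodr_ge0.
apply/measurable_EFinP; apply: measurable_prod => i _.
by apply: (measurableT_comp (measurable_sqr_kernel _)); exact: measurable_tnth.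
Qed.

Lemma gauss_op_sqr_kernels (s c : R) i q : 0 < s -> (forall k, 0 <= q k) ->
  gauss_op s (coordinate_dir c i) (sqr_kernels q) =
  sqr_kernels (fun k => q k + (k == i)%:R * (c ^+ 2 * s ^+ 2)).
Proof.
move=> s0 q0; apply/funext => x; rewrite /gauss_op /sqr_kernels.
transitivity (\int[normal_prob 0 s]_z
   ((\prod_(k | k != i) sqr_kernel (q k) (tnth x k))%:E *
    (sqr_kernel (q i) (tnth x i + z * c))%:E))%E.
  apply: eq_integral => z _; rewrite -EFinM; congr EFin.
  rewrite (bigD1 i)//= mulrC; congr (_ * _); last by rewrite !tnth_mktuple eqxx.
  by apply: eq_bigr => k /negbTE ki; rewrite !tnth_mktuple ki mulr0 addr0.
rewrite ge0_integralZl//=.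
- rewrite integral_sqr_kernel// -EFinM; congr EFin.
  rewrite [RHS](bigD1 i)//= eqxx mul1r mulrC; congr (_ * _).
  by apply: eq_bigr => k /negbTE ki; rewrite ki mul0r addr0.
- by apply/measurable_EFinP; exact: measurable_sqr_kernel_line.
- by move=> z _; rewrite lee_fin.
- by rewrite lee_fin prodr_ge0.
Qed.

Lemma gauss_ops_sqr_kernels (J : eqType) (s : R) (c : J -> R) (i : J -> 'I_l) js q :
  0 < s -> (forall k, 0 <= q k) ->
  gauss_ops s [seq coordinate_dir (c j) (i j) | j <- js] (sqr_kernels q) =
  sqr_kernels (fun k => q k + \sum_(j <- js) (k == i j)%:R * (c j ^+ 2 * s ^+ 2)).
Proof.
move=> s0 q0; elim: js => [|j js IH].
  by congr sqr_kernels; apply/funext => k; rewrite big_nil addr0.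
rewrite [LHS]/= -/(gauss_ops _ _ _) IH gauss_op_sqr_kernels//.
  by congr sqr_kernels; apply/funext => k; rewrite big_cons -addrA; congr (_ + _); rewrite addrC.
move=> k; rewrite addr_ge0// sumr_ge0// => j' _.
by apply: mulr_ge0 => //; apply: mulr_ge0; exact: sqr_ge0.
Qed.
End ChiSquare.

Lemma MVT_ge0 (R : realType) (f df : R -> R) (e : R) : 0 <= e -> f 0 = 0 ->
  (forall y : R, 0 <= y -> is_derive y 1 f (df y)) -> (forall y : R, 0 <= y -> 0 <= df y) ->
  0 <= f e.
Proof.
move=> e0 f0 fdf df0.
have H := @MVT_segment R f df 0 e e0.
have [||y] := H.
- by move=> z; rewrite in_itv/= => /andP[z0 _]; apply: fdf; exact: ltW.
- apply: derivable_within_continuous => z; rewrite in_itv/= => /andP[z0 _].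
  by apply: ex_derive; exact: fdf.
rewrite in_itv/= => /andP[y0 _]; rewrite f0 !subr0 => ->.
by apply: mulr_ge0 => //; exact: df0.
Qed.

Lemma le_ln1D (R : realType) (e : R) : 0 <= e -> e - e ^+ 2 / 2 <= ln (1 + e).
Proof.
move=> e0; pose F (x : R) := ln (1 + x) - x + x ^+ 2 / 2.
pose F' (x : R) := (1 + x)^-1 - 1 + x.
have D (x : R) : 0 <= x -> is_derive x 1 F (F' x).
  move=> x0; have x1 : 0 < 1 + x by rewrite ltr_pwDl.
  have Hln := is_derive1_ln x1.
  apply: is_derive_eq; rewrite /GRing.scale/=.
  by rewrite /F'; move: (_^-1) => k; field.
have F0 : F 0 = 0 by rewrite /F addr0 ln1 expr0n/= mul0r subr0 addr0.
rewrite -subr_ge0; have -> : ln (1 + e) - (e - e ^+ 2 / 2) = F e.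
  by rewrite /F; move: (ln _) => k; ring.
apply: (MVT_ge0 e0 F0 D) => y y0; have y1 : 0 < 1 + y by rewrite ltr_pwDl.
have -> : F' y = y ^+ 2 / (1 + y) by rewrite /F'; field; rewrite gt_eqF.
by apply: divr_ge0; [exact: sqr_ge0|exact: ltW].
Qed.

Lemma sqrt_expR (R : realType) (y : R) : Num.sqrt (expR y) = expR (y / 2).
Proof.
have -> : y = y / 2 *+ 2 by rewrite mulr2n; field.
by rewrite -[y / 2 *+ 2]mulr_natl expRM_natl sqrtr_sqr ger0_norm ?expR_ge0//; congr expR; field.
Qed.

Lemma measurable_lt_set d (T : measurableType d) (R : realType) (f g : T -> R) :
  measurable_fun setT f -> measurable_fun setT g -> measurable [set w | f w < g w].
Proof.
move=> mf mg; rewrite -[X in measurable X]setTI.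
exact: (measurable_fun_ltr mf mg measurableT (Y := [set true])).
Qed.

Lemma measurable_le_set d (T : measurableType d) (R : realType) (f g : T -> R) :
  measurable_fun setT f -> measurable_fun setT g -> measurable [set w | f w <= g w].
Proof.
move=> mf mg; rewrite -[X in measurable X]setTI.
exact: (measurable_fun_ler mf mg measurableT (Y := [set true])).
Qed.

Lemma markov_set d (T : measurableType d) (R : realType) (P : probability T R)
    (A : set T) (f : T -> \bar R) (M : R) :
  measurable A -> measurable_fun setT f -> (forall w, 0 <= f w)%E -> 0 <= M ->
  (forall w, A w -> M%:E <= f w)%E -> (M%:E * P A <= \int[P]_w f w)%E.
Proof.
move=> mA mf f0 M0 Af.
rewrite -(integral_cst P mA).
apply: (@le_trans _ _ (\int[P]_(w in A) f w)%E).
  by apply: ge0_le_integral => //; exact: measurable_funTS.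
by apply: ge0_subset_integral.
Qed.

Section GaussianSketch.
Context {disp : measure_display} {T : measurableType disp} {R : realType}.
Variables (P : probability T R) (l d : nat) (S : T -> 'M[R]_(l, d)).
Hypotheses (l0 : (0 < l)%N) (SG : scaled_gaussian P S).

Lemma measurable_sketch_sqr (v : 'cV[R]_d) :
  measurable_fun setT (fun w => dot (S w *m v) (S w *m v)).
Proof.
have [mS _ _] := SG.
apply: measurable_sum => i; rewrite /=.
have mi : measurable_fun setT (fun w => (S w *m v) i 0).
  under eq_fun do rewrite mxE.
  by apply: measurable_sum => j; apply: measurable_funM => //; exact: (mS (i, j)).
exact: measurable_funM.
Qed.

(** The entry [(i, j)] moves only coordinate [i] of [S v], by [v_j] times a variable of variance
    [1 / l]; in total coordinate [i] receives the variance [|v|^2 / l]. *)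
Lemma sketch_sqr_mgf (v : 'cV[R]_d) (th : R) : 0 <= th ->
  (\int[P]_w (expR (- th * dot (S w *m v) (S w *m v)))%:E =
   ((Num.sqrt (1 + 2 * th * (dot v v / l%:R)))^-1 ^+ l)%:E)%E.
Proof.
move=> th0; have [mS SN SI] := SG.
have s0 : 0 < Num.sqrt (l%:R^-1 : R) by rewrite sqrtr_gt0 invr_gt0 ltr0n.
pose a (ij : 'I_l * 'I_d) := @coordinate_dir R l (v ij.2 0) ij.1.
have main := integral_gauss_comb a mS SN SI (zero_tuple : l.-tuple R)
  (enum_uniq {: 'I_l * 'I_d}) (nonneg_measurable_sqr_kernels th (fun=> 0)).
transitivity (\int[P]_w sqr_kernels th (fun=> 0%R)
    (gauss_comb (entry S) a zero_tuple (enum {: 'I_l * 'I_d}) w))%E.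
  apply: eq_integral => w _; rewrite /sqr_kernels; congr EFin.
  rewrite /dot mulr_sumr expR_sum; apply: eq_bigr => i _.
  rewrite /sqr_kernel mulr0 addr0 sqrtr1 invr1 mulr1 mul1r; congr expR; congr (_ * _).
  rewrite -expr2; congr (_ ^+ 2); rewrite tnth_gauss_comb tnth_mktuple add0r mxE.
  rewrite big_enum/= -(pair_bigA _ (fun i' j => entry S (i', j) w * tnth (a (i', j)) i))/=.
  rewrite (bigD1 i)//= [X in _ + X]big1 ?addr0 => [|i' /negbTE ii'].
    by apply: eq_bigr => j _; rewrite tnth_mktuple/= eqxx.
  by apply: big1 => j _; rewrite tnth_mktuple/= eq_sym ii' mulr0.
rewrite main gauss_ops_sqr_kernels// /sqr_kernels; congr EFin.
transitivity (\prod_(i < l) (Num.sqrt (1 + 2 * th * (dot v v / l%:R)))^-1); last first.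
  by rewrite prodr_const card_ord.
apply: eq_bigr => i _; rewrite /sqr_kernel tnth_mktuple expr0n mulr0 expR0 mulr1 add0r.
congr (Num.sqrt (1 + 2 * th * _))^-1.
rewrite big_enum/= -(pair_bigA _ (fun i' j => (i == i')%:R *
   (v j 0 ^+ 2 * Num.sqrt (l%:R^-1) ^+ 2)))/=.
rewrite (bigD1 i)//= [X in _ + X]big1 ?addr0 => [|i' /negbTE ii'].
  rewrite eqxx sqr_sqrtr ?invr_ge0// /dot mulr_suml.
  by apply: eq_bigr => j _; rewrite mul1r.
by apply: big1 => j _; rewrite eq_sym ii' mul0r.
Qed.

Theorem sketch_lower_tail (v : 'cV[R]_d) (e : R) : 0 < e < 1 ->
  (P [set w | dot (S w *m v) (S w *m v) < (1 - e) * dot v v]%R <=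
   (expR (- (l%:R * e ^+ 2 / 4)))%:E)%E.
Proof.
move=> /andP[e0 e1].
(* For [v = 0] the event is empty, as its inequality is strict. *)
have := dot_ge0 v; rewrite le_eqVlt => /predU1P[/esym v0|v0].
  rewrite (_ : [set w | _] = set0) ?measure0 ?lee_fin ?expR_ge0//.
  rewrite -subset0 => w /=; rewrite v0 mulr0 => H.
  by have := le_lt_trans (dot_ge0 (S w *m v)) H; rewrite ltxx.
set A := [set w | _].
have mA : measurable A.
  by apply: measurable_lt_set => //; exact: measurable_sketch_sqr.
have lN0 : l%:R != 0 :> R by rewrite pnatr_eq0 -lt0n.
(* Chosen so that the transform equals [(1 + e)^(-l / 2)]; the exponent is then [(l / 2) (e (1 - e)
   - ln (1 + e)) <= - l e^2 / 4]. *)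
pose th := e * l%:R / (2 * dot v v).
have th0 : 0 <= th by rewrite divr_ge0// mulr_ge0 ?ler0n// ltW.
have vN0 : dot v v != 0 by rewrite gt_eqF.
have := @markov_set _ _ _ P A
  (fun w => (expR (- th * dot (S w *m v) (S w *m v)))%:E)
  (expR (- (l%:R * (e * (1 - e) / 2)))) mA.
rewrite sketch_sqr_mgf//.
have -> : 2 * th * (dot v v / l%:R) = e by rewrite /th; field; rewrite lN0 vN0.
move=> H.
have {}H : ((expR (- (l%:R * (e * (1 - e) / 2))))%:E * P A <=
   ((Num.sqrt (1 + e))^-1 ^+ l)%:E)%E.
  apply: H.
  - apply/measurable_EFinP; apply: measurableT_comp => //.
    by apply: measurable_funM => //; exact: measurable_sketch_sqr.
  - by move=> w; rewrite lee_fin expR_ge0.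
  - exact: expR_ge0.
  move=> w /= Aw; rewrite lee_fin ler_expR mulNr lerN2.
  have -> : l%:R * (e * (1 - e) / 2) = th * ((1 - e) * dot v v).
    by rewrite /th; field; rewrite vN0.
  by apply: ler_wpM2l => //; exact: ltW.
have E0 := expR_gt0 (- (l%:R * (e * (1 - e) / 2))).
rewrite -(@lee_pmul2l _ (expR (- (l%:R * (e * (1 - e) / 2))))%:E)//.
apply: (le_trans H); rewrite -EFinM lee_fin -expRD.
have u0 : 0 < 1 + e by rewrite addr_gt0.
have -> : Num.sqrt (1 + e) = expR (ln (1 + e) / 2).
  by rewrite -sqrt_expR lnK ?posrE.
rewrite -expRN -expRM_natl ler_expR.
have : e - e ^+ 2 / 2 <= ln (1 + e) by apply: le_ln1D; exact: ltW.
have : (0 : R) <= l%:R by [].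
move: (l%:R : R) (ln _) => n L n0 eL; nra.
Qed.
End GaussianSketch.

(** * Random matrices, rounding, and the operator norm of a sketch *)

Section MeasurableMatrices.
Context {disp : measure_display} {T : measurableType disp} {R : realType}.

Lemma random_matrix_cst m n (A : 'M[R]_(m, n)) : random_matrix (fun _ : T => A).
Proof. by move=> ij; exact: measurable_cst. Qed.

Lemma random_matrix_tr m n (A : T -> 'M[R]_(m, n)) :
  random_matrix A -> random_matrix (fun w => (A w)^T).
Proof.
move=> mA [i j]; rewrite /entry/=.
by under eq_fun do rewrite mxE; exact: (mA (j, i)).
Qed.

Lemma random_matrixD m n (A B : T -> 'M[R]_(m, n)) :
  random_matrix A -> random_matrix B -> random_matrix (fun w => A w + B w).
Proof.
move=> mA mB [i j]; rewrite /entry/=; under eq_fun do rewrite mxE.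
by apply: measurable_funD; [exact: (mA (i, j))|exact: (mB (i, j))].
Qed.

Lemma random_matrixM m n p (A : T -> 'M[R]_(m, n)) (B : T -> 'M[R]_(n, p)) :
  random_matrix A -> random_matrix B -> random_matrix (fun w => A w *m B w).
Proof.
move=> mA mB [i j]; rewrite /entry/=; under eq_fun do rewrite mxE.
apply: measurable_sum => k.
by apply: measurable_funM; [exact: (mA (i, k))|exact: (mB (k, j))].
Qed.

Lemma measurable_dot n (u v : T -> 'cV[R]_n) :
  random_matrix u -> random_matrix v -> measurable_fun setT (fun w => dot (u w) (v w)).
Proof.
move=> mu mv; apply: measurable_sum => i.
by apply: measurable_funM; [exact: (mu (i, 0))|exact: (mv (i, 0))].
Qed.

Lemma measurable_sqrt : measurable_fun [set: R] (@Num.sqrt R).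
Proof. by apply: continuous_measurable_fun; exact: sqrt_continuous. Qed.

Lemma measurable_enorm n (u : T -> 'cV[R]_n) :
  random_matrix u -> measurable_fun setT (fun w => enorm (u w)).
Proof. by move=> mu; apply: (measurableT_comp measurable_sqrt); exact: measurable_dot. Qed.

End MeasurableMatrices.

Lemma random_matrix_generated disp (T : measurableType disp) (R : realType) m n (A : T -> 'M[R]_(m, n))
    (G : set (set T)) : entry_events A `<=` <<s G >> ->
  @random_matrix _ (g_sigma_algebraType G) R m n A.
Proof.
move=> AG ij _ B mB; apply: AG; exists ij => //; exists B => //.
Qed.

Section Rounding.
Context {R : realType} {n : nat}.

Definition int_part (k : nat) (u : 'cV[R]_n) : 'cV[int]_n :=
  \col_i Num.floor (k.+1%:R * u i 0).

Definition round (k : nat) (u : 'cV[R]_n) : 'cV[R]_n :=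
  k.+1%:R^-1 *: map_mx intr (int_part k u).

Lemma round_dist k (u : 'cV[R]_n) i : `|u i 0 - round k u i 0| <= k.+1%:R^-1.
Proof.
rewrite /round /int_part !mxE.
have k0 : 0 < k.+1%:R :> R by rewrite ltr0n.
have /andP[h1 h2] := floor_itv (k.+1%:R * u i 0).
have -> : u i 0 - k.+1%:R^-1 * (Num.floor (k.+1%:R * u i 0))%:~R =
   (k.+1%:R * u i 0 - (Num.floor (k.+1%:R * u i 0))%:~R) * k.+1%:R^-1.
  by field; rewrite gt_eqF.
rewrite normrM [X in _ * X]ger0_norm ?invr_ge0 ?(ltW k0)//.
rewrite ler_piMl ?invr_ge0 ?(ltW k0)// ger0_norm ?subr_ge0//.
move: h2; rewrite intrD; lra.
Qed.

Lemma cvg_round (u : 'cV[R]_n) i : (fun k => round k u i 0) @ \oo --> u i 0.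
Proof.
apply/cvgrPdist_le => e e0; have H := @cvg_harmonic R.
move/cvgrPdist_le : H => /(_ e e0); apply: filterS => k.
rewrite sub0r normrN /harmonic => hk; apply: le_trans (round_dist k u i) _.
by apply: le_trans hk; exact: ler_norm.
Qed.

End Rounding.

Section Limits.
Context {R : realType}.

Lemma cvg_sumr (I : finType) (F : I -> nat -> R) (a : I -> R) :
  (forall i, F i @ \oo --> a i) -> (fun k => \sum_i F i k) @ \oo --> \sum_i a i.
Proof. by move=> Fa; apply: cvg_big => //; exact: add_continuous. Qed.

Lemma cvg_dot n (u v : nat -> 'cV[R]_n) (a b : 'cV[R]_n) :
  (forall i, (fun k => u k i 0) @ \oo --> a i 0) ->
  (forall i, (fun k => v k i 0) @ \oo --> b i 0) ->
  (fun k => dot (u k) (v k)) @ \oo --> dot a b.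
Proof.
move=> ua vb; by apply: cvg_sumr => i; exact: cvgM.
Qed.

Lemma cvg_mulmx m n (A : 'M[R]_(m, n)) (u : nat -> 'cV[R]_n) (a : 'cV[R]_n) :
  (forall i, (fun k => u k i 0) @ \oo --> a i 0) ->
  forall i, (fun k => (A *m u k) i 0) @ \oo --> (A *m a) i 0.
Proof.
move=> ua i; rewrite mxE.
rewrite (_ : (fun k => _) = fun k => \sum_j A i j * u k j 0); last first.
  by apply/funext => k; rewrite mxE.
by apply: cvg_sumr => j; apply: cvgMr; exact: ua.
Qed.

Lemma cvg_enorm n (u : nat -> 'cV[R]_n) (a : 'cV[R]_n) :
  (forall i, (fun k => u k i 0) @ \oo --> a i 0) ->
  (fun k => enorm (u k)) @ \oo --> enorm a.
Proof.
by move=> ua; exact: (cvg_comp _ _ (cvg_dot ua ua) (@sqrt_continuous R _)).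
Qed.

(** Both sides are homogeneous in [u] and in [v], so the scale of the grid drops out and integer
    vectors account for all rounded ones; the roundings converge. *)
Lemma bilinear_bound_int m n (A : 'M[R]_(m, n)) (K : R) :
  (forall (q : 'cV[int]_n) (r : 'cV[int]_m), dot (map_mx intr r) (A *m map_mx intr q) <=
     K * enorm (map_mx intr q : 'cV[R]_n) * enorm (map_mx intr r : 'cV[R]_m)) ->
  forall u v, dot v (A *m u) <= K * enorm u * enorm v.
Proof.
move=> H u v.
have ineq k : dot (round k v) (A *m round k u) <=
    K * enorm (round k u) * enorm (round k v).
  have k0 : 0 <= k.+1%:R^-1 :> R by rewrite invr_ge0.
  rewrite /round -scalemxAr dotZl dotZr !enormZ (ger0_norm k0).
  rewrite (_ : K * _ * _ = k.+1%:R^-1 * (k.+1%:R^-1 *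
     (K * enorm (map_mx intr (int_part k u)) * enorm (map_mx intr (int_part k v))))); last by ring.
  by apply: ler_wpM2l => //; apply: ler_wpM2l => //; exact: H.
have c1 : (fun k => dot (round k v) (A *m round k u)) @ \oo --> dot v (A *m u).
  apply: cvg_dot; first exact: cvg_round.
  by apply: cvg_mulmx; exact: cvg_round.
have c2 : (fun k => K * enorm (round k u) * enorm (round k v)) @ \oo -->
    K * enorm u * enorm v.
  apply: cvgM; last by apply: cvg_enorm; exact: cvg_round.
  by apply: cvgMr; apply: cvg_enorm; exact: cvg_round.
by apply: (ler_cvg_to c1 c2); exact: nearW.
Qed.

Lemma dot_mulmx m n (A : 'M[R]_(m, n)) u v : dot v (A *m u) = dot (A^T *m v) u.
Proof.
rewrite /dot; under eq_bigr => i _ do rewrite mxE mulr_sumr.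
rewrite exchange_big/=; apply: eq_bigr => j _; rewrite mxE mulr_suml.
by apply: eq_bigr => i _; rewrite mxE mulrCA mulrA.
Qed.

(** The bilinear form is tested at [u = A^T s], [v = s]. *)
Lemma enorm_trmx_le m n (A : 'M[R]_(m, n)) (K : R) : 0 <= K ->
  (forall u v, dot v (A *m u) <= K * enorm u * enorm v) ->
  forall s, enorm (A^T *m s) <= K * enorm s.
Proof.
move=> K0 H s; set t := A^T *m s.
have tt : dot t t = dot s (A *m t) by rewrite dot_mulmx.
have := sqrtr_ge0 (dot t t); rewrite -/(enorm t) le_eqVlt => /predU1P[<-|t0].
  by rewrite mulr_ge0// sqrtr_ge0.
rewrite -(ler_pM2l t0); have := H t s; rewrite -tt.
by rewrite -{1}(sqr_sqrtr (dot_ge0 t)) -/(enorm t) expr2 (mulrC K) -mulrA.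
Qed.

End Limits.

Lemma measurable_int_part disp (T : measurableType disp) (R : realType) d k
    (u : T -> 'cV[R]_d) q : random_matrix u ->
  measurable ((fun w => int_part k (u w)) @^-1` [set q]).
Proof.
move=> mu.
rewrite (_ : _ @^-1` _ = \bigcap_(i : 'I_d)
   ([set w | (q i 0)%:~R <= k.+1%:R * u w i 0] `&`
    [set w | k.+1%:R * u w i 0 < (q i 0 + 1)%:~R])); last first.
  apply/seteqP; split => w /=.
    by move=> <- i _ /=; rewrite mxE; have /andP[] := floor_itv (k.+1%:R * u w i 0).
  move=> H; apply/matrixP => i j; rewrite ord1 mxE.
  by have [h1 h2] := H i I; apply: floor_def; rewrite h1 h2.
apply: fin_bigcap_measurable => [|i _]; first exact: finite_finset.
have mi : measurable_fun setT (fun w => k.+1%:R * u w i 0).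
  by apply: measurable_funM => //; exact: (mu (i, 0)).
by apply: measurableI; [exact: measurable_le_set|exact: measurable_lt_set].
Qed.

(** The limit [r -> 0]; in the application [exp(r b)] is [m^r], with [m] the number of points of the
    net. *)
Lemma le_of_expR_perturbation (R : realType) (a b C : R) : 0 < C -> 0 <= b ->
  (forall r, 0 < r <= 1 -> a <= expR (r * b) * C) -> a <= C.
Proof.
move=> C0 b0 H; rewrite leNgt; apply/negP => Ca.
have k1 : 1 < a / C by rewrite ltr_pdivlMr// mul1r.
have L0 : 0 < ln (a / C) by rewrite ln_gt0.
pose r := Num.min 1 (ln (a / C) / (2 * (b + 1))).
have b1 : 0 < 2 * (b + 1) by rewrite mulr_gt0// ltr_wpDl.
have r0 : 0 < r by rewrite lt_min ltr01 divr_gt0.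
have rb : r * b < ln (a / C).
  apply: (@le_lt_trans _ _ (ln (a / C) / (2 * (b + 1)) * b)).
    by apply: ler_wpM2r => //; rewrite ge_min lexx orbT.
  rewrite mulrAC ltr_pdivrMr//; move: (ln _) L0 => L L0; nra.
have := H r; rewrite r0 ge_min lexx => /(_ isT); apply/negP; rewrite -ltNge.
rewrite -ltr_pdivlMr// -[X in _ < X]lnK ?posrE ?ltr_expR//.
exact: lt_trans k1.
Qed.

Section OpnormExcess.
Context {T : Type} {R : realType} {l d : nat}.
Variable S : T -> 'M[R]_(l, d).

(** The event that the operator norm exceeds [K], tested on integer vectors and without
    normalization: a countable union, hence measurable. *)
Definition opnorm_excess (K : R) : set T := \bigcup_(qr : 'cV[int]_d * 'cV[int]_l)
  [set w | K * enorm (map_mx intr qr.1 : 'cV[R]_d) * enorm (map_mx intr qr.2 : 'cV[R]_l) <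
     dot (map_mx intr qr.2) (S w *m map_mx intr qr.1)].

Lemma not_opnorm_excess (K : R) w : 0 <= K -> ~ opnorm_excess K w ->
  forall s, enorm ((S w)^T *m s) <= K * enorm s.
Proof.
move=> K0 Kw; apply: enorm_trmx_le => //.
apply: bilinear_bound_int => q r; rewrite leNgt; apply/negP => H; apply: Kw.
by exists (q, r).
Qed.
End OpnormExcess.

Lemma measurable_bilinear_gt disp (T : measurableType disp) (R : realType) l d
    (S : T -> 'M[R]_(l, d)) (u : 'cV[R]_d) (v : 'cV[R]_l) (K : R) :
  random_matrix S -> measurable [set w | K < dot v (S w *m u)].
Proof.
move=> mS; apply: measurable_lt_set => //; apply: measurable_dot.
  exact: random_matrix_cst.
by apply: random_matrixM => //; exact: random_matrix_cst.
Qed.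

Lemma measurable_opnorm_excess disp (T : measurableType disp) (R : realType) l d
    (S : T -> 'M[R]_(l, d)) (K : R) :
  random_matrix S -> measurable (opnorm_excess S K).
Proof.
move=> mS; apply: countable_bigcupT_measurable => // qr.
exact: measurable_bilinear_gt.
Qed.

Section OperatorNormTail.
Context {disp : measure_display} {T : measurableType disp} {R : realType}.
Variables (P : probability T R) (l d : nat) (S : T -> 'M[R]_(l, d)).
Hypotheses (l0 : (0 < l)%N) (d0 : (0 < d)%N) (SG : scaled_gaussian P S).

Let bilinear_sup m (cu : 'I_m -> 'cV[R]_d) (cv : 'I_m -> 'cV[R]_l) (K : R) :=
  \bigcup_k [set w | K < dot (cv k) (S w *m cu k)].

(** Markov's inequality for softmax with [lam = t / s], which minimizes [lam^2 s^2 / 2 - lam t s].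
    The tail is free of [m] because [beta = lam / r] with [r -> 0]. *)
Lemma net_tail m (cu : 'I_m -> 'cV[R]_d) (cv : 'I_m -> 'cV[R]_l) (t : R) : 0 < t ->
  (forall k, dot (cu k) (cu k) = 1) -> (forall k, dot (cv k) (cv k) = 1) ->
  (P (bilinear_sup cu cv (1 + Num.sqrt (d%:R / l%:R) + t / Num.sqrt l%:R)) <=
   (expR (- (t ^+ 2 / 2)))%:E)%E.
Proof.
move=> t0; case: m cu cv => [|m'] cu cv cu1 cv1.
  rewrite (_ : bilinear_sup _ _ _ = set0) ?measure0 ?lee_fin ?expR_ge0//.
  by rewrite -subset0 => w [[]].
set K := 1 + _ + _; set A := bilinear_sup _ _ K.
set m := m'.+1; have m0 : (0 < m)%N by [].
have [mS SN SI] := SG.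
have lR0 : (0 : R) < l%:R by rewrite ltr0n.
pose s : R := Num.sqrt (l%:R^-1).
have s0 : 0 < s by rewrite sqrtr_gt0 invr_gt0.
have sE : s = (Num.sqrt l%:R)^-1 by rewrite /s sqrtrV// ltW.
pose lam := t / s; have lam0 : 0 < lam by rewrite divr_gt0.
have mA : measurable A by apply: countable_bigcupT_measurable => // k; exact: measurable_bilinear_gt.
have fA : P A \is a fin_num by exact: fin_num_measure.
pose b := ln (m%:R : R).
have b0 : 0 <= b by rewrite ln_ge0// ler1n.
have KE : lam * (s * (Num.sqrt d%:R + Num.sqrt l%:R)) + lam ^+ 2 * s ^+ 2 / 2 - lam * K =
    - (t ^+ 2 / 2).
  rewrite /K; have -> : Num.sqrt (d%:R / l%:R : R) = Num.sqrt d%:R * s.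
    by rewrite sE sqrtrM// sqrtrV// ltW.
  have q0 : Num.sqrt (l%:R : R) != 0 by rewrite gt_eqF// sqrtr_gt0.
  rewrite /lam sE; move: (Num.sqrt l%:R) (Num.sqrt d%:R) q0 => q q' q0.
  by field.
pose C := expR (lam * (s * (Num.sqrt d%:R + Num.sqrt l%:R)) + lam ^+ 2 * s ^+ 2 / 2).
suff main r : 0 < r <= 1 -> expR (lam * K) * fine (P A) <= expR (r * b) * C.
  have := le_of_expR_perturbation (expR_gt0 _) b0 main.
  have -> : expR (- (t ^+ 2 / 2)) = C / expR (lam * K) by rewrite -KE expRB.
  by rewrite -(fineK fA) lee_fin ler_pdivlMr ?expR_gt0// mulrC.
move=> /andP[r0 r1]; pose beta := lam / r.
have lamb : lam <= beta by rewrite ler_pdivlMr// ler_piMr// ltW.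
have bl : lam / beta = r by rewrite /beta invf_div mulrCA mulfV ?mulr1// gt_eqF.
have := softmax_bilinear_bound m0 l0 d0 cu1 cv1 lam0 lamb s0.
have mF : nonneg_measurable (fun x : m.-tuple R => (softmax lam beta x)%:E).
  exact: nonneg_measurable_softmax.
have main := integral_gauss_comb (bilinear_dir cu cv) mS SN SI (zero_tuple : m.-tuple R)
  (enum_uniq {: 'I_l * 'I_d}) mF.
rewrite /bilinear_dirs -main bl => bound.
have := @markov_set _ _ _ P A (fun w => (softmax lam beta
   (gauss_comb (entry S) (bilinear_dir cu cv) zero_tuple (enum {: 'I_l * 'I_d}) w))%:E)
  (expR (lam * K)) mA.
move=> H; have {}H := le_trans (H _ _ _ _) bound.
rewrite -lee_fin EFinM fineK//; apply: le_trans (H _ _ _ _) _.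
- by case: mF => mF _; apply: (measurableT_comp mF); exact: measurable_gauss_comb.
- by move=> w; rewrite lee_fin ltW// softmax_gt0.
- exact: expR_ge0.
- move=> w [k _ /= Kw]; rewrite lee_fin.
  apply: le_trans (ge_softmax m0 lam0 lamb _ k).
  rewrite ler_expR; apply: ler_wpM2l; first exact: ltW.
  apply: (le_trans (ltW Kw)); rewrite tnth_gauss_comb tnth_mktuple add0r.
  rewrite big_enum/= -(pair_bigA _ (fun i j => entry S (i, j) w *
    tnth (bilinear_dir cu cv (i, j)) k))/=.
  rewrite le_eqVlt; apply/orP; left; apply/eqP; rewrite /dot.
  apply: eq_bigr => i _; rewrite mxE mulr_sumr; apply: eq_bigr => j _.
  by rewrite tnth_mktuple/= mulrCA.
by rewrite lee_fin /powR pnatr_eq0/= -/b.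
Qed.

Theorem opnorm_tail (t : R) : 0 < t ->
  (P (opnorm_excess S (1 + Num.sqrt (d%:R / l%:R) + t / Num.sqrt l%:R)) <=
   (expR (- (t ^+ 2 / 2)))%:E)%E.
Proof.
move=> t0; set K := 1 + _ + _; have [mS _ _] := SG.
have K0 : 0 <= K by rewrite !addr_ge0 ?sqrtr_ge0// divr_ge0 ?sqrtr_ge0// ltW.
(* A unit vector used in place of 0, which cannot be normalized; it only adds points to the net. *)
pose e1 n : 'cV[R]_n := \col_i ((i : nat) == 0%N)%:R.
pose unit_of n (x : 'cV[R]_n) := if x == 0 then e1 n else (enorm x)^-1 *: x.
have unit_of1 n (x : 'cV[R]_n) : (0 < n)%N -> dot (unit_of n x) (unit_of n x) = 1.
  rewrite /unit_of; case: eqVneq => [_|x0 _].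
    case: n x => // n _ _; rewrite /dot (bigD1 ord0)//= big1 => [|i /negbTE i0].
      by rewrite !mxE mulr1 addr0.
    by rewrite !mxE (_ : (i : nat) == 0%N = false) ?mul0r.
  rewrite dotZl dotZr; have := enorm_gt0 x0 => /gt_eqF/negbT e0.
  rewrite -(sqr_enorm x).
  by move: (enorm x) e0 => y y0; field.
pose qr k : 'cV[int]_d * 'cV[int]_l := odflt (0, 0) (unpickle k).
pose cu k := unit_of d (map_mx intr (qr k).1).
pose cv k := unit_of l (map_mx intr (qr k).2).
pose A n := bilinear_sup (fun k : 'I_n => cu k) (fun k : 'I_n => cv k) K.
have mA n : measurable (A n).
  by apply: countable_bigcupT_measurable => // k; exact: measurable_bilinear_gt.
have sub : opnorm_excess S K `<=` \bigcup_n A n.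
  move=> w [[q r] _ /= H]; exists (pickle (q, r)).+1 => //; exists ord_max => //=.
  rewrite /cu /cv /qr /= pickleK /= /unit_of.
  move: (map_mx intr q) (map_mx intr r) H => u v H.
  (* With a zero vector both sides vanish, contradicting the strict inequality. *)
  have [u0|u0] := eqVneq u 0.
    move: H; rewrite u0 mulmx0 /dot big1 => [|i _]; last by rewrite mxE mulr0.
    by rewrite ltNge !mulr_ge0// sqrtr_ge0.
  have [v0|v0] := eqVneq v 0.
    move: H; rewrite v0 /dot big1 => [|i _]; last by rewrite mxE mul0r.
    by rewrite ltNge !mulr_ge0// sqrtr_ge0.
  rewrite -scalemxAr dotZl dotZr mulrA -invfM mulrC ltr_pdivlMr ?mulr_gt0 ?enorm_gt0//.
  by rewrite (mulrC (enorm v)) mulrA.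
have ndA : nondecreasing_seq A.
  move=> m n mn; apply/subsetPset => w [k _ H].
  by exists (widen_ord mn k).
have mU : measurable (\bigcup_n A n) by exact: bigcupT_measurable.
apply: (@le_trans _ _ (P (\bigcup_n A n))).
  by apply: le_measure; rewrite ?inE//; exact: measurable_opnorm_excess.
have cA : (P \o A) n @[n --> \oo] --> P (\bigcup_n A n).
  by apply: nondecreasing_cvg_mu.
rewrite -(cvg_lim _ cA)//; apply: lime_le; first by apply/cvg_ex; eexists; exact: cA.
apply: nearW => n; apply: net_tail => // k; exact: unit_of1.
Qed.

End OperatorNormTail.

(** * Sketching a random direction *)

Section CountableCases.
Context {disp : measure_display} {T : measurableType disp} {R : realType}.
Variable P : probability T R.

Lemma pickle_fiber (C : countType) (z : T -> C) k :
  [set w | pickle (z w) = k] =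
  if @pickle_inv C k is Some q then z @^-1` [set q] else set0.
Proof.
apply/seteqP; split => w /= => [<-|]; first by rewrite pickleK_inv.
have := @pickle_invK C k; case: pickle_inv => [q|]//= <-.
by move=> zq; rewrite -zq.
Qed.

Lemma measure_countable_cases (C : countType) (z : T -> C) (A : set T) :
  (forall q, measurable (z @^-1` [set q])) -> measurable A ->
  P A = (\sum_(0 <= k <oo) P (A `&` [set w | pickle (z w) = k]))%E.
Proof.
move=> mz mA.
have mD k : measurable [set w | pickle (z w) = k].
  by rewrite pickle_fiber; case: pickle_inv.
rewrite {1}(_ : A = \bigcup_k (A `&` [set w | pickle (z w) = k])); last first.
  by apply/seteqP; split => [w Aw|w [k _ []]//]; exists (pickle (z w)).
rewrite measure_bigcup//.
- by apply: eq_eseriesl => k; rewrite in_setT.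
- by move=> k _; exact: measurableI.
- by move=> i j _ _ [w [[_ /= <-] [_ /= <-]]].
Qed.

Lemma le_countable_cases (C : countType) (z : T -> C) (A B : set T) (c : R) :
  (forall q, measurable (z @^-1` [set q])) -> measurable A -> measurable B -> 0 <= c ->
  (forall q, P (A `&` z @^-1` [set q]) <= c%:E * P (B `&` z @^-1` [set q]))%E ->
  (P A <= c%:E * P B)%E.
Proof.
move=> mz mA mB c0 H.
rewrite (measure_countable_cases mz mA) (measure_countable_cases mz mB).
rewrite -nneseriesZl//; apply: lee_nneseries => // k _.
by rewrite pickle_fiber; case: pickle_inv => [q|]; rewrite ?H// !setI0 measure0 mule0.
Qed.

End CountableCases.

Section RandomDirection.
Context {disp : measure_display} {T : measurableType disp} {R : realType}.
Variables (P : probability T R) (l d : nat) (S : T -> 'M[R]_(l, d)) (G : set (set T)).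
Hypotheses (l0 : (0 < l)%N) (SG : scaled_gaussian P S).
Hypothesis Gm : forall A, G A -> measurable A.
Hypothesis SI : independent_systems P <<s entry_events S >> <<s G >>.

Let sGm A : <<s G >> A -> measurable A.
Proof. by apply: smallest_sub => //; exact: sigma_algebra_measurable. Qed.

Definition norm_deficit (e : R) (g : T -> 'cV[R]_d) : set T :=
  [set w | dot (S w *m g w) (S w *m g w) < (1 - e) * dot (g w) (g w)].

Lemma generated_norm_deficit e (v : 'cV[R]_d) :
  <<s entry_events S >> (norm_deficit e (fun=> v)).
Proof.
apply: (@measurable_lt_set _ (g_sigma_algebraType (entry_events S))) => //.
have mSv : @random_matrix _ (g_sigma_algebraType (entry_events S)) R l 1
    (fun w => S w *m v).
  apply: random_matrixM; last exact: random_matrix_cst.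
  by apply: random_matrix_generated; exact: sub_sigma_algebra.
exact: measurable_dot.
Qed.

Lemma measurable_norm_deficit e g : random_matrix g -> measurable (norm_deficit e g).
Proof.
move=> mg; have [mS _ _] := SG.
have mSg := random_matrixM mS mg.
by apply: measurable_lt_set; [|apply: measurable_funM => //]; exact: measurable_dot.
Qed.

Let tail_bound (e : R) : R := expR (- (l%:R * e ^+ 2 / 4)).

(** On the fibre [z = q] the direction is the constant [h q]; the fibre and [F] belong to the past,
    of which [S] is independent, so the tail for fixed directions factors out. *)
Let countable_direction e (C : countType) (h : C -> 'cV[R]_d) (z : T -> C) F : 0 < e < 1 ->
  (forall q, <<s G >> (z @^-1` [set q])) -> <<s G >> F ->
  measurable (norm_deficit e (h \o z)) /\
  (P (norm_deficit e (h \o z) `&` F) <= (tail_bound e)%:E * P F)%E.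
Proof.
move=> e01 mz mF.
have E q : norm_deficit e (h \o z) `&` z @^-1` [set q] =
    norm_deficit e (fun=> h q) `&` z @^-1` [set q].
  by apply/seteqP; split => w [] /= H1 H2; split => //; move: H1; rewrite /norm_deficit/= H2.
have mq q : measurable (norm_deficit e (fun=> h q)).
  by apply: measurable_norm_deficit; exact: random_matrix_cst.
have mE : measurable (norm_deficit e (h \o z)).
  rewrite (_ : norm_deficit _ _ = \bigcup_q (norm_deficit e (h \o z) `&` z @^-1` [set q])).
    apply: countable_bigcupT_measurable => // q; rewrite E.
    by apply: measurableI => //; exact: sGm.
  by apply/seteqP; split => [w wE|w [q _ []]//]; exists (z w).
split=> //; apply: (le_countable_cases (z := z)).
- by move=> q; exact: sGm.
- by apply: measurableI => //; exact: sGm.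
- exact: sGm.
- exact: expR_ge0.
move=> q; rewrite setIAC E -setIA.
have mzF : <<s G >> (z @^-1` [set q] `&` F).
  by apply: (@measurableI _ (g_sigma_algebraType G)) => //; exact: mz.
rewrite SI//; last exact: generated_norm_deficit.
rewrite (setIC F); apply: lee_wpmul2r => //.
exact: sketch_lower_tail.
Qed.

Let generated_int_part k (g : T -> 'cV[R]_d) q : entry_events g `<=` <<s G >> ->
  <<s G >> ((fun w => int_part k (g w)) @^-1` [set q]).
Proof.
move=> Hg; apply: (@measurable_int_part _ (g_sigma_algebraType G)).
exact: random_matrix_generated.
Qed.

(** The strict inequality of [norm_deficit] is an open condition, so it holds for all roundings of
    [g] from some index on. The event thus lies in the increasing union of the [C m], and [C m] lies
    in the event for the single rounding [m]. *)
Theorem random_direction_tail e (g : T -> 'cV[R]_d) F : 0 < e < 1 ->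
  entry_events g `<=` <<s G >> -> <<s G >> F ->
  (P (norm_deficit e g `&` F) <= (expR (- (l%:R * e ^+ 2 / 4)))%:E * P F)%E.
Proof.
move=> e01 Hg GF.
pose E n := norm_deficit e (fun w => round n (g w)).
have EE n : measurable (E n) /\ (P (E n `&` F) <= (tail_bound e)%:E * P F)%E.
  apply: (@countable_direction e _ (fun q => n.+1%:R^-1 *: map_mx intr q)
    (fun w => int_part n (g w))) => // q.
  exact: generated_int_part.
have mg : random_matrix g.
  by move=> ij _ B mB; apply: sGm; apply: Hg; exists ij => //; exists B.
have mF := sGm GF.
pose C m := (\bigcap_(n in [set n | (m <= n)%N]) E n) `&` F.
have mC m : measurable (C m).
  by apply: measurableI => //; apply: bigcap_measurableType => n _; exact: (EE n).1.
have ndC : nondecreasing_seq C.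
  move=> m n mn; apply/subsetPset => w [Hw wF]; split=> // k /= nk.
  by apply: Hw; exact: leq_trans nk.
have mU : measurable (\bigcup_m C m) by exact: bigcupT_measurable.
have sub : norm_deficit e g `&` F `<=` \bigcup_m C m.
  move=> w [wg wF].
  pose h (x : 'cV[R]_d) := dot (S w *m x) (S w *m x) - (1 - e) * dot x x.
  have ch : (fun n => h (round n (g w))) @ \oo --> h (g w).
    have cr i := @cvg_round _ _ (g w) i.
    apply: cvgB; first by apply: cvg_dot => i; exact: cvg_mulmx.
    by apply: cvgMr; exact: cvg_dot.
  have h0 : h (g w) < 0 by rewrite subr_lt0.
  have [m _ Hm] : \forall n \near \oo, h (round n (g w)) < 0 by exact: (cvgr_lt _ ch).
  exists m => //; split=> // n mn; have := Hm n mn.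
  by rewrite /= subr_lt0.
apply: (@le_trans _ _ (P (\bigcup_m C m))).
  apply: le_measure; rewrite ?inE//; apply: measurableI => //.
  exact: measurable_norm_deficit.
have cC : (P \o C) n @[n --> \oo] --> P (\bigcup_n C n) by apply: nondecreasing_cvg_mu.
rewrite -(cvg_lim _ cC)//; apply: lime_le; first by apply/cvg_ex; eexists; exact: cC.
apply: nearW => n /=; apply: (@le_trans _ _ (P (E n `&` F))); last exact: (EE n).2.
apply: le_measure; rewrite ?inE//; first by apply: measurableI => //; exact: (EE n).1.
by move=> w [H wF]; split => //; apply: H => /=.
Qed.

End RandomDirection.

(** * A Chernoff bound for adapted events *)

(** The difference vanishes at 1 and has derivative [(1 - 1 / y)^2 / 2]. *)
Lemma ln_le_half_sub_inv (R : realType) (y : R) : 1 <= y -> ln y <= (y - y^-1) / 2.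
Proof.
move=> y1; pose F (z : R) := ((1 + z) - (1 + z)^-1) / 2 - ln (1 + z).
pose F' (z : R) := (1 - (1 + z)^-1) ^+ 2 / 2.
have D (z : R) : 0 <= z -> is_derive z 1 F (F' z).
  move=> z0; have z1 : 0 < 1 + z by rewrite ltr_pwDl.
  have zN0 : 1 + z != 0 by rewrite gt_eqF.
  have Hln := is_derive1_ln z1.
  have Hinv := @is_deriveV R (fun z : R => 1 + z) z 1 1 zN0.
  apply: is_derive_eq; rewrite /GRing.scale/=.
  by rewrite /F' expr2; field.
have F0 : F 0 = 0 by rewrite /F addr0 ln1 invr1 subrr mul0r subr0.
have z0 : 0 <= y - 1 by rewrite subr_ge0.
have := MVT_ge0 z0 F0 D; rewrite /F (addrC 1) subrK subr_ge0; apply.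
by move=> z _; rewrite divr_ge0 ?sqr_ge0.
Qed.

(** The left side is Markov's bound with weight [1 - e] per good iteration. Its exponent is at most
    [(1 - delta) N ((1 - e) (- ln (1 - e)) - e)], and [(1 - e) (- ln (1 - e)) <= e - e^2 / 2]. *)
Lemma chernoff_exponent (R : realType) (N s : nat) (delta e : R) : 0 < e < 1 ->
  0 <= delta <= 1 -> s%:R <= (1 - delta) * (1 - e) * N%:R ->
  (1 - e) ^- s * ((1 - e) + (1 - (1 - e)) * delta) ^+ N <=
  expR (- (e ^+ 2 / 2 * (1 - delta) * N%:R)).
Proof.
move=> /andP[e0 e1] /andP[d0 d1] sN.
have u0 : 0 < 1 - e by rewrite subr_gt0.
have lu : - ln (1 - e) <= ((1 - e)^-1 - (1 - e)) / 2.
  have i1 : 1 <= (1 - e)^-1 by rewrite invf_ge1//; lra.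
  by have := ln_le_half_sub_inv i1; rewrite invrK lnV ?posrE.
have L0 : 0 <= - ln (1 - e) by rewrite oppr_ge0 ln_le0//; lra.
have -> : (1 - e) ^- s = expR (s%:R * - ln (1 - e)).
  by rewrite mulrN expRN expRM_natl lnK ?posrE.
apply: (@le_trans _ _ (expR ((1 - delta) * (1 - e) * N%:R * - ln (1 - e)) *
    expR (N%:R * - (e * (1 - delta))))).
  apply: ler_pM; [exact: expR_ge0| | |].
  - by rewrite exprn_ge0// addr_ge0 ?(ltW u0)// mulr_ge0//; lra.
  - by rewrite ler_expR; apply: ler_wpM2r.
  rewrite expRM_natl lerXn2r ?nnegrE ?expR_ge0//.
    by rewrite addr_ge0 ?(ltW u0)// mulr_ge0//; lra.
  have := expR_ge1Dx (- (e * (1 - delta))); move: (expR _) => E; lra.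
rewrite -expRD ler_expR.
have h : (1 - e) * - ln (1 - e) <= e - e ^+ 2 / 2.
  have -> : e - e ^+ 2 / 2 = (1 - e) * (((1 - e)^-1 - (1 - e)) / 2).
    by field; rewrite gt_eqF.
  by apply: ler_wpM2l lu; exact: ltW.
have n0 : 0 <= (1 - delta) * N%:R by rewrite mulr_ge0// subr_ge0.
have := ler_wpM2l n0 h.
move: (ln _) (N%:R : R) => L n; lra.
Qed.

Section Chernoff.
Context {disp : measure_display} {T : measurableType disp} {R : realType}.
Variables (P : probability T R) (Fl : nat -> set (set T)) (Bad : nat -> set T) (delta : R).
Hypothesis FlT : forall k, Fl k setT.
Hypothesis FlC : forall k A, Fl k A -> Fl k (~` A).
Hypothesis FlI : forall k A B, Fl k A -> Fl k B -> Fl k (A `&` B).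
Variable N : nat.
Hypothesis Flm : forall k A, (k <= N)%N -> Fl k A -> measurable A.
Hypothesis FlS : forall k A, (k < N)%N -> Fl k A -> Fl k.+1 A.
Hypothesis FlBad : forall k, (k < N)%N -> Fl k.+1 (Bad k).
Hypothesis Bad_le : forall k F, (k < N)%N -> Fl k F ->
  (P (Bad k `&` F) <= delta%:E * P F)%E.

Let mBad k : (k < N)%N -> measurable (Bad k).
Proof. by move=> kN; apply: (Flm kN); exact: FlBad. Qed.

Let mu (A : set T) : R := fine (P A).

Let muE A : measurable A -> P A = (mu A)%:E.
Proof. by move=> mA; rewrite fineK// fin_num_measure. Qed.

Let mu_ge0 A : 0 <= mu A.
Proof. by rewrite fine_ge0. Qed.

Let mu_split A E : measurable A -> measurable E -> mu A = mu (A `\` E) + mu (A `&` E).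
Proof.
move=> mA mE; have mD := measurableD mA mE; have mI := measurableI _ _ mA mE.
by apply: EFin_inj; rewrite EFinD -!muE//; exact: measureDI.
Qed.

Let mu_le A B : measurable A -> measurable B -> A `<=` B -> mu A <= mu B.
Proof. by move=> mA mB AB; rewrite -lee_fin -!muE//; apply: le_measure; rewrite ?inE. Qed.

Definition good_count (k : nat) (w : T) : nat := \sum_(j < k) `[< ~ Bad j w >].

Variable e : R.
Hypothesis e01 : 0 < e < 1.

Let a := 1 - e.

Let a01 : 0 < a < 1.
Proof. by case/andP: e01 => h1 h2; rewrite /a; apply/andP; split; lra. Qed.

(* [tilted k A] is the integral over A of a ^ good_count k. *)
Fixpoint tilted (k : nat) (A : set T) : R :=
  if k is k'.+1 then a * tilted k' (A `\` Bad k') + tilted k' (A `&` Bad k') else mu A.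

Let a0 : 0 < a. Proof. by case/andP: a01. Qed.

Let tilted_ge0 k A : 0 <= tilted k A.
Proof.
elim: k A => [|k IH] A //=; apply: addr_ge0 => //; apply: mulr_ge0 => //; exact: ltW.
Qed.

Let tilted_split k A E : (k <= N)%N -> measurable A -> measurable E ->
  tilted k A = tilted k (A `\` E) + tilted k (A `&` E).
Proof.
elim: k A E => [|k IH] A E kN mA mE /=; first exact: mu_split.
have mB := mBad kN.
rewrite (IH (A `\` Bad k) E)//; [|exact: ltnW|exact: measurableD].
rewrite (IH (A `&` Bad k) E)//; [|exact: ltnW|exact: measurableI].
rewrite !setDDl (setUC (Bad k)) !setDE (setIAC A (~` Bad k) E) (setIAC A (Bad k) E).
rewrite (setIAC A (Bad k) (~` E)); ring.
Qed.

(** The weight [a^(good_count k)] is determined by events of [Fl k], so a domination tested against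
    all of these passes to the tilted masses. *)
Let le_tilted k A B c : (k <= N)%N -> 0 <= c -> measurable A -> measurable B ->
  (forall F, Fl k F -> mu (A `&` F) <= c * mu (B `&` F)) -> tilted k A <= c * tilted k B.
Proof.
elim: k A B => [|k IH] A B kN c0 mA mB H /=.
  by have := H _ (FlT 0); rewrite !setIT.
have mBk := mBad kN.
rewrite mulrDr mulrCA; apply: lerD.
  apply: ler_wpM2l; first exact: ltW.
  apply: IH => //; [exact: ltnW|exact: measurableD|exact: measurableD|].
  move=> F FF; rewrite !setDE -!setIA; apply: H; apply: FlI; last exact: FlS.
  by apply: FlC; exact: FlBad.
apply: IH => //; [exact: ltnW|exact: measurableI|exact: measurableI|].
by move=> F FF; rewrite -!setIA; apply: H; apply: FlI; [exact: FlBad|exact: FlS].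
Qed.

Hypothesis delta01 : 0 <= delta <= 1.

Let delta0 : 0 <= delta. Proof. by case/andP: delta01. Qed.

(** Iteration [k] multiplies the mass of good outcomes by [a] and leaves that of bad ones, whose
    tilted share is at most [delta] by [le_tilted]. *)
Let tilted_setT k : (k <= N)%N -> tilted k setT <= (a + (1 - a) * delta) ^+ k.
Proof.
have q0 : 0 <= a + (1 - a) * delta.
  by case/andP: a01 => _ a1; rewrite addr_ge0 ?(ltW a0)// mulr_ge0// subr_ge0 ltW.
elim: k => [|k IH] kN; first by rewrite /= /mu probability_setT expr0.
have mB := mBad kN.
apply: (@le_trans _ _ ((a + (1 - a) * delta) * tilted k setT)); last first.
  by rewrite exprS; apply: ler_wpM2l => //; apply: IH; exact: ltnW.
have h : tilted k (Bad k) <= delta * tilted k setT.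
  apply: le_tilted => //; first exact: ltnW.
  move=> F FF; rewrite setTI -lee_fin EFinM -!muE; [exact: Bad_le|exact: Flm (ltnW kN) FF|].
  by apply: measurableI => //; exact: Flm (ltnW kN) FF.
have s := tilted_split (ltnW kN) measurableT mB; rewrite setTI in s.
rewrite [X in X <= _]/= setTI.
have -> : tilted k (setT `\` Bad k) = tilted k setT - tilted k (Bad k).
  by rewrite s addrK.
case/andP: a01 => _ a1.
move: (tilted k (Bad k)) (tilted k setT) h => u v h; nra.
Qed.

Lemma measurable_good_count k s : (k <= N)%N -> measurable [set w | (good_count k w <= s)%N].
Proof.
elim: k s => [|k IH] s kN.
  rewrite (_ : [set w | _] = setT)//; apply/seteqP; split => // w _ /=.
  by rewrite /good_count big_ord0.
have mB := mBad kN; have IHk := IH _ (ltnW kN).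
have E : [set w | (good_count k.+1 w <= s)%N] =
    (Bad k `&` [set w | (good_count k w <= s)%N]) `|`
    (~` Bad k `&` [set w | (good_count k w < s)%N]).
  apply/seteqP; split => w /=; rewrite /good_count big_ord_recr/=.
    have [Bw|Bw] := pselect (Bad k w); last by rewrite asboolT// addn1; right.
    by rewrite asboolF ?addn0; [left|exact].
  by move=> [[Bw h]|[Bw h]]; [rewrite asboolF ?addn0//; exact|rewrite asboolT// addn1].
rewrite E; apply: measurableU; apply: measurableI => //; first exact: measurableC.
case: s {E} => [|s]; last exact: IHk.
by rewrite (_ : [set w | _] = set0)// -subset0 => w /=; rewrite ltn0.
Qed.

(** Markov's inequality, as the weight is at least [a^s] on this event; by induction because
    [tilted] is a recursion and not an integral. *)
Let le_tilted_good k s A : (k <= N)%N -> measurable A ->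
  a ^+ s * mu (A `&` [set w | (good_count k w <= s)%N]) <= tilted k A.
Proof.
case/andP: a01 => _ a1.
elim: k s A => [|k IH] s A kN mA.
  rewrite /= (_ : [set w | _] = setT) ?setIT; last first.
    by apply/seteqP; split => // w _ /=; rewrite /good_count big_ord0.
  by rewrite ler_piMl//; exact: exprn_ile1 (ltW a0) (ltW a1).
have mB := mBad kN; have kN' := ltnW kN.
have mI := measurableI _ _ mA mB; have mD := measurableD mA mB.
have mS := measurable_good_count s kN.
rewrite [X in _ <= X]/= (mu_split (measurableI _ _ mA mS) mB) mulrDr.
have asB w : Bad k w -> good_count k.+1 w = good_count k w.
  by move=> Bw; rewrite /good_count big_ord_recr/= asboolF ?addn0//; exact.
have asG w : ~ Bad k w -> good_count k.+1 w = (good_count k w).+1.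
  by move=> Bw; rewrite /good_count big_ord_recr/= asboolT// addn1.
apply: lerD; last first.
  apply: le_trans (IH s _ kN' mI); apply: ler_wpM2l; first exact: exprn_ge0 (ltW a0).
  have mk := measurable_good_count s kN'.
  apply: mu_le; [by do 2?apply: measurableI|exact: measurableI|].
  by move=> w [[Aw /= h] Bw]; split => //=; rewrite -asB.
case: s mS => [|s] mS.
  rewrite (_ : _ `\` _ = set0); last first.
    by rewrite -subset0 => w [[Aw /= h] Bw]; rewrite asG in h.
  by rewrite /mu measure0 mulr0 mulr_ge0 ?tilted_ge0// ltW.
rewrite exprS -mulrA; apply: ler_wpM2l; first exact: ltW.
apply: le_trans (IH s _ kN' mD); apply: ler_wpM2l; first exact: exprn_ge0 (ltW a0).
have mk := measurable_good_count s kN'.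
apply: mu_le; [apply: measurableD => //; exact: measurableI|exact: measurableI|].
by move=> w [[Aw /= h] Bw]; split => //=; rewrite asG in h.
Qed.

Theorem good_count_tail s : s%:R <= (1 - delta) * (1 - e) * N%:R ->
  (P [set w | (good_count N w <= s)%N] <=
   (expR (- (e ^+ 2 / 2 * (1 - delta) * N%:R)))%:E)%E.
Proof.
move=> sN; have mS := measurable_good_count s (leqnn N).
rewrite muE// lee_fin; apply: le_trans (chernoff_exponent e01 delta01 sN).
rewrite -/a mulrC ler_pdivlMr ?exprn_gt0// mulrC.
apply: le_trans (tilted_setT (leqnn N)).
by apply: (le_trans _ (le_tilted_good s (leqnn N) measurableT)); rewrite setTI.
Qed.

End Chernoff.

(** * Measurability of the iterates *)

Section ContinuousImage.
Context {disp : measure_display} {T : measurableType disp} {R : realType} {d : nat}.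

Lemma cvg_round_mx (u : 'cV[R]_d) : (fun k => round k u) @ \oo --> u.
Proof.
apply/cvg_ballP => e e0.
have := @cvg_harmonic R; move/cvgrPdist_lt => /(_ e e0); apply: filterS => k.
rewrite sub0r normrN => hk; split=> // i j; rewrite ord1.
apply: le_lt_trans (round_dist k u i) _.
by apply: le_lt_trans hk; rewrite ler_norm.
Qed.

Lemma measurable_countable_image (C : countType) (z : T -> C) (h : C -> R) :
  (forall q, measurable (z @^-1` [set q])) -> measurable_fun setT (h \o z).
Proof.
move=> mz _ B mB; rewrite setTI.
rewrite (_ : _ @^-1` _ = \bigcup_q ((fun=> B (h q)) `&` (z @^-1` [set q]))).
  apply: countable_bigcupT_measurable => // q.
  have [Bq|Bq] := pselect (B (h q)).
    rewrite (_ : _ `&` _ = z @^-1` [set q]) //.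
    by apply/seteqP; split => w // [].
  by rewrite (_ : _ `&` _ = set0)// -subset0 => w [].
apply/seteqP; split => w; first by move=> Bw; exists (z w).
by move=> [q _ [Bq zq]]; rewrite /= zq.
Qed.

(** A random vector is measurable entry by entry. [f (u w)] is the limit of [f (round k (u w))], and
    a rounded vector takes countably many values. *)
Lemma measurable_continuous (f : 'cV[R]_d -> R) (u : T -> 'cV[R]_d) :
  continuous f -> random_matrix u -> measurable_fun setT (f \o u).
Proof.
move=> cf mu; apply: (@measurable_fun_cvg _ _ _ setT
    (fun k w => f (round k (u w))) (f \o u)) => [k|w _].
  apply: (@measurable_countable_image _ (fun w => int_part k (u w))
    (fun q => f (k.+1%:R^-1 *: map_mx intr q))) => q.
  exact: measurable_int_part.
exact: (cvg_comp _ _ (@cvg_round_mx (u w)) (cf (u w))).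
Qed.

Lemma random_gradient (f : 'cV[R]_d -> R) (u : T -> 'cV[R]_d) :
  continuous (gradient f) -> random_matrix u -> random_matrix (fun w => gradient f (u w)).
Proof.
move=> cg mu [i j]; rewrite /entry/= ord1.
apply: (@measurable_continuous (fun x => gradient f x i 0) u) => // x.
exact: (cvg_comp _ _ (cg x) (@coord_continuous R _ _ i 0 _)).
Qed.

End ContinuousImage.

Section History.
Context {disp : measure_display} {T : measurableType disp} {R : realType} {l d : nat}.
Variables (S : nat -> T -> 'M[R]_(l, d)) (B : nat -> T -> 'M[R]_d) (shat : nat -> T -> 'cV[R]_l).

Definition history_generator (k : nat) : set (set T) :=
  \bigcup_(j in `I_k)
        (entry_events (S j) `|` entry_events (B j) `|` entry_events (shat j)).

Notation Hist k := (g_sigma_algebraType (history_generator k)).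

Lemma le_history j k : (j <= k)%N -> history S B shat j `<=` history S B shat k.
Proof.
move=> jk; apply: sub_sigma_algebra2 => A [i /= ij Ai].
by exists i => //=; exact: leq_trans jk.
Qed.

Lemma random_matrix_history k m n (A : T -> 'M[R]_(m, n)) :
  entry_events A `<=` history S B shat k <-> @random_matrix _ (Hist k) R m n A.
Proof.
split; first exact: random_matrix_generated.
by move=> mA _ [ij _ [U mU <-]]; exact: (mA ij).
Qed.

Lemma random_history_data k : [/\ @random_matrix _ (Hist k.+1) R _ _ (S k),
  @random_matrix _ (Hist k.+1) R _ _ (B k) & @random_matrix _ (Hist k.+1) R _ _ (shat k)].
Proof.
split; apply/random_matrix_history => A HA; apply: sub_sigma_algebra;
  exists k => //=; [left; left|left; right|right]; exact: HA.
Qed.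

Lemma measurable_history_mono j k (g : T -> R) : (j <= k)%N ->
  @measurable_fun _ _ (Hist j) R setT g -> @measurable_fun _ _ (Hist k) R setT g.
Proof.
move=> jk mg _ U mU; rewrite setTI; apply: (le_history jk).
by have := mg measurableT U mU; rewrite setTI.
Qed.

End History.

Lemma random_matrix_if disp (T : measurableType disp) (R : realType) m n
    (b : T -> bool) (A A' : T -> 'M[R]_(m, n)) : measurable_fun setT b ->
  random_matrix A -> random_matrix A' -> random_matrix (fun w => if b w then A w else A' w).
Proof.
move=> mb mA mA' ij; rewrite /entry.
rewrite (_ : (fun w => _) = fun w => if b w then entry A ij w else entry A' ij w).
  by apply: measurable_fun_if => //; apply: measurable_funTS.
by apply/funext => w; rewrite /entry; case: ifP.
Qed.

(** * A run is adapted to its history *)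

Section RunMeasurability.
Context {disp : measure_display} {T : measurableType disp} {R : realType} {l d : nat}.
Variables (P : probability T R) (f : 'cV[R]_d -> R).
Variables (alpha_max gamma1 gamma2 theta Bmax C7 : R) (x0 : 'cV[R]_d) (alpha0 : R) (N : nat).
Variables (S : nat -> T -> 'M[R]_(l, d)) (B : nat -> T -> 'M[R]_d) (shat : nat -> T -> 'cV[R]_l).
Variables (x : nat -> T -> 'cV[R]_d) (alpha : nat -> T -> R).
Hypothesis hf : continuously_differentiable f.
Hypothesis run : tr_run P f alpha_max gamma1 gamma2 theta Bmax C7 x0 alpha0 N S B shat x alpha.
Notation Hist k := (g_sigma_algebraType (history_generator S B shat k)).

Let fC : continuous f.
Proof. by move=> u; apply: differentiable_continuous; exact: hf.1. Qed.

Lemma measurable_tr_model d' (T' : measurableType d') (S' : T' -> 'M[R]_(l, d))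
    (B' : T' -> 'M[R]_d) (x' : T' -> 'cV[R]_d) (s : T' -> 'cV[R]_l) :
  random_matrix S' -> random_matrix B' -> random_matrix x' -> random_matrix s ->
  measurable_fun setT (fun w => tr_model f (S' w) (B' w) (x' w) (s w)).
Proof.
move=> mS mB mx ms; rewrite /tr_model.
apply: measurable_funD; first apply: measurable_funD.
- exact: measurable_continuous.
- apply: measurable_dot => //; apply: random_matrixM => //.
  exact: (random_gradient hf.2).
- apply: measurable_funM => //; apply: measurable_dot => //.
  apply: random_matrixM => //; apply: random_matrixM; last exact: random_matrix_tr.
  exact: random_matrixM.
Qed.

(** [x] is only constrained by the relation [tr_iteration], which nevertheless determines the next
    iterate: a measurable test chooses between two measurable vectors. *)
Lemma random_iterate k : (k <= N)%N -> @random_matrix _ (Hist k) R _ _ (x k).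
Proof.
elim: k => [_|k IH kN].
  rewrite (_ : x 0%N = fun=> x0); first exact: random_matrix_cst.
  by apply/funext => w; case: (tr_run_init run w).
have [mS mB ms] := random_history_data S B shat k.
have {}IH : @random_matrix _ (Hist k.+1) R _ _ (x k).
  by move=> ij; apply: (measurable_history_mono (leqnSn k)); apply: IH; exact: ltnW.
pose test w := theta * (tr_model f (S k w) (B k w) (x k w) 0 -
    tr_model f (S k w) (B k w) (x k w) (shat k w)) <=
  f (x k w) - f (x k w + (S k w)^T *m shat k w).
have mstep : @random_matrix _ (Hist k.+1) R _ _ (fun w => x k w + (S k w)^T *m shat k w).
  apply: random_matrixD => //; apply: random_matrixM => //; exact: random_matrix_tr.
rewrite (_ : x k.+1 = fun w => if test w then x k w + (S k w)^T *m shat k w else x k w).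
  apply: random_matrix_if => //; apply: measurable_fun_ler.
    apply: measurable_funM => //; apply: measurable_funB.
      by apply: measurable_tr_model => //; exact: random_matrix_cst.
    exact: measurable_tr_model.
  by apply: measurable_funB; exact: measurable_continuous.
apply/funext => w; have [_ _ _] := tr_run_step run w kN.
by rewrite -/(test w); case: ifP => _ [].
Qed.

Hypotheses (l0 : (0 < l)%N) (ld : (l <= d)%N).
Variables (e t : R).
Hypotheses (e01 : 0 < e < 1) (t0 : 0 < t).

Definition sketch_failure (k : nat) : set T :=
  norm_deficit (S k) e (fun w => gradient f (x k w)) `|`
  opnorm_excess (S k) (1 + Num.sqrt (d%:R / l%:R) + t / Num.sqrt l%:R).

Lemma history_generator_measurable k A : (k <= N)%N ->
  history_generator S B shat k A -> measurable A.
Proof.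
move=> kN [j /= jk]; have jN := leq_trans jk kN.
have ev m n (M : T -> 'M[R]_(m, n)) : random_matrix M -> entry_events M A -> measurable A.
  by move=> mM [ij _ [U mU <-]]; exact: (mM ij).
move=> [[|]|]; apply: ev.
- by have [] := tr_run_gaussian run jN.
- exact: (tr_run_B run jN).
- exact: (tr_run_shat run jN).
Qed.

Lemma history_sketch_failure k : (k < N)%N -> history S B shat k.+1 (sketch_failure k).
Proof.
move=> kN; have [mS _ _] := random_history_data S B shat k.
have mx : @random_matrix _ (Hist k.+1) R _ _ (x k).
  move=> ij; apply: (measurable_history_mono (leqnSn k)); apply: random_iterate.
  exact: ltnW.
have mg := random_gradient hf.2 mx.
apply: (@measurableU _ (Hist k.+1)); last exact: measurable_opnorm_excess.
have mSg := random_matrixM mS mg.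
by apply: measurable_lt_set; [|apply: measurable_funM => //]; exact: measurable_dot.
Qed.

(** The norm deficit involves [x k], a function of the past, and needs the tail for random
    directions; the operator norm involves the current sketch alone, so plain independence
    suffices. *)
Lemma sketch_failure_le k F : (k < N)%N -> history S B shat k F ->
  (P (sketch_failure k `&` F) <=
   (expR (- (l%:R * e ^+ 2 / 4)) + expR (- (t ^+ 2 / 2)))%:E * P F)%E.
Proof.
move=> kN HF; have SG := tr_run_gaussian run kN; have [mS _ _] := SG.
have Gm := @history_generator_measurable k ^~ (ltnW kN).
have sub A : history S B shat k A -> measurable A.
  by move: A; apply: smallest_sub => //; exact: sigma_algebra_measurable.
have mF := sub _ HF.
have mg : @random_matrix _ (Hist k) R _ _ (fun w => gradient f (x k w)).
  by apply: (random_gradient hf.2); apply: random_iterate; exact: ltnW.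
have d0 : (0 < d)%N by exact: leq_trans ld.
set K := 1 + Num.sqrt (d%:R / l%:R) + t / Num.sqrt l%:R.
have mO : measurable (opnorm_excess (S k) K) by exact: measurable_opnorm_excess.
have mD : measurable (norm_deficit (S k) e (fun w => gradient f (x k w))).
  apply: (measurable_norm_deficit SG) => ij _ U mU; apply: sub.
  by apply: mg.
rewrite /sketch_failure setIUl EFinD ge0_muleDl ?lee_fin ?expR_ge0//.
apply: (@le_trans _ _ _ _ _ (measureU2 P _ _)); [exact: measurableI|exact: measurableI|].
apply: leeD.
  apply: (random_direction_tail l0 SG Gm (tr_run_indep run kN)) => //.
  exact/random_matrix_history.
apply: (@le_trans _ _ (P (opnorm_excess (S k) K) * P F)%E); last first.
  by apply: lee_wpmul2r => //; exact: opnorm_tail.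
rewrite le_eqVlt; apply/predU1P; left; apply: (tr_run_indep run kN) => //.
apply: (@measurable_opnorm_excess _ (g_sigma_algebraType (entry_events (S k)))).
by apply: random_matrix_generated; exact: sub_sigma_algebra.
Qed.

End RunMeasurability.

(** * Deterministic analysis of the iterations *)

Section EuclideanNorm.
Context {R : realType}.

Lemma dot_le_enorm n (u v : 'cV[R]_n) : dot u v <= enorm u * enorm v.
Proof.
have [u0|u0] := eqVneq (enorm u) 0.
  by rewrite u0 mul0r (enorm0_eq0 u0) /dot big1// => i _; rewrite mxE mul0r.
have [v0|v0] := eqVneq (enorm v) 0.
  by rewrite v0 mulr0 (enorm0_eq0 v0) /dot big1// => i _; rewrite mxE mulr0.
have pu : 0 < enorm u by rewrite lt_neqAle eq_sym u0 enorm_ge0.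
have pv : 0 < enorm v by rewrite lt_neqAle eq_sym v0 enorm_ge0.
have := le_dot_half ((enorm u)^-1 *: u) ((enorm v)^-1 *: v).
rewrite !dotZl !dotZr -(sqr_enorm u) -(sqr_enorm v).
move: (dot u v) (enorm u) (enorm v) u0 v0 pu pv => D a b a0 b0 pa pb.
have -> : (a^-1 * (a^-1 * a ^+ 2) + b^-1 * (b^-1 * b ^+ 2)) / 2 = 1.
  by field; rewrite a0 b0.
rewrite mulrA -invfM mulrC ler_pdivrMr ?mul1r// mulr_gt0//.
Qed.

Lemma norm_dot_le n (u v : 'cV[R]_n) : `|dot u v| <= enorm u * enorm v.
Proof.
rewrite ler_norml dot_le_enorm andbT lerNl -dotNl.
apply: le_trans (dot_le_enorm _ _) _.
by rewrite -scaleN1r enormZ normrN1 mul1r.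
Qed.

(** By the Frobenius norm. It bounds the set whose [sup] is [opnorm]; for an unbounded set that
    [sup] would be a default value. *)
Lemma enorm_mulmx_bounded m n (A : 'M[R]_(m, n)) :
  exists M, forall u, enorm (A *m u) <= M * enorm u.
Proof.
pose F : R := \sum_i dot (row i A)^T (row i A)^T.
have F0 : 0 <= F by apply: sumr_ge0 => i _; exact: dot_ge0.
exists (Num.sqrt F) => u; rewrite /enorm -sqrtrM//; apply: ler_wsqrtr.
rewrite mulr_suml; apply: ler_sum => i _.
have -> : (A *m u) i 0 = dot (row i A)^T u.
  by rewrite mxE; apply: eq_bigr => j _; rewrite !mxE.
rewrite -(sqr_enorm (row i A)^T) -(sqr_enorm u) -expr2 -exprMn.
rewrite -[X in X <= _]real_normK ?num_real//.
by apply: lerXn2r; rewrite ?nnegrE ?mulr_ge0 ?enorm_ge0//; exact: norm_dot_le.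
Qed.

Lemma opnorm_ge0 m n (A : 'M[R]_(m, n)) : 0 <= opnorm A.
Proof.
have [M HM] := enorm_mulmx_bounded A.
apply: (@le_trans _ _ (enorm (A *m 0))); first exact: enorm_ge0.
apply: ub_le_sup; last first.
  by exists 0; rewrite //= enorm0.
exists `|M| => _ [u /= u1 <-]; apply: (le_trans (HM u)).
apply: (@le_trans _ _ (`|M| * enorm u)).
  by apply: ler_wpM2r; [exact: enorm_ge0|exact: ler_norm].
by rewrite ler_piMr.
Qed.

Lemma le_opnorm m n (A : 'M[R]_(m, n)) u : enorm (A *m u) <= opnorm A * enorm u.
Proof.
have [M HM] := enorm_mulmx_bounded A.
have [u0|u0] := eqVneq (enorm u) 0.
  by rewrite (enorm0_eq0 u0) mulmx0 !enorm0 mulr0.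
have pu : 0 < enorm u by rewrite lt_neqAle eq_sym u0 enorm_ge0.
rewrite -ler_pdivrMr//.
have -> : enorm (A *m u) / enorm u = enorm (A *m ((enorm u)^-1 *: u)).
  by rewrite -scalemxAr enormZ ger0_norm ?invr_ge0 ?enorm_ge0// mulrC.
apply: ub_le_sup; last first.
  exists ((enorm u)^-1 *: u) => //=.
  by rewrite enormZ ger0_norm ?invr_ge0 ?enorm_ge0// mulVf.
exists `|M| => _ [v /= v1 <-]; apply: (le_trans (HM v)).
apply: (@le_trans _ _ (`|M| * enorm v)).
  by apply: ler_wpM2r; [exact: enorm_ge0|exact: ler_norm].
by rewrite ler_piMr.
Qed.

Lemma dot_opnorm_ge n (B : 'M[R]_n) u : - (opnorm B * enorm u ^+ 2) <= dot u (B *m u).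
Proof.
have := norm_dot_le u (B *m u); rewrite ler_norml => /andP[h _].
apply: le_trans h; rewrite lerN2 mulrC expr2 mulrA; apply: ler_wpM2r; first exact: enorm_ge0.
exact: le_opnorm.
Qed.

End EuclideanNorm.

Section Descent.
Context {R : realType} {d : nat}.
Variables (f : 'cV[R]_d -> R) (L : R).
Hypotheses (hf : forall x, differentiable f x) (hL : lipschitz_gradient L f).

Lemma derive_gradient (x s : 'cV[R]_d) : 'D_s f x = dot (gradient f x) s.
Proof.
rewrite (deriveE _ (hf x)).
have E : s = \sum_i s i 0 *: delta_mx i 0.
  rewrite {1}[s]matrix_sum_delta; apply: eq_bigr => i _.
  by rewrite big_ord1.
rewrite {1}E linear_sum /dot; apply: eq_bigr => i _.
by rewrite linearZ mxE (deriveE _ (hf x)) mulrC.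
Qed.

(** The Lipschitz condition at two distinct points, which exist as [0 < d]. *)
Lemma lipschitz_ge0 : (0 < d)%N -> 0 <= L.
Proof.
move=> d0; pose u : 'cV[R]_d := const_mx 1.
have pu : 0 < enorm (u - 0).
  rewrite lt_neqAle enorm_ge0 andbT eq_sym; apply/eqP => /enorm0_eq0.
  rewrite subr0 => /matrixP/(_ (Ordinal d0) 0); rewrite !mxE => /eqP.
  by rewrite oner_eq0.
by rewrite -(pmulr_lge0 _ pu); apply: le_trans (hL u 0); exact: enorm_ge0.
Qed.

(** The mean value theorem along the segment gives the constant [L] instead of [L / 2]; this is the
    [L] in the threshold [L + Bmax / 2]. *)
Lemma descent (x s : 'cV[R]_d) : 0 <= L ->
  f (x + s) <= f x + dot (gradient f x) s + L * enorm s ^+ 2.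
Proof.
move=> L0; pose phi (t : R) := f (x + t *: s).
pose dphi t := dot (gradient f (x + t *: s)) s.
have D (t : R) : is_derive t 1 phi (dphi t).
  have E : (fun h : R => h^-1 *: ((phi \o shift t) (h *: 1) - phi t)) =
      (fun h : R => h^-1 *: ((f \o shift (x + t *: s)) (h *: s) - f (x + t *: s))).
    apply/funext => h; rewrite /phi /=; congr (_ *: (f _ - _)).
    by rewrite /shift/= [h *: 1]mulr1 scalerDl addrCA addrA addrC addrA.
  have H := diff_derivable (v := s) (hf (x + t *: s)).
  split; first by rewrite /derivable E.
  by rewrite /derive E /dphi -derive_gradient.
have cphi : {within `[0, 1], continuous phi}.
  by apply: derivable_within_continuous => t _; exact: (@ex_derive _ _ _ _ _ _ _ (D t)).
have [c] := @MVT_segment R phi dphi 0 1 ler01 (fun t _ => D t) cphi.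
rewrite in_itv/= => /andP[c0 c1]; rewrite /phi scale1r scale0r addr0 subr0 mulr1 => E.
have -> : f (x + s) = f x + dphi c by rewrite -E addrCA subrr addr0.
rewrite -addrA lerD2l.
have -> : dphi c = dot (gradient f x) s + dot (gradient f (x + c *: s) - gradient f x) s.
  by rewrite dotDl dotNl addrCA subrr addr0.
rewrite lerD2l; apply: (le_trans (dot_le_enorm _ _)).
rewrite expr2 mulrA; apply: ler_wpM2r; first exact: enorm_ge0.
apply: (le_trans (hL _ _)); apply: ler_wpM2l => //.
by rewrite (addrC x) addrK enormZ ger0_norm// ler_piMl// enorm_ge0.
Qed.
End Descent.

(** * Counting good iterations *)

Section Counting.
Variables (N p h c : nat) (acc good : nat -> bool).
Hypotheses (c0 : (0 < c)%N) (ph : (p <= h)%N).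

(* alpha_k = alpha_max * gamma1 ^+ radius_exponent k *)
Fixpoint radius_exponent (k : nat) : nat :=
  if k is k'.+1 then
    if acc k' then (radius_exponent k' - c)%N else (radius_exponent k').+1
  else p.

Definition low_success (k : nat) : bool :=
  [&& good k, acc k & (radius_exponent k <= h + c)%N].

(* min (a_n, h) rises by at most one, and only at a failure below h, while a
   success above h + c lowers max (a_n, h) by c. *)
Lemma count_good_steps :
  (forall k, (k < N)%N -> good k -> (h <= radius_exponent k)%N -> acc k) ->
  (c.+1 * \sum_(k < N) good k <=
   c.+1 * \sum_(k < N) low_success k + c * N + (h - p))%N.
Proof.
move=> Hacc.
(* Equality at [n = 0], where the exponent is [p <= h]; at [n = N] the claim follows as min <= max.
   The term [c * n] pays for the rest: a success that is not good lowers the min by at most [c], a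
   failure that is not good raises the max by at most 1, and a good success above [h + c] leaves
   [c + 1 - c = 1]. *)
suff H n : (n <= N)%N ->
  (c.+1 * \sum_(k < n) good k + p + maxn (radius_exponent n) h <=
   c.+1 * \sum_(k < n) low_success k + c * n + minn (radius_exponent n) h + h)%N.
  have := H N (leqnn N); move: (c.+1 * _)%N (c.+1 * _)%N (c * N)%N => u v w; lia.
elim: n => [|n IH] nN; first by rewrite !big_ord0 /=; lia.
have := IH (ltnW nN); have := Hacc n nN.
rewrite !big_ord_recr /= !mulnDr mulnS /low_success.
move: (c.+1 * _)%N (c.+1 * _)%N (c * n)%N (radius_exponent n) => u v w a.
case: (good n) (acc n) => [] [] /=; rewrite ?muln0 ?muln1 ?andbF; lia.
Qed.

End Counting.

Section Radius.
Context {R : realType}.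
Variables (alpha_max gamma1 : R) (c : nat).
Hypotheses (am0 : 0 < alpha_max) (g01 : 0 < gamma1 < 1).

(** As the expansion factor is an exact power of [gamma1], radii stay on the grid
    [alpha_max gamma1^a]; the cap at [alpha_max] is the truncation in the subtraction of
    exponents. *)
Lemma min_radius_expansion (a : nat) :
  Num.min alpha_max (gamma1 ^- c * (alpha_max * gamma1 ^+ a)) =
  alpha_max * gamma1 ^+ (a - c).
Proof.
case/andP: g01 => g0 g1; have gc : gamma1 ^+ c != 0 by rewrite expf_neq0// gt_eqF.
have [ca|ac] := leqP c a.
  have -> : gamma1 ^- c * (alpha_max * gamma1 ^+ a) = alpha_max * gamma1 ^+ (a - c).
    by rewrite -{1}(subnK ca) exprD; field.
  by apply/min_idPr; rewrite ler_piMr ?(ltW am0)// exprn_ile1// ltW.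
rewrite (eqP (ltnW ac)) expr0 mulr1; apply/min_idPl.
rewrite mulrCA ler_peMr ?(ltW am0)// mulrC ler_pdivlMr ?exprn_gt0// mul1r.
by apply: ler_wiXn2l; [exact: ltW|exact: ltW|exact: ltnW].
Qed.

End Radius.

Section Step.
Context {R : realType} {l d : nat}.
Variables (f : 'cV[R]_d -> R) (L theta Bmax C7 e eps K : R).
Hypotheses (hf : continuously_differentiable f) (hL : lipschitz_gradient L f) (L0 : 0 <= L).
Hypotheses (theta01 : 0 < theta < 1) (Bmax0 : 0 < Bmax) (C70 : 0 < C7).
Hypotheses (e01 : 0 < e < 1) (eps0 : 0 < eps) (K0 : 0 < K).

Definition accepted (S : 'M[R]_(l, d)) (B : 'M[R]_d) (x : 'cV[R]_d) (s : 'cV[R]_l) : bool :=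
  theta * (tr_model f S B x 0 - tr_model f S B x s) <= f x - f (x + S^T *m s).

Lemma min_ratio_ge0 (a g b : R) : 0 <= a -> 0 <= g -> 0 <= b -> 0 <= min_ratio a g b.
Proof.
move=> a0 g0 b0; rewrite /min_ratio; case: ifP => // _.
by rewrite le_min a0 divr_ge0.
Qed.

Lemma ge_min_ratio (a g b : R) : 0 <= g -> 0 <= b <= Bmax ->
  Num.min a (g / Bmax) <= min_ratio a g b.
Proof.
move=> g0 /andP[b0 bB]; rewrite /min_ratio; case: ifPn => [_|bN0].
  by rewrite ge_min lexx.
have pb : 0 < b by rewrite lt_neqAle eq_sym bN0.
rewrite le_min !ge_min lexx/=; apply/orP; right.
by apply: ler_wpM2l => //; rewrite lef_pV2.
Qed.

Let gam := Num.sqrt (1 - e) * eps.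
Let bound := Num.min (C7 * (1 - theta) / ((L + Bmax / 2) * K ^+ 2)) (1 / Bmax).

Variables (S : 'M[R]_(l, d)) (B : 'M[R]_d) (s : 'cV[R]_l) (x : 'cV[R]_d) (alpha : R).
Hypotheses (Bop : opnorm B <= Bmax) (salpha : enorm s <= alpha) (alpha0 : 0 <= alpha).
Let g := enorm (S *m gradient f x).
Let decrease := tr_model f S B x 0 - tr_model f S B x s.
Hypothesis dec : C7 * g * min_ratio alpha g (opnorm B) <= decrease.

Let g0 : 0 <= g. Proof. exact: enorm_ge0. Qed.

Lemma decrease_ge0 : 0 <= decrease.
Proof.
apply: le_trans dec; apply: mulr_ge0; first by apply: mulr_ge0 => //; exact: ltW.
by apply: min_ratio_ge0 => //; exact: opnorm_ge0.
Qed.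

Hypothesis good_norm : (1 - e) * dot (gradient f x) (gradient f x) <=
  dot (S *m gradient f x) (S *m gradient f x).
Hypothesis large : eps < enorm (gradient f x).

Let gam0 : 0 < gam.
Proof. by case/andP: e01 => _ e1; rewrite mulr_gt0// sqrtr_gt0 subr_gt0. Qed.

Let gam_le : gam <= g.
Proof.
case/andP: e01 => _ e1; rewrite /g /enorm.
apply: le_trans (ler_wsqrtr good_norm).
have h : 0 <= 1 - e by rewrite subr_ge0 ltW.
rewrite (sqrtrM _ h); apply: ler_wpM2l; first exact: sqrtr_ge0.
exact: ltW large.
Qed.

Lemma decrease_ge : C7 * gam * Num.min alpha (gam / Bmax) <= decrease.
Proof.
apply: le_trans dec; apply: ler_pM.
- by apply: mulr_ge0; exact: ltW.
- by rewrite le_min alpha0/=; apply: divr_ge0; exact: ltW.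
- by apply: ler_wpM2l => //; exact: ltW.
apply: (le_trans _ (@ge_min_ratio alpha g (opnorm B) g0 _)).
  rewrite le_min !ge_min lexx/=; apply/orP; right.
  by apply: ler_wpM2r => //; rewrite invr_ge0 ltW.
by rewrite opnorm_ge0.
Qed.

(** The actual decrease falls short of the predicted one by at most [(L + Bmax / 2) |u|^2], which is
    quadratic in the radius, while the prediction is at least [C7 g alpha], linear in it. Below the
    threshold the shortfall is at most [(1 - theta) decrease]. *)
Lemma small_radius_accepted : (forall u, enorm (S^T *m u) <= K * enorm u) ->
  alpha <= gam * bound -> accepted S B x s.
Proof.
move=> HK small; rewrite /accepted -/decrease.
have LB : 0 < L + Bmax / 2 by rewrite ltr_wpDl// divr_gt0.
set u := S^T *m s.
have hu : enorm u <= K * alpha.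
  by apply: (le_trans (HK s)); apply: ler_wpM2l => //; exact: ltW.
have h1 := descent hf.1 hL x u L0.
have h2 := dot_opnorm_ge B u.
have Du : decrease = - dot (gradient f x) u - 2^-1 * dot u (B *m u).
  rewrite /decrease /tr_model.
  have -> : dot (S *m gradient f x) 0 = 0 by rewrite -(scale0r 0) dotZr mul0r.
  have -> : dot 0 (S *m B *m S^T *m 0) = 0 by rewrite mulmx0 -(scale0r 0) dotZr mul0r.
  have -> : dot (S *m gradient f x) s = dot (gradient f x) u.
    by rewrite dotC dot_mulmx dotC.
  have -> : dot s (S *m B *m S^T *m s) = dot u (B *m u).
    by rewrite -!mulmxA dot_mulmx.
  by ring.
have h3 : opnorm B * enorm u ^+ 2 <= Bmax * enorm u ^+ 2.
  by apply: ler_wpM2r => //; exact: sqr_ge0.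
(* The entry [1 / Bmax] of the threshold: the radius realizes the minimum in the decrease
   condition. *)
have minE : min_ratio alpha g (opnorm B) = alpha.
  rewrite /min_ratio; case: ifPn => // bN0; apply/min_idPl.
  have pb : 0 < opnorm B by rewrite lt_neqAle eq_sym bN0 opnorm_ge0.
  apply: (le_trans small); rewrite ler_pdivlMr//.
  apply: (@le_trans _ _ (gam * (1 / Bmax) * opnorm B)).
    apply: ler_wpM2r; first exact: ltW.
    by apply: ler_wpM2l; [exact: ltW|rewrite ge_min lexx orbT].
  apply: le_trans gam_le; rewrite -mulrA ler_piMr ?(ltW gam0)//.
  by rewrite mul1r mulrC ler_pdivrMr// mul1r.
have h4 : (L + Bmax / 2) * enorm u ^+ 2 <= (1 - theta) * decrease.
  apply: (@le_trans _ _ ((L + Bmax / 2) * (K * alpha) ^+ 2)).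
    apply: ler_wpM2l; first exact: ltW.
    by apply: lerXn2r; rewrite ?nnegrE ?enorm_ge0// mulr_ge0// ltW.
  apply: (@le_trans _ _ ((1 - theta) * (C7 * g * alpha))); last first.
    apply: ler_wpM2l; first by case/andP: theta01 => _ /ltW; rewrite subr_ge0.
    by move: dec; rewrite minE.
  have : alpha <= g * (C7 * (1 - theta) / ((L + Bmax / 2) * K ^+ 2)).
    apply: (le_trans small); apply: ler_pM; first exact: ltW.
    - rewrite le_min (divr_ge0 ler01 (ltW Bmax0)) andbT.
      apply: divr_ge0; last by apply: mulr_ge0; [exact: ltW|exact: sqr_ge0].
      apply: mulr_ge0; first exact: ltW.
      by case/andP: theta01 => _ /ltW; rewrite subr_ge0.
    - exact: gam_le.
    - by rewrite ge_min lexx.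
  have q0 : 0 < (L + Bmax / 2) * K ^+ 2 by rewrite mulr_gt0// exprn_gt0.
  rewrite mulrA ler_pdivlMr// => h.
  have := ler_wpM2l alpha0 h.
  rewrite exprMn; move: (K ^+ 2) (L + Bmax / 2) => k2 q; lra.
move: h1 h2 h3 h4 Du.
move: decrease (dot (gradient f x) u) (dot u (B *m u)) (enorm u ^+ 2) (f (x + u)) => D a b n y.
nra.
Qed.

End Step.

(** Rounding the exponent up overshoots [y] by at most one factor [b]; this accounts for the [+ 1]
    in the exponent [c + 1] of [gamma1] in [h_eps]. *)
Lemma ceil_logb_bounds (R : realType) (b y : R) : 0 < b < 1 -> 0 < y <= 1 ->
  exists2 n : nat, Num.ceil (logb b y) = n%:Z & b * y <= b ^+ n <= y.
Proof.
move=> /andP[b0 b1] /andP[y0 y1]; have lb : ln b < 0 by rewrite ln_lt0// b0.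
have ly : ln y <= 0 by apply: ln_le0.
have l0 : 0 <= logb b y by rewrite /logb -mulrNN -invrN; apply: divr_ge0; rewrite oppr_ge0// ltW.
have c0 : 0 <= Num.ceil (logb b y) by rewrite -(ler_int R); apply: le_trans l0 _; exact: ceil_ge.
exists `|Num.ceil (logb b y)|%N; first by rewrite gez0_abs.
set n := `|_|%N.
have nE : n%:R = (Num.ceil (logb b y))%:~R :> R by rewrite -[n%:R]/((n%:Z)%:~R) /n gez0_abs.
have h1 : logb b y <= n%:R by rewrite nE; exact: ceil_ge.
have h2 : n%:R < logb b y + 1.
  rewrite nE -ltrBlDr; have := ceilB1_lt (logb b y); by rewrite intrB.
have E : b ^+ n = expR (n%:R * ln b) by rewrite expRM_natl lnK ?posrE.
rewrite E; apply/andP; split.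
  have -> : b * y = expR (ln b + ln y) by rewrite expRD !lnK ?posrE.
  rewrite ler_expR -(subrK (ln b) (n%:R * ln b)) addrC lerD2r.
  have -> : n%:R * ln b - ln b = (n%:R - 1) * ln b by ring.
  rewrite -ler_ndivlMr//; apply: ltW; rewrite ltrBlDr; exact: h2.
rewrite -[X in _ <= X](lnK (x := y)) ?posrE// ler_expR -ler_ndivrMr//.
Qed.

(** * The bound along one sample path *)

Section Path.
Context {R : realType} {l d : nat}.
Variables (f : 'cV[R]_d -> R) (L fstar alpha_max gamma1 theta Bmax C7 : R).
Variables (x0 : 'cV[R]_d) (e eps K : R) (c p N : nat).
Variables (S : nat -> 'M[R]_(l, d)) (B : nat -> 'M[R]_d) (shat : nat -> 'cV[R]_l).
Variables (x : nat -> 'cV[R]_d) (alpha : nat -> R) (good : nat -> bool).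
Hypotheses (hf : continuously_differentiable f) (hL : lipschitz_gradient L f) (L0 : 0 <= L).
Hypotheses (theta01 : 0 < theta < 1) (Bmax0 : 0 < Bmax) (C70 : 0 < C7).
Hypotheses (e01 : 0 < e < 1) (eps0 : 0 < eps) (K0 : 0 < K) (c0 : (0 < c)%N).
Hypotheses (am0 : 0 < alpha_max) (g01 : 0 < gamma1 < 1) (hfstar : forall z, fstar <= f z).

Let gamma2 := gamma1 ^- c.
Let alpha0 := alpha_max * gamma1 ^+ p.
Let bound := Num.min (C7 * (1 - theta) / ((L + Bmax / 2) * K ^+ 2)) (1 / Bmax).
Let alpha_low := Num.sqrt (1 - e) * eps * bound.
Let h_eps := theta * C7 * (1 - e) * eps ^+ 2 * gamma1 ^+ c.+1
    * Num.min bound (alpha0 / (Num.sqrt (1 - e) * eps * gamma2)).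
Let tau_alpha :=
    Num.ceil (logb gamma1 (Num.min (alpha_low / alpha0) (1 / gamma2))).

Hypothesis x_init : x 0 = x0.
Hypothesis alpha_init : alpha 0 = alpha0.
Hypothesis step : forall k, (k < N)%N ->
  tr_iteration f alpha_max gamma1 gamma2 theta Bmax C7
      (S k) (B k) (shat k) (x k) (alpha k) (x k.+1) (alpha k.+1).
Hypothesis good_norm : forall k, (k < N)%N -> good k ->
  (1 - e) * dot (gradient f (x k)) (gradient f (x k)) <=
  dot (S k *m gradient f (x k)) (S k *m gradient f (x k)).
Hypothesis good_opnorm : forall k, (k < N)%N -> good k ->
  forall u, enorm ((S k)^T *m u) <= K * enorm u.
Hypothesis large : forall k, (k < N)%N -> eps < enorm (gradient f (x k)).

Let acc k := accepted f theta (S k) (B k) (x k) (shat k).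
Let a := radius_exponent p c acc.
Let gam := Num.sqrt (1 - e) * eps.

Let g0 : 0 < gamma1. Proof. by case/andP: g01. Qed.
Let gam0 : 0 < gam.
Proof. by case/andP: e01 => _ e1; rewrite mulr_gt0// sqrtr_gt0 subr_gt0. Qed.
Let alpha00 : 0 < alpha0. Proof. by rewrite mulr_gt0// exprn_gt0. Qed.
Let bound0 : 0 < bound.
Proof.
have LB : 0 < L + Bmax / 2 by rewrite ltr_wpDl// divr_gt0.
case/andP: theta01 => _ t1.
rewrite lt_min; apply/andP; split; last exact: divr_gt0.
by apply: divr_gt0; apply: mulr_gt0 => //; [rewrite subr_gt0|exact: exprn_gt0].
Qed.

Let radiusE k : (k <= N)%N -> alpha k = alpha_max * gamma1 ^+ a k.
Proof.
elim: k => [_|k IH kN]; first by rewrite alpha_init.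
have [_ _ _] := step kN; rewrite -/(accepted f theta (S k) (B k) (x k) (shat k)) -/(acc k).
rewrite /a /= -/a IH ?(ltnW kN)//; case: ifP => _ [_ ->].
  exact: min_radius_expansion.
exact: etrans (mulrCA _ _ _) (congr1 _ (esym (exprS _ _))).
Qed.

Let alpha_ge0 k : (k <= N)%N -> 0 <= alpha k.
Proof. by move=> kN; rewrite radiusE// mulr_ge0 ?exprn_ge0// ltW. Qed.

Theorem count_good_bound :
  0 < h_eps /\
  (\sum_(k < N) good k)%:R <= (f x0 - fstar) / h_eps + tau_alpha%:~R / (1 + c%:R) +
    c%:R * N%:R / (1 + c%:R).
Proof.
pose y := Num.min (alpha_low / alpha0) (1 / gamma2).
have gc0 : 0 < gamma1 ^+ c by exact: exprn_gt0.
have g2E : 1 / gamma2 = gamma1 ^+ c by rewrite /gamma2 div1r invrK.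
have y0 : 0 < y by rewrite lt_min g2E gc0 andbT divr_gt0// mulr_gt0.
have y1 : y <= 1.
  by case/andP: g01 => _ g1; rewrite ge_min g2E exprn_ile1 ?orbT// ltW.
have [|tau tauE /andP[tau_lo tau_hi]] := @ceil_logb_bounds R gamma1 y g01; first by rewrite y0.
(* In this form [gamma1^(c + 1) alpha0 y] is a lower bound for the radius at a counted success: its
   exponent is at most [p + tau + c], and [gamma1^tau >= gamma1 y]. *)
have h_epsE : h_eps = theta * (C7 * gam * (gamma1 ^+ c.+1 * (alpha0 * y))).
  have -> : alpha0 * y = gam * Num.min bound (alpha0 / (gam * gamma2)).
    rewrite /y (minr_pMr _ _ (ltW alpha00)) [RHS](minr_pMr _ _ (ltW gam0)).
    congr Num.min; first by rewrite mulrC (divfK (lt0r_neq0 alpha00)).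
    have gN : gamma2 != 0 by rewrite invr_neq0// lt0r_neq0.
    by move: gamma2 gam gN (lt0r_neq0 gam0) => q r qN rN; field; rewrite qN rN.
  have se : 1 - e = Num.sqrt (1 - e) ^+ 2.
    by rewrite sqr_sqrtr// subr_ge0 ltW//; case/andP: e01.
  rewrite /h_eps {1}se -/gam -/gamma2; move: (Num.min bound _) => m.
  by rewrite /gam; ring.
have ay0 : 0 < gamma1 ^+ c.+1 * (alpha0 * y) by rewrite mulr_gt0 ?mulr_gt0// exprn_gt0.
have theta0 : 0 < theta by case/andP: theta01.
have heps0 : 0 < h_eps.
  by rewrite h_epsE; apply: mulr_gt0 => //; apply: mulr_gt0 => //; exact: mulr_gt0.
split; first exact: heps0.
(* From the exponent [p + tau] on, the radius is at most [alpha0 y <= alpha_low]. *)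
have Hacc k : (k < N)%N -> good k -> (p + tau <= a k)%N -> acc k.
  move=> kN gk hk; have [[_ Bop] sal dec _] := step kN.
  apply: (small_radius_accepted hf hL L0 theta01 Bmax0 C70 e01 eps0 K0 Bop sal _ dec
    (good_norm kN gk) (large kN) (good_opnorm kN gk)).
    by apply: alpha_ge0; exact: ltnW.
  rewrite radiusE; last exact: ltnW.
  apply: (@le_trans _ _ (alpha0 * gamma1 ^+ tau)).
    rewrite /alpha0 -mulrA -exprD; apply: ler_wpM2l; first exact: ltW.
    by case/andP: g01 => h0 h1; apply: ler_wiXn2l => //; exact: ltW.
  rewrite mulrC -ler_pdivlMr//; apply: (le_trans tau_hi).
  by rewrite /y ge_min lexx.
have H := @count_good_steps N p (p + tau) c acc good c0 (leq_addr _ _) Hacc.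
pose ls k := low_success p (p + tau) c acc good k.
have dec_step k : (k < N)%N -> (ls k)%:R * h_eps <= f (x k) - f (x k.+1).
  move=> kN; have [[_ Bop] sal dec upd] := step kN.
  have ak0 : 0 <= alpha k by apply: alpha_ge0; exact: ltnW.
  have D0 := decrease_ge0 C70 ak0 dec.
  move: upd; rewrite -/(accepted f theta (S k) (B k) (x k) (shat k)) -/(acc k).
  rewrite /ls /low_success; case E : (acc k) => -[-> _]; last by rewrite andbF mul0r subrr.
  have E' := E; rewrite /acc /accepted in E'; apply: le_trans E'.
  case: (boolP [&& good k, _ & _]) => [/and3P[gk _ hk]|_]; last first.
    by rewrite mul0r mulr_ge0// ltW.
  rewrite mul1r h_epsE; apply: ler_wpM2l; first exact: ltW.
  apply: le_trans (decrease_ge Bmax0 C70 e01 eps0 Bop ak0 dec (good_norm kN gk) (large kN)).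
  apply: ler_wpM2l; first by apply: mulr_ge0; exact: ltW.
  rewrite le_min; apply/andP; split.
    rewrite radiusE; last exact: ltnW.
    apply: (@le_trans _ _ (alpha_max * gamma1 ^+ (p + tau + c))); last first.
      apply: ler_wpM2l; first exact: ltW.
      by case/andP: g01 => h0 h1; apply: ler_wiXn2l => //; exact: ltW.
    have -> : gamma1 ^+ c.+1 * (alpha0 * y) = alpha0 * (gamma1 * y) * gamma1 ^+ c.
      by rewrite exprS -mulrA [RHS]mulrC (mulrCA gamma1) (mulrCA gamma1).
    have -> : alpha_max * gamma1 ^+ (p + tau + c) = alpha0 * gamma1 ^+ tau * gamma1 ^+ c.
      by rewrite !exprD !mulrA.
    by apply: ler_wpM2r; [exact: ltW|apply: ler_wpM2l => //; exact: ltW].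
  apply: (@le_trans _ _ (alpha0 * y)).
    case/andP: g01 => h0 h1; apply: ler_piMl; first by apply: mulr_ge0; exact: ltW.
    by apply: exprn_ile1; exact: ltW.
  apply: (@le_trans _ _ alpha_low).
    by rewrite mulrC -ler_pdivlMr// /y ge_min lexx.
  rewrite /alpha_low -/gam; apply: ler_wpM2l; first exact: ltW.
  by rewrite /bound ge_min div1r lexx orbT.
have tele n : (n <= N)%N -> (\sum_(k < n) ls k)%:R * h_eps <= f x0 - f (x n).
  elim: n => [_|n IH nN]; first by rewrite big_ord0 mul0r x_init subrr.
  rewrite big_ord_recr natrD mulrDl; have := IH (ltnW nN); have := dec_step n nN.
  by move: (_ * h_eps) (_ * h_eps) => u v; lra.
have tot : (\sum_(k < N) ls k)%:R <= (f x0 - fstar) / h_eps.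
  rewrite ler_pdivlMr//; apply: (le_trans (tele N (leqnn N))).
  by rewrite lerD2l lerN2.
have {}H : (c.+1 * \sum_(k < N) good k <= c.+1 * \sum_(k < N) ls k + c * N + tau)%N.
  by move: H; rewrite addKn.
have {}H : (1 + c%:R) * (\sum_(k < N) good k)%:R <=
    (1 + c%:R) * (\sum_(k < N) ls k)%:R + c%:R * N%:R + tau%:R :> R.
  by rewrite !nat1r -!natrM -!natrD ler_nat.
have c1 : 0 < 1 + c%:R :> R by rewrite ltr_pwDl.
rewrite /tau_alpha -/y tauE -addrA -mulrDl -lerBlDl ler_pdivlMr// mulrBl lerBlDl.
rewrite [_%:~R](_ : _ = tau%:R)//.
have := ler_wpM2l (ltW c1) tot.
move: H; move: (_%:R) (_%:R) ((f x0 - fstar) / h_eps) => u v M.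
by move=> H1 H2; rewrite mulrC (mulrC M); lra.
Qed.

End Path.

Lemma random_history_sub disp (T : measurableType disp) (R : realType) m n
    (A : T -> 'M[R]_(m, n)) (G : set (set T)) : (forall B, G B -> measurable B) ->
  @random_matrix _ (g_sigma_algebraType G) R m n A -> random_matrix A.
Proof.
move=> Gm mA ij _ U mU; have := mA ij measurableT U mU; move: (_ `&` _).
by apply: smallest_sub => //; exact: sigma_algebra_measurable.
Qed.

(** If no index up to [N] qualifies, [N + 1] is a lower bound of the set, also when the set is
    empty. *)
Lemma N_eps_leP (R : realType) d (f : 'cV[R]_d -> R) (eps : R) (x : nat -> 'cV[R]_d) N :
  (N_eps f eps x <= (N%:R)%:E)%E <->
  exists2 k, (k <= N)%N & enorm (gradient f (x k)) <= eps.
Proof.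
split; last by move=> [k kN hk]; apply: ge_ereal_inf; exists (k%:R)%:E;
  [exists k|rewrite lee_fin ler_nat].
move=> H; apply: contrapT => Hn.
suff : ((N.+1%:R)%:E <= N_eps f eps x)%E.
  by move=> /le_trans/(_ H); rewrite lee_fin ler_nat ltnn.
apply: le_ereal_inf_tmp => _ [k /= hk <-]; rewrite lee_fin ler_nat ltnNge.
by apply/negP => kN; apply: Hn; exists k.
Qed.

Theorem theorem4p5p4
  (R : realType) (disp : measure_display) (T : measurableType disp)
  (P : probability T R) (l d c p N : nat)
  (f : 'cV[R]_d -> R) (L fstar : R)
  (alpha_max gamma1 theta Bmax C7 : R) (x0 : 'cV[R]_d)
  (eps epsS deltaS2 delta1 : R)
  (Sk : nat -> T -> 'M[R]_(l, d)) (Bk : nat -> T -> 'M[R]_d)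
  (shat : nat -> T -> 'cV[R]_l)
  (x : nat -> T -> 'cV[R]_d) (alpha : nat -> T -> R)
  (hl : (0 < l)%N) (hld : (l <= d)%N) (hc : (0 < c)%N) (hp : (0 < p)%N)
  (hgamma1 : 0 < gamma1 < 1) (htheta : 0 < theta < 1)
  (halpha_max : 0 < alpha_max) (hBmax : 0 < Bmax) (hC7 : 0 < C7)
  (hf : continuously_differentiable f) (hL : lipschitz_gradient L f)
  (hfstar : (exists z, f z = fstar) /\ (forall z, fstar <= f z))
  (heps : 0 < eps) (hdeltaS2 : 0 < deltaS2) (hepsS : 0 < epsS < 1)
  (hdelta1 : 0 < delta1) :
  let gamma2 := gamma1 ^- c in
  let alpha0 := alpha_max * gamma1 ^+ p in
  let deltaS := expR (- (l%:R * epsS ^+ 2 / 4)) + deltaS2 in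
  let ratio := c%:R / (c%:R + 1) ^+ 2 in
  let factor := ((1 - deltaS) * (1 - delta1) - 1 + ratio)^-1 in
  let Smax := 1 + Num.sqrt (d%:R / l%:R)
                + Num.sqrt (2 * ln (1 / deltaS2) / l%:R) in
  let bound := Num.min (C7 * (1 - theta) / ((L + Bmax / 2) * Smax ^+ 2))
                       (1 / Bmax) in
  let alpha_low := Num.sqrt (1 - epsS) * eps * bound in
  let h_eps := theta * C7 * (1 - epsS) * eps ^+ 2 * gamma1 ^+ c.+1
    * Num.min bound (alpha0 / (Num.sqrt (1 - epsS) * eps * gamma2)) in
  let tau_alpha :=
    Num.ceil (logb gamma1 (Num.min (alpha_low / alpha0) (1 / gamma2))) in
  deltaS < ratio ->
  0 < factor ->
  factor * ((f x0 - fstar) / h_eps + tau_alpha%:~R / (1 + c%:R)) <= N%:R ->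
  tr_run P f alpha_max gamma1 gamma2 theta Bmax C7 x0 alpha0 N
    Sk Bk shat x alpha ->
  ((1 - expR (- (delta1 ^+ 2 / 2 * (1 - deltaS) * N%:R)))%:E <=
   P [set w | N_eps f eps (x ^~ w) <= (N%:R)%:E])%E.
Proof.
move=> gamma2 alpha0 deltaS ratio factor Smax bound alpha_low h_eps tau_alpha.
move=> hdS hfac hN run.
have hd : (0 < d)%N by exact: leq_trans hld.
have L0 := lipschitz_ge0 hL hd.
have lR : (0 : R) < l%:R by rewrite ltr0n.
have C0 : (0 : R) < c%:R by rewrite ltr0n.
have q1 : (0 : R) < c%:R + 1 by rewrite addr_gt0.
have ratio_le : ratio <= (c%:R + 1)^-1.
  rewrite /ratio ler_pdivrMr ?exprn_gt0// expr2 mulrA mulVf ?gt_eqF// mul1r.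
  by rewrite lerDl.
have ratio_lt1 : ratio < 1.
  by apply: (le_lt_trans ratio_le); rewrite invf_lt1// ltrDr.
have dS0 : 0 <= deltaS by rewrite addr_ge0 ?expR_ge0// ltW.
have dS1 : deltaS < 1 by exact: lt_trans hdS ratio_lt1.
have d21 : deltaS2 < 1.
  by apply: le_lt_trans dS1; rewrite lerDr expR_ge0.
have kappa0 : 0 < (1 - deltaS) * (1 - delta1) - 1 + ratio by rewrite -invr_gt0.
(* Forced by the positivity of [factor], since [ratio < 1]. *)
have d1 : delta1 < 1.
  rewrite -subr_gt0 -(pmulr_rgt0 _ (_ : 0 < 1 - deltaS)) ?subr_gt0//.
  have aux (u v : R) : 0 < u - 1 + v -> v < 1 -> 0 < u by lra.
  exact: aux kappa0 ratio_lt1.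
(* Chosen so that [exp(- t^2 / 2) = deltaS2]. *)
pose t := Num.sqrt (2 * ln (1 / deltaS2)).
have ln0 : 0 < 2 * ln (1 / deltaS2).
  by rewrite mulr_gt0// ln_gt0// div1r invf_gt1.
have t0 : 0 < t by rewrite sqrtr_gt0.
have SmaxE : Smax = 1 + Num.sqrt (d%:R / l%:R) + t / Num.sqrt l%:R.
  by rewrite /Smax (sqrtrM _ (ltW ln0)) sqrtrV// ltW.
have Smax0 : 0 < Smax.
  by rewrite /Smax -addrA ltr_pwDl// addr_ge0 ?sqrtr_ge0.
have dSE : deltaS = expR (- (l%:R * epsS ^+ 2 / 4)) + expR (- (t ^+ 2 / 2)).
  rewrite /deltaS /t sqr_sqrtr ?(ltW ln0)//; congr (_ + _).
  by rewrite div1r (mulrC 2) mulfK ?pnatr_eq0// lnV ?posrE// opprK lnK ?posrE.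
pose Hist k := g_sigma_algebraType (history_generator Sk Bk shat k).
pose Bad k := sketch_failure f Sk x epsS t k.
have sub_hist k B : (k <= N)%N -> history Sk Bk shat k B -> measurable B.
  move=> kN; move: B; apply: smallest_sub; first exact: sigma_algebra_measurable.
  by move=> B; exact: (history_generator_measurable run kN).
have mx k : (k <= N)%N -> random_matrix (x k).
  move=> kN; apply: (random_history_sub (G := history_generator Sk Bk shat k)).
    by move=> B; apply: (history_generator_measurable run kN).
  exact: (random_iterate hf run).
pose A := [set w | (N_eps f eps (x ^~ w) <= (N%:R)%:E)%E].
have mA : measurable A.
  rewrite (_ : A = \bigcup_(k in [set k | (k <= N)%N])
      [set w | enorm (gradient f (x k w)) <= eps]).
    apply: bigcup_measurable => k kN; apply: measurable_le_set => //.
    by apply: measurable_enorm; apply: (random_gradient hf.2); exact: mx.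
  apply/seteqP; split => w /=.
    by move/N_eps_leP => [k kN hk]; exists k.
  by move=> [k kN hk]; apply/N_eps_leP; exists k.
(* The Chernoff threshold. A path whose gradients all stay large has at most [q] good iterations,
   hence at most [s], their number being an integer. *)
pose q := (1 - deltaS) * (1 - delta1) * N%:R.
have q0 : 0 <= q by rewrite !mulr_ge0// subr_ge0 ltW.
pose s := Num.truncn q.
have sq : s%:R <= q by rewrite truncn_le.
have tail : (P [set w | (good_count Bad N w <= s)%N] <=
   (expR (- (delta1 ^+ 2 / 2 * (1 - deltaS) * N%:R)))%:E)%E.
  have d01 : 0 <= deltaS <= 1 by rewrite dS0 ltW.
  have e01 : 0 < delta1 < 1 by rewrite hdelta1.
  apply: (good_count_tail (Fl := fun k => history Sk Bk shat k) _ _ _ sub_hist _ _ _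
    e01 d01 sq).
  - by move=> k; exact: (@measurableT _ (Hist k)).
  - by move=> k B; exact: (@measurableC _ (Hist k)).
  - by move=> k B B'; exact: (@measurableI _ (Hist k)).
  - by move=> k B kN; exact: (le_history (leqnSn k)).
  - by move=> k kN; exact: (history_sketch_failure hf run).
  - by move=> k F kN HF; rewrite dSE; exact: (sketch_failure_le hf run hl hld hepsS t0 kN HF).
have sub : ~` A `<=` [set w | (good_count Bad N w <= s)%N].
  move=> w /= wA.
  have large k : (k <= N)%N -> eps < enorm (gradient f (x k w)).
    move=> kN; rewrite ltNge; apply/negP => hk; apply: wA; apply/N_eps_leP.
    by exists k.
  pose good k := `[< ~ Bad k w >].
  have good_norm k : (k < N)%N -> good k ->
      (1 - epsS) * dot (gradient f (x k w)) (gradient f (x k w)) <=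
      dot (Sk k w *m gradient f (x k w)) (Sk k w *m gradient f (x k w)).
    by move=> _ /asboolP nB; rewrite leNgt; apply/negP => H; apply: nB; left.
  have good_opnorm k : (k < N)%N -> good k ->
      forall u, enorm ((Sk k w)^T *m u) <= Smax * enorm u.
    move=> _ /asboolP nB; apply: not_opnorm_excess; first exact: ltW.
    by rewrite SmaxE => H; apply: nB; right.
  have [x_init alpha_init] := tr_run_init run w.
  have [hpos cnt] := count_good_bound hf hL L0 htheta hBmax hC7 hepsS heps Smax0 hc
    halpha_max hgamma1 hfstar.2 (x := x ^~ w) (alpha := alpha ^~ w)
    x_init alpha_init (fun k kN => tr_run_step run w kN) good_norm good_opnorm
    (fun k kN => large k (ltnW kN)).
  rewrite truncn_ge_nat//; apply: (le_trans cnt).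
  rewrite -/bound -/alpha_low -/alpha0 -/gamma2 -/h_eps -/tau_alpha.
  have hM : (f x0 - fstar) / h_eps + tau_alpha%:~R / (1 + c%:R) <=
      ((1 - deltaS) * (1 - delta1) - 1 + ratio) * N%:R.
    by rewrite -ler_pdivrMl.
  apply: (le_trans (lerD hM (lexx _))).
  rewrite /q mulrAC -mulrDl; apply: ler_wpM2r => //.
  (* The counting argument adds [c N / (c + 1)], and [ratio + c / (c + 1) <= 1] because
     [ratio = c / (c + 1)^2 <= 1 / (c + 1)]. *)
  have -> : c%:R / (1 + c%:R) = 1 - (c%:R + 1)^-1 :> R by field; rewrite gt_eqF// addrC.
  have aux (u v r : R) : r <= v -> u - 1 + r + (1 - v) <= u by lra.
  exact: aux ratio_le.
have mG : measurable [set w | (good_count Bad N w <= s)%N].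
  apply: (measurable_good_count (Fl := fun k => history Sk Bk shat k) sub_hist _ s (leqnn N)).
  by move=> k kN; exact: (history_sketch_failure hf run).
have {}tail := le_trans (le_measure P _ _ sub) tail.
rewrite -/A -[A]setCK probability_setC; last exact: measurableC.
rewrite EFinB; apply: leeB => //; apply: tail; rewrite ?inE//; exact: measurableC.
Qed.
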